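(* Let $\mathsf{As}$ be the associative operad over $\mathbb Q$ and $[\mathsf{As}]^{\mathbb Z_2}$ its suboperad of invariants under the automorphism $\tau(x_{\sigma(1)}\cdots x_{\sigma(n)})=(-1)^{n-1}x_{\sigma(n)}\cdots x_{\sigma(1)}$. The operad $[\mathsf{As}]^{\mathbb Z_2}$ is generated by the binary operation $\nu_2:=x_1x_2-x_2x_1$ and the ternary operation $\mu_3:=\sum_{\sigma\in S_3}x_{\sigma(1)}x_{\sigma(2)}x_{\sigma(3)}$, subject to the following relations (together with all those obtained from them by permutations of the inputs): $$\nu_2(\nu_2(x_1,x_2),x_3)+\nu_2(\nu_2(x_2,x_3),x_1)+\nu_2(\nu_2(x_3,x_1),x_2)=0,$$ $$\nu_2(\mu_3(x_1,x_2,x_3),x_4)=\mu_3(x_1,x_2,\nu_2(x_3,x_4))+\mu_3(x_1,\nu_2(x_2,x_4),x_3)+\mu_3(\nu_2(x_1,x_4),x_2,x_3),$$ $$\mu_3(\mu_3(x_1,x_2,x_4),x_3,x_5)-\mu_3(\mu_3(x_1,x_2,x_3),x_4,x_5)=B(x_1,x_2,x_4,x_3,x_5)-B(x_1,x_2,x_3,x_4,x_5),$$ where $B$ is the multilinear operation, symmetric in its first three and in its last two arguments, determined by $$B(a,a,a,b,b)=3\mu_3(\nu_2(a,b),\nu_2(a,b),a)+6\mu_3(\nu_2(a,\nu_2(a,b)),a,b)+\tfrac65\,\nu_2(b,\nu_2(a,\nu_2(a,\nu_2(a,b))))+\tfrac{18}5\,\nu_2(a,\nu_2(b,\nu_2(a,\nu_2(b,a)))).$$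 These relations form a Gröbner basis with respect to the degree-path-lexicographic ordering of monomials with the convention $\nu_2>\mu_3$.
   Context: $\mathsf{As}(n)$ has basis the words $x_{\sigma(1)}\cdots x_{\sigma(n)}$, $\sigma\in S_n$; $\tau$ is an operad automorphism of order $2$ (it sends the product $x_1x_2$ to $-x_2x_1$), so its invariants form a suboperad. The generator $\nu_2$ is antisymmetric and $\mu_3$ is totally symmetric. Gröbner bases and the ordering of tree monomials are meant in the sense of Dotsenko–Khoroshkin, for the associated shuffle operad.
   Formalization: The ordering is made precise: monomials are compared by arity, number of μ3, then path words by number of ν2 (not by length), ties lexicographically with ν2 > end of word > μ3, then leaf order reversed; with length-first comparison the Gröbner claim fails in arity 5. *)

(* Defs.v *)
(* MathComp, with multinomials for formal linear combinations. *)
From HB Require Import structures.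
From mathcomp Require Import all_boot all_order all_fingroup all_algebra.
From mathcomp Require Import finmap.
From mathcomp Require Import monalg.

Set Implicit Arguments.
Unset Strict Implicit.
Unset Printing Implicit Defensive.

Import GRing.Theory Num.Theory.
Local Open Scope ring_scope.

(* Inputs are numbered from 1: arity n uses the labels 1, ..., n, and a
   permutation of the inputs is a map on labels permuting them. *)
Definition permutes (n : nat) (s : nat -> nat) : Prop :=
  perm_eq [seq s i | i <- iota 1 n] (iota 1 n).

(** * The associative operad *)

(* The free associative algebra on x_1, x_2, ...; its multilinear part in
   x_1, ..., x_n is As(n), and operadic composition is substitution. *)
Notation freeAlg := {malg rat[{fmonom nat}]}.

Definition var (i : nat) : freeAlg := << fmu i >>.

(* As(0) = 0: As is not unital. *)
Definition As (n : nat) (a : freeAlg) : Prop :=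
  forall w : {fmonom nat}, w \in msupp a ->
    (0 < n)%N /\ perm_eq (fmonom_val w) (iota 1 n).

Definition alg_subst (s : nat -> freeAlg) (a : freeAlg) : freeAlg :=
  \sum_(w <- msupp a) a@_w *: \prod_(i <- fmonom_val w) s i.

Definition tau (a : freeAlg) : freeAlg :=
  \sum_(w <- msupp a)
     (a@_w * (-1) ^+ (size (fmonom_val w)).-1) *:
       << FMonom (rev (fmonom_val w)) >>.

Definition As_inv (n : nat) (a : freeAlg) : Prop := As n a /\ tau a = a.

Definition nu2 : freeAlg := var 1 * var 2 - var 2 * var 1.

Definition mu3 : freeAlg :=
  \sum_(s : 'S_3) \prod_(i < 3) var (s i).+1.

(** * The free operad on a binary and a ternary operation *)

Inductive tree : predArgType :=
  | Leaf of nat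
  | Nu of tree & tree
  | Mu of tree & tree & tree.

Coercion Leaf : nat >-> tree.
Arguments Leaf _%_N.
Arguments Nu (_ _)%_N.
Arguments Mu (_ _ _)%_N.

Fixpoint tree_encode (t : tree) : GenTree.tree nat :=
  match t with
  | Leaf i => GenTree.Leaf i
  | Nu a b => GenTree.Node 2 [:: tree_encode a; tree_encode b]
  | Mu a b c => GenTree.Node 3 [:: tree_encode a; tree_encode b; tree_encode c]
  end.

Fixpoint tree_decode (t : GenTree.tree nat) : tree :=
  match t with
  | GenTree.Leaf i => Leaf i
  | GenTree.Node _ [:: a; b] => Nu (tree_decode a) (tree_decode b)
  | GenTree.Node _ [:: a; b; c] =>
      Mu (tree_decode a) (tree_decode b) (tree_decode c)
  | _ => Leaf 0
  end.

Lemma tree_encodeK : cancel tree_encode tree_decode.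
Proof. by elim=> //= [a -> b ->|a -> b -> c ->]. Qed.

HB.instance Definition _ := Choice.copy tree (can_type tree_encodeK).

Notation treeMod := {malg rat[tree]}.

Definition lincomb (s : seq (rat * tree)) : treeMod :=
  \sum_(p <- s) p.1 *: << p.2 >>.

Fixpoint leaves (t : tree) : seq nat :=
  match t with
  | Leaf i => [:: i]
  | Nu a b => leaves a ++ leaves b
  | Mu a b c => leaves a ++ leaves b ++ leaves c
  end.

Fixpoint tree_subst (s : nat -> tree) (t : tree) : tree :=
  match t with
  | Leaf i => s i
  | Nu a b => Nu (tree_subst s a) (tree_subst s b)
  | Mu a b c => Mu (tree_subst s a) (tree_subst s b) (tree_subst s c)
  end.

Definition tree_relabel (s : nat -> nat) : tree -> tree :=
  tree_subst (fun i => Leaf (s i)).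

(* Arity n of the free symmetric operad on one binary and one ternary
   operation without symmetry.  The symmetries of nu2 and mu3 are imposed by
   [symmetry_rel] below. *)
Definition free_op (n : nat) (f : treeMod) : Prop :=
  forall t, t \in msupp f -> perm_eq (leaves t) (iota 1 n).

Definition relabel (s : nat -> nat) (f : treeMod) : treeMod :=
  \sum_(t <- msupp f) f@_t *: << tree_relabel s t >>.

(* Bilinear extension of: graft t, relabelled by v, on the leaf i of s, the
   other leaves of s being relabelled by u. *)
Definition graft (i : nat) (u v : nat -> nat) (f g : treeMod) : treeMod :=
  \sum_(s <- msupp f) \sum_(t <- msupp g) (f@_s * g@_t) *:
    << tree_subst (fun j => if j == i then tree_relabel v t else Leaf (u j))
                  s >>.

(* The partial composition of f with g at the input i, g having arity n. *)
Definition pcomp (i n : nat) : treeMod -> treeMod -> treeMod :=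
  graft i (fun j => if (j < i)%N then j else (j + n).-1)
          (fun k => (k + i).-1).

Inductive operad_ideal (G : nat -> treeMod -> Prop) : nat -> treeMod -> Prop :=
  | OI_gen n g : G n g -> operad_ideal G n g
  | OI_zero n : operad_ideal G n 0
  | OI_add n f g :
      operad_ideal G n f -> operad_ideal G n g -> operad_ideal G n (f + g)
  | OI_scale n c f : operad_ideal G n f -> operad_ideal G n (c *: f)
  | OI_perm n s f :
      permutes n s -> operad_ideal G n f -> operad_ideal G n (relabel s f)
  | OI_compl m n i f g : (0 < i <= m)%N ->
      operad_ideal G m f -> free_op n g ->
      operad_ideal G (m + n).-1 (pcomp i n f g)
  | OI_compr m n i f g : (0 < i <= m)%N ->
      free_op m f -> operad_ideal G n g ->
      operad_ideal G (m + n).-1 (pcomp i n f g).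

(* The operad morphism to As sending the generators to nu2 and mu3. *)
Fixpoint realize_tree (t : tree) : freeAlg :=
  match t with
  | Leaf i => var i
  | Nu a b =>
      alg_subst (fun i => nth 0 [:: realize_tree a; realize_tree b] i.-1) nu2
  | Mu a b c =>
      alg_subst (fun i => nth 0 [:: realize_tree a; realize_tree b;
                                    realize_tree c] i.-1) mu3
  end.

Definition realize (f : treeMod) : freeAlg :=
  \sum_(t <- msupp f) f@_t *: realize_tree t.

(** * The relations *)

Variant symmetry_rel : nat -> treeMod -> Prop :=
  | nu_antisymmetric :
      symmetry_rel 2 (lincomb [:: (1, Nu 1 2); (1, Nu 2 1)])
  | mu_symmetric (i j k : nat) : perm_eq [:: i; j; k] [:: 1; 2; 3]%N ->
      symmetry_rel 3 (lincomb [:: (1, Mu i j k); (-1, Mu 1 2 3)]).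

Definition jacobi : treeMod :=
  lincomb [:: (1, Nu (Nu 1 2) 3); (1, Nu (Nu 2 3) 1); (1, Nu (Nu 3 1) 2)].

Definition derivation : treeMod :=
  lincomb [:: (1, Nu (Mu 1 2 3) 4);
              (-1, Mu 1 2 (Nu 3 4));
              (-1, Mu 1 (Nu 2 4) 3);
              (-1, Mu (Nu 1 4) 2 3)].

(* A multilinear operation which becomes the prescribed B(a,a,a,b,b) for
   a1 = a2 = a3 = a and b1 = b2 = b. *)
Definition B_lift (a1 a2 a3 b1 b2 : tree) : seq (rat * tree) :=
  [:: (3, Mu (Nu a1 b1) (Nu a2 b2) a3);
      (6, Mu (Nu a1 (Nu a2 b1)) a3 b2);
      (6 / 5, Nu b1 (Nu a1 (Nu a2 (Nu a3 b2))));
      (18 / 5, Nu a1 (Nu b1 (Nu a2 (Nu b2 a3))))].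

(* Polarization: B is the average of [B_lift] over S_3 x S_2, the only
   multilinear operation with the required symmetry and the same values as
   [B_lift] on (a,a,a,b,b). *)
Definition B (a1 a2 a3 b1 b2 : tree) : treeMod :=
  \sum_(s : 'S_3) \sum_(r : 'S_2)
    let a i := nth a1 [:: a1; a2; a3] (s (inord i)) in
    let b i := nth b1 [:: b1; b2] (r (inord i)) in
    (3`! * 2`!)%:R^-1 *: lincomb (B_lift (a 0) (a 1) (a 2) (b 0) (b 1))%N.

Arguments B (_ _ _ _ _)%_N.

Lemma B_diag (a b : tree) : B a a a b b = lincomb (B_lift a a a b b).
Proof.
have nthc (x : tree) n k : nth x (nseq n x) k = x by rewrite nth_nseq if_same.
rewrite /B; under eq_bigr => s _ do under eq_bigr => r _ do
  rewrite !(nthc a 3) !(nthc b 2).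
rewrite !sumr_const -mulrnA -scaler_nat scalerA.
have -> : (#|'S_2| * #|'S_3|)%N = (3`! * 2`!)%N.
  by rewrite !card_Sn mulnC.
by rewrite mulfV ?scale1r.
Qed.

Definition associativity : treeMod :=
  lincomb [:: (1, Mu (Mu 1 2 4) 3 5); (-1, Mu (Mu 1 2 3) 4 5)]
  - (B 1 2 4 3 5 - B 1 2 3 4 5).

Variant defining_rel : nat -> treeMod -> Prop :=
  | rel_jacobi : defining_rel 3 jacobi
  | rel_derivation : defining_rel 4 derivation
  | rel_associativity : defining_rel 5 associativity.

Definition presentation_rel (n : nat) (f : treeMod) : Prop :=
  symmetry_rel n f \/ defining_rel n f.

(** * The free shuffle operad and Groebner bases *)

Fixpoint min_leaf (t : tree) : nat :=
  match t with
  | Leaf i => i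
  | Nu a b => minn (min_leaf a) (min_leaf b)
  | Mu a b c => minn (min_leaf a) (minn (min_leaf b) (min_leaf c))
  end.

Fixpoint is_shuffle (t : tree) : bool :=
  match t with
  | Leaf _ => true
  | Nu a b => [&& (min_leaf a < min_leaf b)%N, is_shuffle a & is_shuffle b]
  | Mu a b c => [&& (min_leaf a < min_leaf b < min_leaf c)%N,
                    is_shuffle a, is_shuffle b & is_shuffle c]
  end.

Definition shuffle_op (n : nat) (f : treeMod) : Prop :=
  forall t, t \in msupp f -> is_shuffle t /\ perm_eq (leaves t) (iota 1 n).

(* The shuffle tree equal to a given tree up to the symmetries of nu2 and mu3,
   with the sign so produced. *)
Fixpoint sort_tree (t : tree) : rat * tree :=
  match t with
  | Leaf i => (1, Leaf i)
  | Nu a b =>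
      let: (c, a') := sort_tree a in
      let: (d, b') := sort_tree b in
      if (min_leaf a < min_leaf b)%N then (c * d, Nu a' b')
      else (- (c * d), Nu b' a')
  | Mu a b c =>
      let: (d, a') := sort_tree a in
      let: (e, b') := sort_tree b in
      let: (g, c') := sort_tree c in
      let s := sort (fun x y => min_leaf x <= min_leaf y)%N [:: a'; b'; c'] in
      (d * e * g, Mu (nth a' s 0) (nth a' s 1) (nth a' s 2))
  end.

Definition shuffle_form (f : treeMod) : treeMod :=
  \sum_(t <- msupp f) (f@_t * (sort_tree t).1) *: << (sort_tree t).2 >>.

Variant shuffle_rel : nat -> treeMod -> Prop :=
  | ShuffleRel n s r : defining_rel n r -> permutes n s ->
      shuffle_rel n (shuffle_form (relabel s r)).

(* The data of a shuffle composition at the input i, in arities m and n: the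
   increasing maps u and v relabel the two factors by 1, ..., m + n - 1, the
   smallest input of the second factor taking the place of i. *)
Definition shuffle_data (m n i : nat) (u v : nat -> nat) : Prop :=
  [/\ (0 < i <= m)%N,
      {in iota 1 m &, {homo u : j k / (j < k)%N}},
      {in iota 1 n &, {homo v : j k / (j < k)%N}},
      u i = v 1%N
    & perm_eq ([seq u j | j <- iota 1 m & j != i] ++ [seq v k | k <- iota 1 n])
              (iota 1 (m + n).-1)].

Inductive shuffle_ideal (G : nat -> treeMod -> Prop) :
    nat -> treeMod -> Prop :=
  | SI_gen n g : G n g -> shuffle_ideal G n g
  | SI_zero n : shuffle_ideal G n 0
  | SI_add n f g :
      shuffle_ideal G n f -> shuffle_ideal G n g -> shuffle_ideal G n (f + g)
  | SI_scale n c f : shuffle_ideal G n f -> shuffle_ideal G n (c *: f)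
  | SI_compl m n i u v f g : shuffle_data m n i u v ->
      shuffle_ideal G m f -> shuffle_op n g ->
      shuffle_ideal G (m + n).-1 (graft i u v f g)
  | SI_compr m n i u v f g : shuffle_data m n i u v ->
      shuffle_op m f -> shuffle_ideal G n g ->
      shuffle_ideal G (m + n).-1 (graft i u v f g).

(* Divisibility of tree monomials: g occurs in the divisible tree as a
   subtree, the minimal leaves above its inputs being in the same order as
   the labels of these inputs. *)
Inductive divides (g : tree) : tree -> Prop :=
  | div_root s :
      {in leaves g &, {homo (fun i => min_leaf (s i)) :
                         i j / (i < j)%N >-> (i < j)%N}} ->
      divides g (tree_subst s g)
  | div_nu1 a b : divides g a -> divides g (Nu a b)
  | div_nu2 a b : divides g b -> divides g (Nu a b)
  | div_mu1 a b c : divides g a -> divides g (Mu a b c)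
  | div_mu2 a b c : divides g b -> divides g (Mu a b c)
  | div_mu3 a b c : divides g c -> divides g (Mu a b c).

Section Ordering.

Fixpoint lex_lt (T : eqType) (lt : rel T) (s t : seq T) : bool :=
  match s, t with
  | x :: s', y :: t' => lt x y || (x == y) && lex_lt lt s' t'
  | [::], _ :: _ => true
  | _, [::] => false
  end.

(* The word read from the root to the leaf i: true is nu2, false is mu3. *)
Fixpoint path_word (t : tree) (i : nat) : seq bool :=
  match t with
  | Leaf _ => [::]
  | Nu a b => true :: path_word (if i \in leaves a then a else b) i
  | Mu a b c => false :: path_word (if i \in leaves a then a
                                    else if i \in leaves b then b else c) i
  end.

Definition path_seq (t : tree) : seq (seq bool) :=
  [seq path_word t i | i <- iota 1 (size (leaves t))].

(* Lexicographic comparison with nu2 > 1 > mu3, where 1 is the end of the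
   word. *)
Fixpoint word_lex_lt (u v : seq bool) : bool :=
  match u, v with
  | x :: u', y :: v' => if x == y then word_lex_lt u' v' else y
  | [::], y :: _ => y
  | x :: _, [::] => ~~ x
  | [::], [::] => false
  end.

(* Words are compared by degree, nu2 having degree 1 and mu3 degree 0, then
   lexicographically.  This order is compatible with concatenation on both
   sides; the place of the end of the word in [word_lex_lt] is forced by
   that. *)
Definition word_lt (u v : seq bool) : bool :=
  let degree := count_mem true in
  (degree u < degree v)%N ||
  (degree u == degree v) && word_lex_lt u v.

Fixpoint mu_degree (t : tree) : nat :=
  match t with
  | Leaf _ => 0
  | Nu a b => mu_degree a + mu_degree b
  | Mu a b c => (mu_degree a + mu_degree b + mu_degree c).+1
  end.

(* The degree-path-lexicographic ordering: arity, degree in mu3, sequence of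
   path words, and finally the planar sequence of leaves, in the reverse
   lexicographic order.  Comparing path words by length instead of by their
   degree in nu2 would make mu3(nu2(x1,x2),x3,x4) and not
   nu2(x1,mu3(x2,x3,x4)) the leading monomial of one of the derivation
   relations, and the relations would no longer form a Groebner basis. *)
Definition tree_lt (s t : tree) : bool :=
  let arity x := size (leaves x) in
  [|| (arity s < arity t)%N |
   (arity s == arity t) &&
  [|| (mu_degree s < mu_degree t)%N |
   (mu_degree s == mu_degree t) &&
  [|| lex_lt word_lt (path_seq s) (path_seq t) |
   (path_seq s == path_seq t) && lex_lt ltn (leaves t) (leaves s)]]].

End Ordering.

Definition leading_monomial (f : treeMod) (t : tree) : Prop :=
  t \in msupp f /\ forall s, s \in msupp f -> s != t -> tree_lt s t.

(* G is a Groebner basis of the ideal of the free shuffle operad which it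
   generates. *)
Definition groebner_basis (G : nat -> treeMod -> Prop) : Prop :=
  forall n f t, shuffle_ideal G n f -> leading_monomial f t ->
    exists m g s, [/\ G m g, leading_monomial g s & divides s t].

(* Main.v *)
Require Import Defs.
From HB Require Import structures.
From mathcomp Require Import all_boot all_order all_fingroup all_algebra.
From mathcomp Require Import finmap.
From mathcomp Require Import monalg.
From mathcomp Require Import ring zify.

Set Implicit Arguments.
Unset Strict Implicit.
Unset Printing Implicit Defensive.

Import GRing.Theory Num.Theory.
Local Open Scope ring_scope.

(** The relations hold in every associative algebra, as an evaluation of
    noncommutative polynomials shows ([defining_rel_identity]), and operadic and
    shuffle compositions preserve this property.  So both ideals lie in the
    kernel of the realization, and the theorem follows from a count which
    replaces the confluence of S-polynomials.

    - Generation.  Up to sign, [tau] is the antipode of the free algebra, so the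
      invariants are the skew elements a = - S a.  They are spanned by the
      skew products w - S w of letters, and these are generated by induction on
      the length of w ([skew_generated_step]): modulo shorter skew products the
      factors commute; a product of even length is then congruent to its
      opposite, and one of odd length is obtained from the Jordan triple product
      abc + cba, which the two operations generate ([attained_triple]).

    - Reduction.  The leading monomials of the relations are nu2 applied to a
      product mu3, the bracketings nu2(nu2(a,b),c) with a < b < c, and all
      mu3-mu3 monomials except mu3(mu3(a,b,c),d,e) with a < b < c < d < e.  The
      monomials that avoid them are the iterated products
      mu3(mu3(mu3(l1,l2,l3),l4,l5),...) of an odd number of standard Lie
      monomials with increasing minimal leaves ([instance_or_normal]).  The
      order is compatible with contexts and substitutions ([less_in_context],
      [less_subst]) and well founded ([rank_less]), so every monomial is
      congruent to a combination of such normal monomials that are not larger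
      ([normal_form_shuffle]).

    - Counting.  Concatenating the words of the Lie factors in decreasing order
      embeds the normal monomials of arity n in the permutations with an odd
      number of left-to-right minima ([code_inj]).  For n > 1 these are half of
      all permutations ([count_odd_ascending]), as many as the linearly
      independent skew products of words up to reversal.  By generation and
      reduction these skew products are combinations of normal monomials; so the
      normal monomials are linearly independent in the associative operad
      ([normal_free]).

    Independence gives the kernel, by taking normal forms, and the Groebner
    property: the leading monomial of an element of the ideal cannot be normal,
    hence contains an instance of the leading term of a relation, which after
    renumbering is the leading monomial of a shuffle relation
    ([root_divides]). *)

(** * Linear extension *)

Section LinearExtension.
Variables (K : choiceType) (V : lmodType rat) (F : K -> V).

Definition linext (f : {malg rat[K]}) : V := \sum_(k <- msupp f) f@_k *: F k.

Lemma linextEw (d : {fset K}) f :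
  (msupp f `<=` d)%fset -> linext f = \sum_(k <- d) f@_k *: F k.
Proof.
move=> le; rewrite /linext (big_fset_incl _ le) // => k _.
by rewrite -mcoeff_eq0 => /eqP->; rewrite scale0r.
Qed.

Fact linext_is_linear : linear linext.
Proof.
move=> c f g; pose d := (msupp f `|` msupp g)%fset.
have lef : (msupp f `<=` d)%fset by exact: fsubsetUl.
have leg : (msupp g `<=` d)%fset by exact: fsubsetUr.
have leh : (msupp (c *: f + g) `<=` d)%fset.
  apply: fsubset_trans (msuppD_le _ _) _; apply: fsetUSS => //.
  exact: msuppZ_le.
rewrite (linextEw lef) (linextEw leg) (linextEw leh) scaler_sumr -big_split /=.
by apply: eq_bigr => k _; rewrite mcoeffD mcoeffZ scalerDl scalerA.
Qed.
HB.instance Definition _ :=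
  GRing.isLinear.Build rat {malg rat[K]} V _ linext linext_is_linear.

Lemma linextU k : linext << k >> = F k.
Proof. by rewrite /linext msuppU oner_eq0 big_seq_fset1 mcoeffUU scale1r. Qed.

End LinearExtension.

Section LinearExtensionTheory.
Variable K : choiceType.
Implicit Types (V : lmodType rat) (f : {malg rat[K]}).

Lemma malg_linext f : f = linext (fun k => << k >>) f.
Proof.
rewrite {1}[f]monalgE; apply: eq_bigr => k _.
by apply/malgP=> j; rewrite mcoeffZ !mcoeffU mulr_natr.
Qed.

Lemma linear_linext V (W : lmodType rat) (h : {linear V -> W}) (F : K -> V) f :
  h (linext F f) = linext (h \o F) f.
Proof. by rewrite linear_sum; apply: eq_bigr => k _; rewrite linearZ. Qed.

Lemma eq_in_linext V (F G : K -> V) f :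
  {in msupp f, F =1 G} -> linext F f = linext G f.
Proof.
by move=> eqFG; rewrite /linext big_seq [RHS]big_seq; apply: eq_bigr => k /eqFG->.
Qed.

End LinearExtensionTheory.

Lemma malg_ind (K : choiceType) (P : {malg rat[K]} -> Prop) :
  P 0 -> (forall c k f, P f -> P (c *: << k >> + f)) -> forall f, P f.
Proof.
move=> P0 PD f; rewrite [f]malg_linext /linext.
by elim: (enum_fset _) => [|k s IHs]; rewrite ?big_nil ?big_cons //; apply: PD.
Qed.

(** * Commutators and symmetrized products in associative algebras *)

Section BilinearExtension.
Variables (K : Type) (A B : lmodType rat) (e : K -> A).
Hypothesis spanA : forall P : A -> Prop,
  P 0 -> (forall c k a, P a -> P (c *: e k + a)) -> forall a, P a.

Lemma eq_linear_span (f g : A -> B) :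
  linear f -> linear g -> (forall k, f (e k) = g (e k)) -> f =1 g.
Proof.
move=> lf lg efg; have h0 (h : A -> B) : linear h -> h 0 = 0.
  by move=> lh; have := lh (-1) 0 0; rewrite !scaleN1r !addNr.
by apply: spanA => [|c k a IHa]; rewrite ?h0 // lf lg IHa efg.
Qed.

(** The induction principle [spanA] says that [e] spans [A], so that bilinear maps
    are determined by their values on [e]. *)
Lemma eq_bilinear_span (f g : A -> A -> B) :
  (forall a, linear (f a)) -> (forall b, linear (f^~ b)) ->
  (forall a, linear (g a)) -> (forall b, linear (g^~ b)) ->
  (forall k l, f (e k) (e l) = g (e k) (e l)) -> f =2 g.
Proof.
move=> lf rf lg rg efg a b; move: a; apply: eq_linear_span => // k.
by move: b; apply: eq_linear_span.
Qed.
End BilinearExtension.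

Section AlgebraMorphism.
Variables (K : Type) (A B : algType rat) (e : K -> A).
Hypothesis spanA : forall P : A -> Prop,
  P 0 -> (forall c k a, P a -> P (c *: e k + a)) -> forall a, P a.
Variable h : {linear A -> B}.

Lemma span_mulr_morph :
  (forall k l, h (e k * e l) = h (e k) * h (e l)) -> {morph h : a b / a * b}.
Proof.
apply: (eq_bilinear_span spanA) => a c b b'.
- by rewrite mulrDr -scalerAr linearP.
- by rewrite mulrDl -scalerAl linearP.
- by rewrite linearP mulrDr -scalerAr.
by rewrite linearP mulrDl -scalerAl.
Qed.

Lemma span_mulr_antimorph :
  (forall k l, h (e k * e l) = h (e l) * h (e k)) ->
  forall a b, h (a * b) = h b * h a.
Proof.
move=> he a b; move: a b.
apply: (eq_bilinear_span spanA (f := fun a b => h (a * b)) (g := fun a b => h b * h a)) => // a c b b'.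
- by rewrite mulrDr -scalerAr linearP.
- by rewrite mulrDl -scalerAl linearP.
- by rewrite linearP mulrDl -scalerAl.
by rewrite linearP mulrDr -scalerAr.
Qed.
End AlgebraMorphism.

Section Operations.
Variable A : algType rat.

Definition comm (a b : A) : A := a * b - b * a.

Definition sym3 (a b c : A) : A :=
  a * b * c + a * c * b + b * a * c + b * c * a + c * a * b + c * b * a.

Fixpoint tree_eval (x : nat -> A) (t : tree) : A :=
  match t with
  | Leaf i => x i
  | Nu a b => comm (tree_eval x a) (tree_eval x b)
  | Mu a b c => sym3 (tree_eval x a) (tree_eval x b) (tree_eval x c)
  end.

Lemma eq_tree_eval x y t :
  {in leaves t, x =1 y} -> tree_eval x t = tree_eval y t.
Proof.
elim: t => [i|a IHa b IHb|a IHa b IHb c IHc] /= exy; first by rewrite exy ?inE.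
  by rewrite IHa ?IHb // => i it; rewrite exy // mem_cat it ?orbT.
by rewrite IHa ?IHb ?IHc // => i it; rewrite exy // !mem_cat it ?orbT.
Qed.

Lemma tree_eval_subst x s t :
  tree_eval x (tree_subst s t) = tree_eval (fun i => tree_eval x (s i)) t.
Proof. by elim: t => [i|a /= -> b ->|a /= -> b -> c ->]. Qed.

End Operations.

Section OperationsMorphism.
Variables (A B : algType rat) (h : {linear A -> B}).

Lemma comm_morph :
  {morph h : a b / a * b} -> forall a b, h (comm a b) = comm (h a) (h b).
Proof. by move=> hM a b; rewrite linearB !hM. Qed.

Lemma sym3_morph :
  {morph h : a b / a * b} -> forall a b c, h (sym3 a b c) = sym3 (h a) (h b) (h c).
Proof. by move=> hM a b c; rewrite !linearD !hM. Qed.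

End OperationsMorphism.

Lemma addr_rev6 (V : nmodType) (a b c d e f : V) :
  a + b + c + d + e + f = f + e + d + c + b + a.
Proof. by rewrite addrC (addrC _ e) (addrC _ d) (addrC _ c) (addrC a b) !addrA. Qed.

(** An antiautomorphism negating the letters negates commutators and symmetrized
    products of elements that it negates: reversing a product of k factors and
    negating each of them gives the sign (-1)^k, which reversing a commutator
    turns into -1 and reversing a symmetrized product leaves equal to -1. *)
Lemma tree_eval_antimorph (A : algType rat) (h : {linear A -> A}) x t :
  (forall a b, h (a * b) = h b * h a) -> (forall i, h (x i) = - x i) ->
  h (tree_eval x t) = - tree_eval x t.
Proof.
move=> hM hx; elim: t => [i|a /= IHa b IHb|a /= IHa b IHb c IHc] //=.
  by rewrite /comm linearB !hM IHa IHb !mulrNN opprB.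
rewrite /sym3 !linearD !hM IHa IHb IHc !(mulrN, mulNr, opprK) -!opprD !mulrA.
by rewrite addr_rev6; congr (- (_ + _)); rewrite addrAC; congr (_ + _ + _); rewrite addrAC.
Qed.

(** * The free algebra *)

Definition word (w : seq nat) : freeAlg := << FMonom w >>.

Lemma wordM u v : word u * word v = word (u ++ v).
Proof.
by rewrite /word malgM_def fgmulUU mulr1; congr mkmalgU; apply: fmmulE.
Qed.

Lemma word0 : word [::] = 1.
Proof. by rewrite /word -fmoneE. Qed.

Lemma varE i : var i = word [:: i].
Proof. by rewrite /var fmuE. Qed.

Lemma freeAlg_ind (P : freeAlg -> Prop) :
  P 0 -> (forall c w f, P f -> P (c *: word w + f)) -> forall f, P f.
Proof. by move=> P0 PD; apply: malg_ind => // c [w] f; apply: PD. Qed.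

Lemma freeAlg_scaleAr (c : rat) (a b : freeAlg) : a * (c *: b) = c *: (a * b).
Proof.
rewrite (malgMEw (fsubset_refl _) (msuppZ_le c b)) malgME scaler_sumr.
apply: eq_bigr => u _; rewrite scaler_sumr; apply: eq_bigr => v _.
by apply/malgP=> w; rewrite !mcoeffsE mulrCA mulrnAr.
Qed.

Lemma mcoeff_word u (w : {fmonom nat}) : (word u)@_w = (u == fmonom_val w)%:R.
Proof. by rewrite mcoeffU; case: w. Qed.

(** A copy of the free algebra, to which the structure of a noncommutative
    algebra over the rationals is attached. *)
Definition FA : Type := freeAlg.
HB.instance Definition _ := GRing.Lalgebra.on FA.
HB.instance Definition _ := GRing.Lalgebra_isAlgebra.Build rat FA
  (fun c a b => esym (freeAlg_scaleAr c a b)).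

Definition wordA (w : seq nat) : FA := word w.

Lemma FA_ind (P : FA -> Prop) :
  P 0 -> (forall c w a, P a -> P (c *: wordA w + a)) -> forall a, P a.
Proof. exact: freeAlg_ind. Qed.

Lemma wordAM u v : wordA u * wordA v = wordA (u ++ v).
Proof. exact: wordM. Qed.

(** * Substitution and realization *)

Section Substitution.
Variable s : nat -> FA.

Definition subst (a : FA) : FA := alg_subst s a.

Fact subst_linear : linear subst.
Proof. exact: (linext_is_linear (fun w => \prod_(i <- fmonom_val w) s i)). Qed.
HB.instance Definition _ :=
  GRing.isLinear.Build rat FA FA _ subst subst_linear.

Lemma subst_word w : subst (wordA w) = \prod_(i <- w) s i.
Proof. exact: (linextU (fun w => \prod_(i <- fmonom_val w) s i)). Qed.

Lemma substM : {morph subst : a b / a * b}.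
Proof.
apply: (span_mulr_morph FA_ind) => u v.
by rewrite /= wordAM !subst_word big_cat.
Qed.
End Substitution.

Definition letter (i : nat) : FA := var i.

Lemma letterE i : letter i = wordA [:: i].
Proof. exact: varE. Qed.

Lemma subst_letter s i : subst s (letter i) = s i.
Proof. by rewrite letterE subst_word big_seq1. Qed.

(** Both sums over permutations are made explicit by listing the permutations;
    such a list is complete as soon as it is duplicate free of the right
    length. *)
Lemma sum_S3 (V : nmodType) (F : 'I_3 -> 'I_3 -> 'I_3 -> V) :
  let i := @Ordinal 3 0 isT in
  let j := @Ordinal 3 1 isT in
  let k := @Ordinal 3 2 isT in
  \sum_(s : 'S_3) F (s i) (s j) (s k) =
  F i j k + F i k j + F j i k + F j k i + F k i j + F k j i.
Proof.
move=> i j k.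
pose l : seq 'S_3 := [:: 1%g; tperm j k; tperm i j; (tperm i j * tperm i k)%g;
                         (tperm i j * tperm j k)%g; tperm i k].
have El : [seq [seq s x | x <- [:: i; j; k]] | s : 'S_3 <- l] =
    [:: [:: i; j; k]; [:: i; k; j]; [:: j; i; k]; [:: j; k; i]; [:: k; i; j]; [:: k; j; i]].
  by rewrite /l /= !permM !permE /=.
have Ul : uniq l by apply: (map_uniq (f := fun s : 'S_3 => [seq s x | x <- [:: i; j; k]])); rewrite El.
have le : perm_eq (index_enum 'S_3) l.
  rewrite perm_sym uniq_perm ?index_enum_uniq // => s.
  rewrite mem_index_enum; apply/idP.
  have /(uniq_min_size Ul) [|_ ->] : {subset l <= enum 'S_3} by move=> x; rewrite mem_enum.
    by rewrite -cardE card_Sn.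
  by rewrite mem_enum.
rewrite (perm_big _ le) /=.
pose G (t : seq 'I_3) := F (nth i t 0) (nth i t 1) (nth i t 2).
rewrite -(big_map (fun s : 'S_3 => [seq s x | x <- [:: i; j; k]]) xpredT G) El.
by rewrite !big_cons big_nil /G /= addr0 !addrA.
Qed.

Lemma sum_S2 (V : nmodType) (F : 'I_2 -> 'I_2 -> V) :
  let i := @Ordinal 2 0 isT in
  let j := @Ordinal 2 1 isT in
  \sum_(s : 'S_2) F (s i) (s j) = F i j + F j i.
Proof.
move=> i j.
pose l : seq 'S_2 := [:: 1%g; tperm i j].
have El : [seq [seq s x | x <- [:: i; j]] | s : 'S_2 <- l] =
    [:: [:: i; j]; [:: j; i]].
  by rewrite /l /= !permE /=.
have Ul : uniq l by apply: (map_uniq (f := fun s : 'S_2 => [seq s x | x <- [:: i; j]])); rewrite El.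
have le : perm_eq (index_enum 'S_2) l.
  rewrite perm_sym uniq_perm ?index_enum_uniq // => s.
  rewrite mem_index_enum; apply/idP.
  have /(uniq_min_size Ul) [|_ ->] : {subset l <= enum 'S_2} by move=> x; rewrite mem_enum.
    by rewrite -cardE card_Sn.
  by rewrite mem_enum.
rewrite (perm_big _ le) /=.
pose G (t : seq 'I_2) := F (nth i t 0) (nth i t 1).
rewrite -(big_map (fun s : 'S_2 => [seq s x | x <- [:: i; j]]) xpredT G) El.
by rewrite !big_cons big_nil /G /= addr0.
Qed.

Definition mu3A : FA := mu3.

Lemma mu3E : mu3A = sym3 (letter 1) (letter 2) (letter 3).
Proof.
pose F (a b c : 'I_3) := letter a.+1 * letter b.+1 * letter c.+1.
rewrite /sym3 -[RHS](sum_S3 F).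
apply: (@eq_bigr _ 0 +%R _ _ _ (fun s : 'S_3 => \prod_(i < 3) letter (s i).+1)) => s _.
rewrite !big_ord_recl big_ord0 mulr1 mulrA /F.
have -> : ord0 = @Ordinal 3 0 isT by apply: val_inj.
have -> : lift (@Ordinal 3 0 isT) ord0 = @Ordinal 3 1 isT by apply: val_inj.
have -> : lift (@Ordinal 3 0 isT) (lift ord0 ord0) = @Ordinal 3 2 isT by apply: val_inj.
by [].
Qed.

Lemma realize_treeE t : realize_tree t = tree_eval letter t.
Proof.
elim: t => [//|a IHa b IHb|a IHa b IHb c IHc]; rewrite /= IHa ?IHb ?IHc.
  set s := (fun i => _).
  rewrite -[LHS]/(subst s (comm (letter 1) (letter 2))).
  by rewrite (comm_morph (substM s)) /= !subst_letter.
set s := (fun i => _).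
rewrite -[LHS]/(subst s mu3A) mu3E.
by rewrite (sym3_morph (substM s)) /= !subst_letter.
Qed.

Lemma realizeE f : realize f = linext (tree_eval letter) f.
Proof. by apply: eq_bigr => t _; rewrite realize_treeE. Qed.

(** * Supports of formal sums *)

Section Supports.
Variables (K : choiceType) (P : K -> Prop).
Implicit Types f g : {malg rat[K]}.

Definition supported f := forall k, k \in msupp f -> P k.

Lemma supported0 : supported 0.
Proof. by move=> k; rewrite msupp0 in_fset0. Qed.

Lemma supportedU k : P k -> supported << k >>.
Proof. by move=> Pk j; rewrite msuppU oner_eq0 inE => /eqP->. Qed.

Lemma supportedD f g : supported f -> supported g -> supported (f + g).
Proof.
by move=> Pf Pg k /(fsubsetP (msuppD_le _ _)); rewrite inE => /orP[/Pf|/Pg].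
Qed.

Lemma supportedZ c f : supported f -> supported (c *: f).
Proof. by move=> Pf k /(fsubsetP (msuppZ_le _ _)) /Pf. Qed.

Lemma supportedN f : supported f -> supported (- f).
Proof. by move=> Pf k; rewrite msuppN => /Pf. Qed.

Lemma supportedB f g : supported f -> supported g -> supported (f - g).
Proof. by move=> Pf /supportedN; apply: supportedD. Qed.

Lemma supported_sum (I : eqType) (r : seq I) (F : I -> {malg rat[K]}) :
  (forall i, i \in r -> supported (F i)) -> supported (\sum_(i <- r) F i).
Proof.
move=> PF; rewrite big_seq; elim/big_ind: _ => //; first exact: supported0.
exact: supportedD.
Qed.

End Supports.

Lemma supported_linext (J K : choiceType) (P : K -> Prop)
    (F : J -> {malg rat[K]}) f :
  (forall j, j \in msupp f -> supported P (F j)) -> supported P (linext F f).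
Proof.
by move=> PF; apply: supported_sum => j fj; apply: supportedZ; apply: PF.
Qed.

Lemma supported_sub (K : choiceType) (P Q : K -> Prop) (f : {malg rat[K]}) :
  (forall k, P k -> Q k) -> supported P f -> supported Q f.
Proof. by move=> PQ Pf k /Pf /PQ. Qed.

(** * Formal sums given by lists *)

Lemma linext_lincomb (V : lmodType rat) (F : tree -> V) s :
  linext F (lincomb s) = \sum_(p <- s) p.1 *: F p.2.
Proof.
by rewrite /lincomb linear_sum; apply: eq_bigr => p _; rewrite linearZ /= linextU.
Qed.

Lemma supported_lincomb (P : tree -> Prop) s :
  (forall p, p \in s -> P p.2) -> supported P (lincomb s).
Proof.
by move=> Ps; apply: supported_sum => p /Ps Pp; apply: supportedZ; apply: supportedU.
Qed.

Lemma lincomb_cat s t : lincomb (s ++ t) = lincomb s + lincomb t.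
Proof. exact: big_cat. Qed.

Lemma lincomb_scale c s : c *: lincomb s = lincomb [seq (c * p.1, p.2) | p <- s].
Proof.
by rewrite /lincomb scaler_sumr big_map; apply: eq_bigr => p _; rewrite scalerA.
Qed.

(** The coefficients of [B] are multiples of 1/60: there are 12 terms in the
    average over S_3 x S_2, and 5 is the denominator of [B_lift].  Integral
    coefficients make the verification of the relations a computation. *)
Definition B60_lift (a1 a2 a3 b1 b2 : tree) : seq (int * tree) :=
  [:: (15, Mu (Nu a1 b1) (Nu a2 b2) a3);
      (30, Mu (Nu a1 (Nu a2 b1)) a3 b2);
      (6, Nu b1 (Nu a1 (Nu a2 (Nu a3 b2))));
      (18, Nu a1 (Nu b1 (Nu a2 (Nu b2 a3))))].

Definition B60 (a1 a2 a3 b1 b2 : tree) : seq (int * tree) :=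
  let f a1 a2 a3 := B60_lift a1 a2 a3 b1 b2 ++ B60_lift a1 a2 a3 b2 b1 in
  f a1 a2 a3 ++ f a1 a3 a2 ++ f a2 a1 a3 ++ f a2 a3 a1 ++ f a3 a1 a2 ++ f a3 a2 a1.

Definition lincomb60 (s : seq (int * tree)) : treeMod :=
  lincomb [seq (p.1%:~R / 60, p.2) | p <- s].

Lemma lincomb60_cat s t : lincomb60 (s ++ t) = lincomb60 s + lincomb60 t.
Proof. by rewrite /lincomb60 map_cat lincomb_cat. Qed.

Lemma B60E a1 a2 a3 b1 b2 : B a1 a2 a3 b1 b2 = lincomb60 (B60 a1 a2 a3 b1 b2).
Proof.
pose A (i : 'I_3) := nth a1 [:: a1; a2; a3] i.
pose C (i : 'I_2) := nth b1 [:: b1; b2] i.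
pose F i j k l m := lincomb60 (B60_lift (A i) (A j) (A k) (C l) (C m)).
transitivity (\sum_(s : 'S_3) \sum_(r : 'S_2)
    F (s (@Ordinal 3 0 isT)) (s (@Ordinal 3 1 isT)) (s (@Ordinal 3 2 isT))
      (r (@Ordinal 2 0 isT)) (r (@Ordinal 2 1 isT))).
  rewrite /B; apply: eq_bigr => s _; apply: eq_bigr => r _; cbv zeta.
  have I3 k (lt : (k < 3)%N) : inord k = Ordinal lt :> 'I_3.
    by apply: val_inj; rewrite /= inordK.
  have I2 k (lt : (k < 2)%N) : inord k = Ordinal lt :> 'I_2.
    by apply: val_inj; rewrite /= inordK.
  rewrite (I3 0 isT) (I3 1 isT) (I3 2 isT) (I2 0 isT) (I2 1 isT) /F /A /C lincomb_scale /lincomb60.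
  by rewrite /B_lift /B60_lift /=; congr (lincomb [:: (_, _); (_, _); (_, _); (_, _)]).
under eq_bigr => s _ do rewrite (sum_S2 (F _ _ _)).
pose G i j k := F i j k (@Ordinal 2 0 isT) (@Ordinal 2 1 isT) +
                F i j k (@Ordinal 2 1 isT) (@Ordinal 2 0 isT).
rewrite (sum_S3 G) /G /F /A /C /= /B60 !lincomb60_cat.
by rewrite !addrA.
Qed.

(** * The relations hold in associative algebras *)

(** The noncommutative polynomial of a monomial, as a list of words with integral
    coefficients.  A combination of monomials vanishes in every associative
    algebra as soon as the coefficients of each word cancel, which is decidable
    by evaluation. *)
Fixpoint expand (t : tree) : seq (int * seq nat) :=
  let mul l m := [seq (p.1 * q.1, p.2 ++ q.2) | p <- l, q <- m] in
  let opp l := [seq (- p.1, p.2) | p <- l] in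
  match t with
  | Leaf i => [:: (1, [:: i])]
  | Nu a b => let a := expand a in let b := expand b in mul a b ++ opp (mul b a)
  | Mu a b c =>
    let a := expand a in let b := expand b in let c := expand c in
    mul (mul a b) c ++ mul (mul a c) b ++ mul (mul b a) c ++
    mul (mul b c) a ++ mul (mul c a) b ++ mul (mul c b) a
  end.

Fixpoint coefz (w : seq nat) (l : seq (int * seq nat)) : int :=
  if l is p :: l' then (if p.2 == w then p.1 + coefz w l' else coefz w l') else 0.

Definition cancels (l : seq (int * seq nat)) : bool :=
  all (fun w => coefz w l == 0) (undup (unzip2 l)).

Definition expand60 (s : seq (int * tree)) : seq (int * seq nat) :=
  flatten [seq [seq (p.1 * q.1, q.2) | q <- expand p.2] | p <- s].

Section Expansion.
Variables (A : algType rat) (x : nat -> A).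

Definition word_sum (l : seq (int * seq nat)) : A :=
  \sum_(p <- l) p.1%:~R *: \prod_(i <- p.2) x i.

Lemma word_sum_cat l m : word_sum (l ++ m) = word_sum l + word_sum m.
Proof. exact: big_cat. Qed.

Lemma word_sum_mul l m :
  word_sum [seq (p.1 * q.1, p.2 ++ q.2) | p <- l, q <- m] = word_sum l * word_sum m.
Proof.
rewrite /word_sum big_allpairs_dep mulr_suml; apply: eq_bigr => p _.
rewrite mulr_sumr; apply: eq_bigr => q _ /=.
by rewrite big_cat -scalerAl -scalerAr scalerA intrM.
Qed.

Lemma word_sum_opp l : word_sum [seq (- p.1, p.2) | p <- l] = - word_sum l.
Proof.
rewrite /word_sum big_map -sumrN; apply: eq_bigr => p _ /=.
by rewrite mulrNz scaleNr.
Qed.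

Lemma expandE t : tree_eval x t = word_sum (expand t).
Proof.
elim: t => [i|a /= -> b ->|a /= -> b -> c ->] /=.
- by rewrite /word_sum !big_seq1 scale1r.
- by rewrite word_sum_cat word_sum_opp !word_sum_mul.
by rewrite !word_sum_cat !word_sum_mul !addrA.
Qed.

Lemma word_sum_coef l :
  word_sum l = \sum_(w <- undup (unzip2 l)) (coefz w l)%:~R *: \prod_(i <- w) x i.
Proof.
have coefE w m : (coefz w m)%:~R = \sum_(p <- m) (p.1 *+ (p.2 == w))%:~R :> rat.
  elim: m => [|p m IHm]; first by rewrite big_nil.
  by rewrite big_cons /=; case: eqP => _; rewrite ?mulr0n ?add0r // intrD IHm.
under [RHS]eq_bigr => w _ do rewrite coefE scaler_suml.
rewrite exchange_big /word_sum big_seq [RHS]big_seq /=; apply: eq_bigr => p pl.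
rewrite (bigD1_seq p.2) ?undup_uniq ?mem_undup ?map_f //= eqxx.
by rewrite [X in _ + X]big1 ?addr0 // => w /negPf; rewrite eq_sym => ->; rewrite scale0r.
Qed.

Lemma cancelsP l : cancels l -> word_sum l = 0.
Proof.
move=> /allP cl; rewrite word_sum_coef big_seq big1 // => w /cl/eqP->.
by rewrite scale0r.
Qed.

Lemma cancels_lincomb60 s :
  cancels (expand60 s) -> linext (tree_eval x) (lincomb60 s) = 0.
Proof.
move=> /cancelsP s0; rewrite /lincomb60 linext_lincomb big_map /=.
have -> : \sum_(p <- s) (p.1%:~R / 60) *: tree_eval x p.2 =
          60^-1 *: word_sum (expand60 s).
  rewrite /word_sum /expand60 big_flatten big_map scaler_sumr.
  apply: eq_bigr => p _; rewrite expandE /word_sum big_map !scaler_sumr.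
  by apply: eq_bigr => q _; rewrite !scalerA intrM mulrA [_ / 60]mulrC.
by rewrite s0 scaler0.
Qed.
End Expansion.

Lemma jacobi60 : jacobi = lincomb60
  [:: (60, Nu (Nu 1 2) 3); (60, Nu (Nu 2 3) 1); (60, Nu (Nu 3 1) 2)].
Proof. by rewrite /lincomb60 /= divff. Qed.

Lemma derivation60 : derivation = lincomb60
  [:: (60, Nu (Mu 1 2 3) 4); (-60, Mu 1 2 (Nu 3 4)); (-60, Mu 1 (Nu 2 4) 3);
      (-60, Mu (Nu 1 4) 2 3)].
Proof. by rewrite /lincomb60 /= mulrNz mulNr divff. Qed.

Lemma lincomb60N s : - lincomb60 s = lincomb60 [seq (- p.1, p.2) | p <- s].
Proof.
rewrite -scaleN1r lincomb_scale /lincomb60 -!map_comp.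
by congr lincomb; apply: eq_map => p /=; rewrite mulN1r mulrNz mulNr.
Qed.

Definition assoc60 : seq (int * tree) :=
  [:: (60, Mu (Mu 1 2 4) 3 5); (-60, Mu (Mu 1 2 3) 4 5)] ++
  [seq (- p.1, p.2) | p <- B60 1%N 2%N 4%N 3%N 5%N] ++ B60 1%N 2%N 3%N 4%N 5%N.

Lemma associativity60 : associativity = lincomb60 assoc60.
Proof.
rewrite /assoc60 lincomb60_cat lincomb60_cat -lincomb60N -!B60E /associativity opprB.
by congr (_ + _); apply: addrC.
Qed.

(** Working in all associative algebras at once, rather than in the free one,
    makes substitution harmless: substituting trees for the inputs amounts to
    changing the values of the letters. *)
Definition identity (f : treeMod) : Prop :=
  forall (A : algType rat) (x : nat -> A), linext (tree_eval x) f = 0.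

(** The only place where the precise form of the relations, and in particular of
    [B], matters: all 120 words on five letters are checked by evaluation. *)
Lemma defining_rel_identity n r : defining_rel n r -> identity r.
Proof.
case; rewrite ?jacobi60 ?derivation60 ?associativity60 => A x;
  by apply: cancels_lincomb60; vm_compute.
Qed.

(** * Substitution in formal sums *)

Definition tsubst (s : nat -> tree) : treeMod -> treeMod :=
  linext (fun t => << tree_subst s t >>).
HB.instance Definition _ s := GRing.isLinear.Build rat treeMod treeMod _
  (tsubst s) (linext_is_linear (fun t => << tree_subst s t >>)).

Lemma tsubstU s t : tsubst s << t >> = << tree_subst s t >>.
Proof. exact: linextU. Qed.

Lemma relabelE s : relabel s = tsubst (fun i => Leaf (s i)).
Proof. by []. Qed.

Lemma eq_tree_subst s s' t :
  {in leaves t, s =1 s'} -> tree_subst s t = tree_subst s' t.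
Proof.
elim: t => [i|a IHa b IHb|a IHa b IHb c IHc] /= ss; first by rewrite ss ?inE.
  by rewrite IHa ?IHb // => i it; rewrite ss // mem_cat it ?orbT.
by rewrite IHa ?IHb ?IHc // => i it; rewrite ss // !mem_cat it ?orbT.
Qed.

Lemma eq_tsubst s s' f : supported (fun t => {in leaves t, s =1 s'}) f ->
  tsubst s f = tsubst s' f.
Proof.
by move=> ss; apply: eq_in_linext => t /ss {}ss; congr << _ >>; apply: eq_tree_subst.
Qed.

Lemma tree_subst_comp s s' t :
  tree_subst s (tree_subst s' t) = tree_subst (tree_subst s \o s') t.
Proof. by elim: t => [i|a /= -> b ->|a /= -> b -> c ->]. Qed.

Lemma tsubst_comp s s' f : tsubst s (tsubst s' f) = tsubst (tree_subst s \o s') f.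
Proof.
rewrite [tsubst s' f]/tsubst linear_linext; apply: eq_in_linext => t _ /=.
by rewrite tsubstU tree_subst_comp.
Qed.

Lemma linext_tsubst (A : algType rat) (x : nat -> A) s f :
  linext (tree_eval x) (tsubst s f) = linext (tree_eval (tree_eval x \o s)) f.
Proof.
rewrite [tsubst s f]/tsubst linear_linext.
by apply: eq_in_linext => t _ /=; rewrite linextU tree_eval_subst.
Qed.

Lemma identity_tsubst s f : identity f -> identity (tsubst s f).
Proof. by move=> f0 A x; rewrite linext_tsubst. Qed.

Definition graft_tree (i : nat) (u v : nat -> nat) (s t : tree) : tree :=
  tree_subst (fun j => if j == i then tree_relabel v t else Leaf (u j)) s.

Lemma graftE i u v f g :
  graft i u v f g = linext (fun s => linext (fun t => << graft_tree i u v s t >>) g) f.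
Proof.
apply: eq_bigr => s _; rewrite scaler_sumr; apply: eq_bigr => t _.
by rewrite scalerA.
Qed.

Lemma linextC (J K : choiceType) (V : lmodType rat) (F : J -> K -> V) f g :
  linext (fun j => linext (F j) g) f = linext (fun k => linext (F^~ k) f) g.
Proof.
rewrite /linext; under eq_bigr => j _ do rewrite scaler_sumr.
rewrite exchange_big; apply: eq_bigr => k _; rewrite scaler_sumr.
by apply: eq_bigr => j _; rewrite !scalerA mulrC.
Qed.

Lemma linext0 (K : choiceType) (V : lmodType rat) (F : K -> V) f :
  (forall k, k \in msupp f -> F k = 0) -> linext F f = 0.
Proof.
by move=> F0; rewrite /linext big_seq big1 // => k /F0->; rewrite scaler0.
Qed.

(** A graft in [f] is a combination of substitution instances of [f]. *)
Lemma identity_graftl i u v f g : identity f -> identity (graft i u v f g).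
Proof.
move=> f0 A x; rewrite graftE linextC linear_linext; apply: linext0 => t _ /=.
exact: (identity_tsubst (fun j => if j == i then tree_relabel v t else Leaf (u j)) f0).
Qed.

Lemma sym3_swap12 (A : algType rat) (a b c : A) : sym3 a b c = sym3 b a c.
Proof. by rewrite /sym3 [RHS](ACl (3*4*1*2*6*5)). Qed.

Lemma sym3_swap23 (A : algType rat) (a b c : A) : sym3 a b c = sym3 a c b.
Proof. by rewrite /sym3 [RHS](ACl (2*1*5*6*3*4)). Qed.

Lemma sym3_rot (A : algType rat) (a b c : A) : sym3 a b c = sym3 c a b.
Proof. by rewrite sym3_swap23 sym3_swap12. Qed.

Lemma addr_split6 (V : nmodType) (a1 b1 a2 b2 a3 b3 a4 b4 a5 b5 a6 b6 : V) :
  (a1 + b1) + (a2 + b2) + (a3 + b3) + (a4 + b4) + (a5 + b5) + (a6 + b6) =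
  (a1 + a2 + a3 + a4 + a5 + a6) + (b1 + b2 + b3 + b4 + b5 + b6).
Proof.
by rewrite (addrACA a1) (addrACA _ _ a3) (addrACA _ _ a4) (addrACA _ _ a5) (addrACA _ _ a6).
Qed.

Lemma comm_linear (A : algType rat) c (a b b' : A) :
  (comm a (c *: b + b') = c *: comm a b + comm a b') *
  (comm (c *: b + b') a = c *: comm b a + comm b' a).
Proof.
rewrite /comm !mulrDl !mulrDr -!scalerAl -!scalerAr !scalerBr.
by split; rewrite opprD addrACA.
Qed.

Lemma sym3_linear (A : algType rat) c (a a' b d : A) :
  sym3 (c *: a + a') b d = c *: sym3 a b d + sym3 a' b d.
Proof.
rewrite /sym3 !(mulrDl, mulrDr) -!(scalerAl, scalerAr) !scalerDr.
exact: addr_split6.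
Qed.

Section Multilinear.
Variables (A : algType rat) (y : nat -> A) (i : nat).

Let at_i (z : A) j := if j == i then z else y j.

Lemma tree_eval_notin s z : i \notin leaves s -> tree_eval (at_i z) s = tree_eval y s.
Proof.
by move=> si; apply: eq_tree_eval => j js; rewrite /at_i; case: eqP si => // <-; rewrite js.
Qed.

Lemma tree_eval_linear s : count_mem i (leaves s) = 1%N ->
  linear (fun z => tree_eval (at_i z) s).
Proof.
have ni t z : count_mem i (leaves t) = 0%N -> tree_eval (at_i z) t = tree_eval y t.
  by move=> /count_memPn/tree_eval_notin->.
elim: s => [j|s IHs t IHt|s IHs t IHt r IHr] /=.
- by rewrite addn0 /at_i; case: eqP => // _ _ c a b.
- rewrite count_cat => st c a b.
  have [[s0 t1]|[s1 t0]] :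
    (count_mem i (leaves s) = 0%N /\ count_mem i (leaves t) = 1%N) \/
    (count_mem i (leaves s) = 1%N /\ count_mem i (leaves t) = 0%N).
    move: (count_mem i (leaves s)) (count_mem i (leaves t)) st.
    by case=> [|[|?]] [|[|?]] //= _; [left|right].
    by rewrite !(ni s) // IHt // comm_linear.
  by rewrite !(ni t) // IHs // comm_linear.
rewrite !count_cat => st c a b.
have [[s1 t0 r0]|[[s0 t1 r0]|[s0 t0 r1]]] :
  [/\ count_mem i (leaves s) = 1%N, count_mem i (leaves t) = 0%N & count_mem i (leaves r) = 0%N] \/
  [/\ count_mem i (leaves s) = 0%N, count_mem i (leaves t) = 1%N & count_mem i (leaves r) = 0%N] \/
  [/\ count_mem i (leaves s) = 0%N, count_mem i (leaves t) = 0%N & count_mem i (leaves r) = 1%N].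
  move: (count_mem i (leaves s)) (count_mem i (leaves t)) (count_mem i (leaves r)) st.
  by case=> [|[|?]] [|[|?]] [|[|?]] //= _; [right; right|right; left|left].
- by rewrite !(ni t) // !(ni r) // IHs // sym3_linear.
- by rewrite !(ni s) // !(ni r) // IHt // !(sym3_swap12 (tree_eval y s)) sym3_linear.
by rewrite !(ni s) // !(ni t) // IHr // !(sym3_rot (tree_eval y s)) sym3_linear.
Qed.
End Multilinear.

(** Every monomial of [f] contains the input [i] once, hence is linear in the value
    given to it. *)
Lemma identity_graftr i u v f g :
  supported (fun s => count_mem i (leaves s) = 1%N) f ->
  identity g -> identity (graft i u v f g).
Proof.
move=> fi g0 A x; rewrite graftE linear_linext; apply: linext0 => s /fi {}fi /=.
rewrite linear_linext.
have lin := tree_eval_linear (x \o u) fi.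
pose h : {linear A -> A} := HB.pack (fun z => tree_eval (fun j => if j == i then z else x (u j)) s)
   (GRing.isLinear.Build rat A A _ _ lin).
transitivity (h (linext (tree_eval (x \o v)) g)); last by rewrite g0 linear0.
rewrite linear_linext; apply: eq_in_linext => t _ /=.
rewrite linextU tree_eval_subst; apply: eq_tree_eval => j _.
by case: eqP => //= _; rewrite tree_eval_subst.
Qed.

Lemma supported_mulA (P Q R : {fmonom nat} -> Prop) (a b : FA) :
  (forall u v, P u -> Q v -> R (fmmul u v)) ->
  supported P (a : freeAlg) -> supported Q (b : freeAlg) ->
  supported R ((a * b : FA) : freeAlg).
Proof.
by move=> PQR Pa Qb w /msuppM_le[u [v [/Pa Pu /Qb Qv ->]]]; apply: PQR.
Qed.

Definition homog (L : seq nat) (a : FA) : Prop :=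
  supported (fun w : {fmonom nat} => perm_eq (fmonom_val w) L) (a : freeAlg).

Lemma homogM L K a b : homog L a -> homog K b -> homog (L ++ K) (a * b).
Proof.
apply: supported_mulA => u v uL vK; rewrite fmmulE.
exact: perm_cat.
Qed.

Lemma homogD L a b : homog L a -> homog L b -> homog L (a + b).
Proof. exact: supportedD. Qed.

Lemma homogB L a b : homog L a -> homog L b -> homog L (a - b).
Proof. exact: supportedB. Qed.

Lemma homog_perm L K a : homog L a -> perm_eq L K -> homog K a.
Proof. by move=> La LK; apply: supported_sub La => w /perm_trans; apply. Qed.

Local Ltac perm_count := by apply/seq.permP=> ?; rewrite !count_cat /=; lia.

Lemma homog_tree t : homog (leaves t) (tree_eval letter t).
Proof.
elim: t => [i|a IHa b IHb|a IHa b IHb c IHc] /=.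
- by rewrite letterE; apply: supportedU.
- apply: homogB; first exact: homogM.
  apply: (homog_perm (homogM IHb IHa)); perm_count.
rewrite /sym3; do ![apply: homogD].
- apply: (homog_perm (homogM (homogM IHa IHb) IHc)); perm_count.
- apply: (homog_perm (homogM (homogM IHa IHc) IHb)); perm_count.
- apply: (homog_perm (homogM (homogM IHb IHa) IHc)); perm_count.
- apply: (homog_perm (homogM (homogM IHb IHc) IHa)); perm_count.
- apply: (homog_perm (homogM (homogM IHc IHa) IHb)); perm_count.
apply: (homog_perm (homogM (homogM IHc IHb) IHa)); perm_count.
Qed.

(** * The ideals consist of identities *)

(** It suffices to exchange adjacent blocks, which [catCA_perm_ind] reduces
    arbitrary permutations to. *)
Lemma sym3_perm (A : algType rat) (T : eqType) (F : T -> A) x (s t : seq T) :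
  size s = 3 -> perm_eq s t ->
  sym3 (F (nth x s 0)) (F (nth x s 1)) (F (nth x s 2)) =
  sym3 (F (nth x t 0)) (F (nth x t 1)) (F (nth x t 2)).
Proof.
move=> s3 st.
pose P (r : seq T) := size r = 3 /\ sym3 (F (nth x s 0)) (F (nth x s 1)) (F (nth x s 2)) =
  sym3 (F (nth x r 0)) (F (nth x r 1)) (F (nth x r 2)).
suff [] : P t by [].
apply: (catCA_perm_ind _ st) => // s1 s2 s4 [z eqF]; split.
  by rewrite -z !size_cat addnCA.
rewrite {s st s3 P t}eqF; move: s1 s2 s4 z.
move=> [|a [|b [|c [|? ?]]]] [|d [|e [|f [|? ?]]]] [|g [|h [|i [|? ?]]]] //= _.
- exact: sym3_swap12.
- by rewrite sym3_swap12 sym3_swap23.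
by rewrite sym3_swap23 sym3_swap12.
Qed.

Lemma comm_scale (A : algType rat) p q (a b : A) :
  comm (p *: a) (q *: b) = (p * q) *: comm a b.
Proof.
by rewrite /comm -!scalerAr -!scalerAl !scalerA scalerBr [q * p]mulrC.
Qed.

Lemma comm_anti (A : algType rat) (a b : A) : comm a b = - comm b a.
Proof. by rewrite /comm opprB. Qed.

Lemma sym3_scale (A : algType rat) p q r (a b c : A) :
  sym3 (p *: a) (q *: b) (r *: c) = (p * q * r) *: sym3 a b c.
Proof.
rewrite /sym3 -!scalerAl -!scalerAr -!scalerAl !scalerA !scalerDr.
by do ![congr (_ + _)]; congr (_ *: _); ring.
Qed.

Lemma tree_eval_sort (A : algType rat) (x : nat -> A) t :
  tree_eval x t = (sort_tree t).1 *: tree_eval x (sort_tree t).2.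
Proof.
elim: t => [i|a IHa b IHb|a IHa b IHb c IHc] /=; first by rewrite scale1r.
  rewrite IHa IHb; case: (sort_tree a) (sort_tree b) => [p a'] [q b'] /=.
  case: ifP => _ /=; rewrite comm_scale // comm_anti.
  by rewrite scalerN scaleNr.
rewrite IHa IHb IHc; case: (sort_tree a) (sort_tree b) (sort_tree c) => [p a'] [q b'] [r c'].
set s := sort _ _; rewrite [RHS]/= sym3_scale.
have := @sym3_perm A tree (tree_eval x) a' [:: a'; b'; c'] s erefl.
by rewrite perm_sym perm_sort perm_refl => /(_ isT) /= <-.
Qed.

Lemma shuffle_formE f : shuffle_form f =
  linext (fun t => (sort_tree t).1 *: << (sort_tree t).2 >>) f.
Proof. by apply: eq_bigr => t _; rewrite scalerA. Qed.

Lemma linext_shuffle_form (A : algType rat) (x : nat -> A) f :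
  linext (tree_eval x) (shuffle_form f) = linext (tree_eval x) f.
Proof.
rewrite shuffle_formE linear_linext; apply: eq_in_linext => t _ /=.
by rewrite linearZ /= linextU -tree_eval_sort.
Qed.

Lemma symmetry_rel_identity n r : symmetry_rel n r -> identity r.
Proof.
case=> [|i j k ijk] A x; rewrite linext_lincomb 2!big_cons big_nil addr0 !scale1r.
  by rewrite /= [comm (x 2) _]comm_anti subrr.
by rewrite scaleN1r [tree_eval _ _](sym3_perm x 0 _ ijk) ?subrr.
Qed.

Lemma presentation_rel_identity n r : presentation_rel n r -> identity r.
Proof. by case=> [/symmetry_rel_identity|/defining_rel_identity]. Qed.

Lemma shuffle_rel_identity n r : shuffle_rel n r -> identity r.
Proof.
case=> {n r} n s r r0 _ A x; rewrite linext_shuffle_form relabelE.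
exact: identity_tsubst (defining_rel_identity r0) _ _.
Qed.

Lemma count_leaf m i s : (0 < i <= m)%N -> perm_eq (leaves s) (iota 1 m) ->
  count_mem i (leaves s) = 1%N.
Proof.
move=> im sm; rewrite (seq.permP sm) count_uniq_mem ?iota_uniq // mem_iota.
by rewrite add1n ltnS im.
Qed.

Lemma operad_ideal_identity G : (forall n r, G n r -> identity r) ->
  forall n f, operad_ideal G n f -> identity f.
Proof.
move=> G0 n f; elim=> {n f}
  [n f /G0//|n|n f g _ f0 _ g0|n c f _ f0|n s f _ _ f0|m n i f g _ _ f0 _|m n i f g im fm _ g0].
- by move=> A x; rewrite linear0.
- by move=> A x; rewrite linearD /= f0 g0 addr0.
- by move=> A x; rewrite linearZ /= f0 scaler0.
- by rewrite relabelE; apply: identity_tsubst.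
- exact: identity_graftl.
by apply: identity_graftr => // s /fm; apply: count_leaf.
Qed.

Lemma shuffle_ideal_identity G : (forall n r, G n r -> identity r) ->
  forall n f, shuffle_ideal G n f -> identity f.
Proof.
move=> G0 n f; elim=> {n f}
  [n f /G0//|n|n f g _ f0 _ g0|n c f _ f0|m n i u v f g _ _ f0 _|m n i u v f g [im _ _ _ _] fm _ g0].
- by move=> A x; rewrite linear0.
- by move=> A x; rewrite linearD /= f0 g0 addr0.
- by move=> A x; rewrite linearZ /= f0 scaler0.
- exact: identity_graftl.
by apply: identity_graftr => // s /fm[_]; apply: count_leaf.
Qed.

(** * Realized operations are invariant *)

Fact sign_rev_linear : linear (linext (fun w : {fmonom nat} =>
  (-1) ^+ size (fmonom_val w) *: wordA (rev (fmonom_val w))) : FA -> FA).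
Proof. exact: linext_is_linear. Qed.

(** The antipode of the free algebra, which negates the letters and reverses
    products.  Up to sign it is [tau]. *)
Definition antipode (a : FA) : FA :=
  linext (fun w : {fmonom nat} =>
    (-1) ^+ size (fmonom_val w) *: wordA (rev (fmonom_val w))) (a : freeAlg).
HB.instance Definition _ :=
  GRing.isLinear.Build rat FA FA _ antipode sign_rev_linear.

Lemma antipode_word w : antipode (wordA w) = (-1) ^+ size w *: wordA (rev w).
Proof. exact: linextU. Qed.

Lemma antipodeM a b : antipode (a * b) = antipode b * antipode a.
Proof.
apply: (span_mulr_antimorph FA_ind) => u v.
rewrite /= wordAM !antipode_word -scalerAl -scalerAr wordAM scalerA -exprD.
by rewrite rev_cat size_cat addnC.
Qed.

Lemma antipode_tree t : antipode (tree_eval letter t) = - tree_eval letter t.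
Proof.
apply: (tree_eval_antimorph (h := antipode)) => [a b|i] /=.
  exact: antipodeM.
by rewrite letterE antipode_word expr1 scaleN1r.
Qed.

Lemma tauE a : supported (fun w : {fmonom nat} => (0 < size (fmonom_val w))%N) a ->
  tau a = - antipode a.
Proof.
move=> a0; transitivity (linext (fun w : {fmonom nat} =>
    (-1) ^+ (size (fmonom_val w)).-1 *: << FMonom (rev (fmonom_val w)) >> : freeAlg) a).
  by apply: eq_bigr => w _; rewrite scalerA.
rewrite -[RHS]scaleN1r /antipode [RHS](linear_linext ( *:%R (-1))).
apply: eq_in_linext => w /a0 w0 /=; rewrite scalerA -exprS.
suff -> : (-1) ^+ (size (fmonom_val w)).-1 = (-1) ^+ (size (fmonom_val w)).+1 :> rat by [].
by case: (size _) w0 => //= k _; rewrite !exprS mulrA mulN1r opprK mul1r.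
Qed.

Lemma leaves_gt0 t : (0 < size (leaves t))%N.
Proof. by elim: t => //= *; rewrite !size_cat; lia. Qed.

Lemma realize_inv n f : free_op n f -> As_inv n (realize f).
Proof.
move=> fn.
have hf : supported (fun w : {fmonom nat} => (0 < size (fmonom_val w))%N /\
    perm_eq (fmonom_val w) (iota 1 n)) (linext (tree_eval letter) f : freeAlg).
  apply: supported_linext => t /fn tn.
  move=> w /homog_tree wt; split; last exact: perm_trans wt tn.
  by rewrite (perm_size wt) leaves_gt0.
rewrite realizeE; split.
  by move=> w /hf[w0 wn]; split=> //; rewrite -(size_iota 1 n) -(perm_size wn).
rewrite tauE; last by move=> w /hf[].
rewrite -[RHS]opprK; congr (- _).
rewrite [LHS](linear_linext antipode) -[RHS]scaleN1r [RHS](linear_linext ( *:%R (-1))).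
apply: eq_in_linext => t _; rewrite /= antipode_tree scaleN1r.
by [].
Qed.

(** * The invariants are generated by the commutator and the symmetrized product *)

Section Generation.
Variables (A : algType rat) (x : nat -> A).

(** The elements that the two operations produce from the letters of [L], each
    letter being used as often as it occurs in [L]. *)
Definition attained (L : seq nat) (a : A) : Prop :=
  exists2 f, supported (fun t => perm_eq (leaves t) L) f &
             linext (tree_eval x) f = a.

Lemma attained_perm L K a : attained L a -> perm_eq L K -> attained K a.
Proof.
move=> [f fL fa] LK; exists f => //; apply: supported_sub fL => t tL.
exact: perm_trans tL LK.
Qed.

Lemma attained0 L : attained L 0.
Proof. by exists 0; [apply: supported0 | rewrite linear0]. Qed.

Lemma attainedD L a b : attained L a -> attained L b -> attained L (a + b).
Proof.
by move=> [f fL <-] [g gL <-]; exists (f + g); [apply: supportedD | rewrite linearD].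
Qed.

Lemma attainedZ L c a : attained L a -> attained L (c *: a).
Proof.
by move=> [f fL <-]; exists (c *: f); [apply: supportedZ | rewrite linearZ].
Qed.

Lemma attainedN L a : attained L a -> attained L (- a).
Proof. by rewrite -scaleN1r; apply: attainedZ. Qed.

Lemma attained_half L a : attained L (a + a) -> attained L a.
Proof.
move=> /(attainedZ 2^-1); rewrite -mulr2n -scaler_nat scalerA mulVf //.
by rewrite scale1r.
Qed.

Lemma attained_tree t : attained (leaves t) (tree_eval x t).
Proof. by exists << t >>; [apply: supportedU | rewrite linextU]. Qed.

(** Applied to one argument at a time, this gives closure under the commutator
    and the symmetrized product. *)
Lemma attained_linear L K (h : A -> A) : linear h ->
  (forall t, perm_eq (leaves t) L -> attained K (h (tree_eval x t))) ->
  forall a, attained L a -> attained K (h a).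
Proof.
move=> lh ht a [f fL <-].
pose lin : {linear A -> A} := HB.pack h (GRing.isLinear.Build rat A A _ _ lh).
rewrite -[h _]/(lin _) linear_linext /linext big_seq.
elim/big_ind: _ => [||t tf]; [exact: attained0|exact: attainedD|].
by apply: attainedZ; apply: ht; apply: fL.
Qed.

Lemma attained_comm L K a b :
  attained L a -> attained K b -> attained (L ++ K) (comm a b).
Proof.
move=> La Kb; apply: (attained_linear (h := fun a => comm a b) _ _ La) => [c a1 a2|s sL].
  by rewrite comm_linear.
apply: (attained_linear _ _ Kb) => [c b1 b2|t tK]; first by rewrite comm_linear.
by apply: attained_perm (attained_tree (Nu s t)) _; apply: perm_cat.
Qed.

Lemma attained_sym3 L K M a b c :
  attained L a -> attained K b -> attained M c ->
  attained (L ++ K ++ M) (sym3 a b c).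
Proof.
move=> La Kb Mc; apply: (attained_linear (h := fun a => sym3 a b c) _ _ La) => [p a1 a2|s sL].
  by rewrite sym3_linear.
apply: (attained_linear (h := fun b => sym3 _ b c) _ _ Kb) => [p b1 b2|t tK].
  by rewrite !(sym3_swap12 (tree_eval x s)) sym3_linear.
apply: (attained_linear _ _ Mc) => [p c1 c2|r rM].
  by rewrite !(sym3_rot (tree_eval x s)) sym3_linear.
apply: attained_perm (attained_tree (Mu s t r)) _.
by apply: perm_cat => //; apply: perm_cat.
Qed.

(** The Jordan triple product is generated, because
    3 (abc + cba) = sym3 a b c + [[a, b], c] + [a, [b, c]]. *)
Lemma attained_triple L K M a b c :
  attained L a -> attained K b -> attained M c ->
  attained (L ++ K ++ M) (a * b * c + c * b * a).
Proof.
move=> La Kb Mc.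
have E : (3%:R : rat) *: (a * b * c + c * b * a) =
    sym3 a b c + comm (comm a b) c + comm a (comm b c).
  pose y := nth 0 [:: a; b; c].
  have -> : 3%:R *: (a * b * c + c * b * a) =
      word_sum y [:: (3, [:: 0; 1; 2]%N); (3, [:: 2; 1; 0]%N)].
    by rewrite /word_sum !big_cons !big_nil /y /= !mulr1 !addr0 scalerDr !mulrA.
  pose l := expand (Mu 0 1 2) ++ expand (Nu (Nu 0 1) 2) ++ expand (Nu 0 (Nu 1 2)).
  have -> : sym3 a b c + comm (comm a b) c + comm a (comm b c) = word_sum y l.
    by rewrite /l 2!word_sum_cat -!expandE /y /= [RHS]addrA.
  apply: subr0_eq; rewrite -word_sum_opp -word_sum_cat.
  by apply: cancelsP; vm_compute.
have := attainedZ 3^-1 (attainedD (attainedD (attained_sym3 La Kb Mc)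
  (attained_perm (attained_comm (attained_comm La Kb) Mc) _))
  (attained_comm La (attained_comm Kb Mc))).
rewrite -E scalerA mulVf // scale1r; apply.
by rewrite catA.
Qed.

(** The difference between a product and its image under an antiautomorphism
    that negates all the factors. *)
Definition skewprod (s : seq A) : A :=
  \prod_(a <- s) a - (-1) ^+ size s *: \prod_(a <- rev s) a.

(** Exchanging two adjacent factors changes a skew product by a skew product
    with one factor less; by induction on the number of factors, the order of
    the factors therefore does not matter modulo generated elements. *)
Lemma skew_swap p a b q :
  skewprod (p ++ a :: b :: q) - skewprod (p ++ b :: a :: q) = skewprod (p ++ comm a b :: q).
Proof.
rewrite /skewprod !rev_cat !rev_cons -!cats1 -!catA !big_cat !big_cons !big_nil /=.
rewrite !mulr1 !size_cat /= !addnS; set e := (size p + size q)%N.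
have -> : (-1) ^+ e.+2 = - (-1) ^+ e.+1 :> rat by rewrite exprS mulN1r.
rewrite !scaleNr !opprK /comm !(mulrBl, mulrBr) scalerBr opprB -!mulrA.
by rewrite opprD addrACA.
Qed.

(** A factor comes with the list of the labels that it uses, since the inputs of
    the operation must be accounted for. *)
Let flabels (s : seq (seq nat * A)) := flatten (unzip1 s).

Definition attained_family (s : seq (seq nat * A)) : Prop :=
  forall p, p \in s -> attained p.1 p.2.

Definition skew_generated n := forall s : seq (seq nat * A),
  (0 < size s <= n)%N -> attained_family s -> attained (flabels s) (skewprod (unzip2 s)).

Lemma flabels_perm s t : perm_eq s t -> perm_eq (flabels s) (flabels t).
Proof. by move=> st; apply: perm_flatten; apply: perm_map. Qed.

Lemma attained_family_perm s t :
  perm_eq s t -> attained_family s -> attained_family t.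
Proof. by move=> st gs p; rewrite -(perm_mem st); apply: gs. Qed.

Section Step.
Variable n : nat.
Hypothesis IHn : skew_generated n.

Let fam s := size s = n.+1 /\ attained_family s.

Let equiv (s t : seq (seq nat * A)) := perm_eq s t /\
  (fam s -> attained (flabels s) (skewprod (unzip2 s) - skewprod (unzip2 t))).

Let fam_perm s t : perm_eq s t -> fam s -> fam t.
Proof.
by move=> st [sn gs]; split; rewrite -?(perm_size st) //; apply: attained_family_perm gs.
Qed.

Let equiv_refl s : equiv s s.
Proof. by split=> // _; rewrite subrr; apply: attained0. Qed.

Let equiv_sym s t : equiv s t -> equiv t s.
Proof.
move=> [st est]; split; first by rewrite perm_sym.
move=> ft.
have fs : fam s by apply: fam_perm ft; rewrite perm_sym.
rewrite -opprB; apply: attainedN.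
by apply: attained_perm (est fs) _; apply: flabels_perm.
Qed.

Let equiv_trans t s r : equiv s t -> equiv t r -> equiv s r.
Proof.
move=> [st est] [tr etr]; split; first exact: perm_trans st tr.
move=> fs; rewrite -(subrKA (skewprod (unzip2 t))); apply: attainedD; first exact: est.
apply: attained_perm (etr (fam_perm st fs)) _.
by apply: flabels_perm; rewrite perm_sym.
Qed.

Let equiv_swap p a b q : equiv (p ++ a :: b :: q) (p ++ b :: a :: q).
Proof.
have pe : perm_eq (p ++ a :: b :: q) (p ++ b :: a :: q).
  by rewrite perm_cat2l (perm_catCA [:: a] [:: b]).
split=> // -[sz gs]; rewrite /unzip2 !map_cat /= skew_swap.
pose s := p ++ (a.1 ++ b.1, comm a.2 b.2) :: q.
have -> : flabels (p ++ a :: b :: q) = flabels s.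
  by rewrite /flabels /unzip1 /s !map_cat !flatten_cat /= -!catA.
have := IHn (s := s); rewrite /unzip2 map_cat; apply.
  by move: sz; rewrite /s !size_cat /= !addnS => -[<-]; rewrite leqnn.
move=> r; rewrite mem_cat inE => /or3P[rp|/eqP->|rq].
- by apply: gs; rewrite mem_cat rp.
- by apply: attained_comm; apply: gs; rewrite mem_cat !inE eqxx !orbT.
by apply: gs; rewrite mem_cat !inE rq !orbT.
Qed.

Let equiv_move p a q r : equiv (p ++ a :: q ++ r) (p ++ q ++ a :: r).
Proof.
elim: q p => [|b q IHq] p; first exact: equiv_refl.
apply: equiv_trans (equiv_swap _ _ _ _) _.
by have := IHq (rcons p b); rewrite !cat_rcons.
Qed.

Let equiv_rev p s r : equiv (p ++ s ++ r) (p ++ rev s ++ r).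
Proof.
elim: s r => [|a s IHs] r; first exact: equiv_refl.
apply: equiv_trans (equiv_move _ _ _ _) _.
by rewrite rev_cons cat_rcons; apply: IHs.
Qed.

(** Modulo skew products with fewer factors, the factors may be reordered.  For
    an even number of factors, reversal also changes the sign, so that twice the
    skew product is generated.  For an odd number at least 3, the triple
    product of the first factor, of the skew product of the inner ones and of
    the last factor is a sum of two skew products of all the factors, which are
    congruent. *)
Lemma skew_generated_step : skew_generated n.+1.
Proof.
move=> s /andP[s0]; rewrite leq_eqVlt => /orP[/eqP sz|sz] gs; last first.
  by apply: IHn => //; rewrite s0.
have fs : fam s by split.
have [odd_s|even_s] := boolP (odd (size s)); last first.
  have := equiv_rev [::] s [::]; rewrite !cats0 /= => -[_ /(_ fs)].
  have -> : skewprod (unzip2 (rev s)) = - skewprod (unzip2 s).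
    rewrite /skewprod /unzip2 map_rev revK size_rev !size_map -signr_odd.
    by rewrite (negPf even_s) !scale1r opprB.
  by rewrite opprK; apply: attained_half.
case: s {s0} gs sz fs odd_s => // a s; case: (lastP s) => [|m c] {s} gs sz fs odd_s.
  apply: attained_half; rewrite /skewprod /= !big_seq1 expr1 scaleN1r opprK.
  apply: attainedD; apply: attainedD;
  by rewrite /flabels /= cats0; apply: gs; rewrite inE.
have om : odd (size m) by move: odd_s; rewrite /= size_rcons negbK.
have gm : attained (flabels m) (skewprod (unzip2 m)).
  apply: IHn => [|p pm]; last by apply: gs; rewrite inE mem_rcons inE pm !orbT.
  by move: sz; rewrite /= size_rcons => -[<-]; rewrite leqnSn; case: (m) om.
have ga : attained a.1 a.2 by apply: gs; rewrite inE eqxx.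
have gc : attained c.1 c.2 by apply: gs; rewrite inE mem_rcons inE eqxx orbT.
have := attained_triple ga gm gc.
have -> : a.2 * skewprod (unzip2 m) * c.2 + c.2 * skewprod (unzip2 m) * a.2 =
   skewprod (unzip2 (a :: rcons m c)) + skewprod (unzip2 (c :: rcons m a)).
  rewrite /skewprod /unzip2 /= !map_rcons !rev_cons !rev_rcons /= !size_rcons !size_map.
  have -> : (-1) ^+ (size m).+2 = -1 :> rat by rewrite -signr_odd /= negbK om.
  have -> : (-1) ^+ size m = -1 :> rat by rewrite -signr_odd om.
  rewrite -!cats1 /= !(big_cons, big_cat, big_seq1) /= !scaleN1r !opprK.
  by rewrite !big_nil !mulr1 !(mulrDr, mulrDl) !mulrA [LHS](AC (2*2) ((1*4)*(3*2))).
have -> : a.1 ++ flabels m ++ c.1 = flabels (a :: rcons m c).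
  by rewrite /flabels /= /unzip1 map_rcons flatten_rcons.
have [_ /(_ fs) e] : equiv (a :: rcons m c) (c :: rcons m a).
  apply: (@equiv_trans (m ++ [:: a; c])).
    by rewrite -cats1; apply: (equiv_move [::] a m [:: c]).
  apply: equiv_sym; have := equiv_move [::] c (rcons m a) [::].
  by rewrite /= cats0 cat_rcons.
move=> /(attainedD e) e2; apply: attained_half.
by move: e2; rewrite addrACA addNr addr0.
Qed.
End Step.

Lemma skew_generatedT s : s != [::] -> attained_family s ->
  attained (flabels s) (skewprod (unzip2 s)).
Proof.
move=> s0; have : skew_generated (size s).
  elim: (size s) => [|n IHn]; first by move=> t; case: (size t).
  exact: skew_generated_step.
by apply; rewrite leqnn lt0n size_eq0 s0.
Qed.
End Generation.

Lemma prod_letter w : \prod_(a <- map letter w) a = wordA w.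
Proof.
rewrite big_map; elim: w => [|i w IHw]; first by rewrite big_nil -[RHS]/(word [::]) word0.
by rewrite big_cons IHw letterE [LHS]wordAM.
Qed.

Lemma skew_letter w :
  skewprod (map letter w) = wordA w - antipode (wordA w).
Proof.
rewrite antipode_word /skewprod -map_rev size_map !prod_letter; reflexivity.
Qed.

Lemma skew_letter_attained w n : (0 < n)%N -> perm_eq w (iota 1 n) ->
  attained letter (iota 1 n) (skewprod (map letter w)).
Proof.
move=> n0 wn; pose s := [seq ([:: i], letter i) | i <- w].
have s0 : s != [::].
  by rewrite -size_eq0 size_map (perm_size wn) size_iota -lt0n.
have gs : attained_family letter s.
  by move=> _ /mapP[i _ ->]; apply: (attained_tree letter (Leaf i)).
have := skew_generatedT s0 gs.
rewrite /s /unzip1 /unzip2 -!map_comp => /attained_perm; apply.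
by rewrite -[X in perm_eq X](_ : w = _) //; elim: (w) => //= i v <-.
Qed.

Lemma sub_antipodeE (a : FA) : a - antipode a =
  linext (fun w : {fmonom nat} => skewprod (map letter (fmonom_val w))) (a : freeAlg).
Proof.
have subP (V : lmodType rat) (h : {linear V -> V}) : linear (fun v => v - h v).
  by move=> c u v; rewrite linearP scalerBr opprD addrACA.
apply: (eq_linear_span FA_ind (f := fun b => b - antipode b)
  (g := fun b : FA => linext (fun w : {fmonom nat} => skewprod (map letter (fmonom_val w)))
    (b : freeAlg))) => [||w].
- exact: subP.
- exact: linext_is_linear.
by rewrite -skew_letter [RHS]linextU.
Qed.

(** Twice an invariant [a] is the difference of [a] and of its antipode, hence a
    combination of skew products of letters. *)
Lemma As_inv_attained n a : As_inv n a ->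
  exists2 f, free_op n f & realize f = a.
Proof.
move=> [an ta].
suff [f fn fa] : attained letter (iota 1 n) (a : FA).
  by exists f; [exact: fn | rewrite realizeE; exact: fa].
apply: attained_half.
have -> : (a : FA) + a = linext (fun w : {fmonom nat} => skewprod (map letter (fmonom_val w))) a.
  rewrite -{2}ta tauE => [|w /an[n0 /perm_size->]]; last by rewrite size_iota.
  exact: sub_antipodeE.
rewrite /linext big_seq; elim/big_ind: _ => [||w wa].
- exact: attained0.
- exact: attainedD.
by apply: attainedZ; have [n0 wn] := an w wa; apply: skew_letter_attained.
Qed.

(** * The ideal on arbitrary labels *)

Definition pos (L : seq nat) (i : nat) : nat := (index i L).+1.

Lemma map_pos L : uniq L -> map (pos L) L = iota 1 (size L).
Proof.
move=> uL; apply: (@eq_from_nth _ 0%N); rewrite size_map ?size_iota // => k kL.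
by rewrite (nth_map 0%N) // nth_iota // /pos index_uniq.
Qed.

Lemma leaves_subst s t :
  leaves (tree_subst s t) = flatten [seq leaves (s i) | i <- leaves t].
Proof.
elim: t => [i|a IHa b IHb|a IHa b IHb c IHc] /=; first by rewrite cats0.
  by rewrite map_cat flatten_cat IHa IHb.
by rewrite !map_cat !flatten_cat IHa IHb IHc.
Qed.

Lemma leaves_relabel s t : leaves (tree_relabel s t) = map s (leaves t).
Proof. by rewrite leaves_subst flatten_map1. Qed.

Lemma tree_subst_id s t : {in leaves t, forall i, s i = Leaf i} -> tree_subst s t = t.
Proof.
move=> /eq_tree_subst->.
by elim: t => [//|a /= -> b ->|a /= -> b -> c ->].
Qed.

Definition has_labels (L : seq nat) : treeMod -> Prop :=
  supported (fun t => perm_eq (leaves t) L).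

(** The ideal of the operad on inputs with arbitrary labels.  Its closure under
    contexts and substitutions does not involve the renumbering of inputs that
    partial compositions perform; [pos] hides this renumbering. *)
Definition ideal (L : seq nat) (f : treeMod) : Prop :=
  has_labels L f /\ operad_ideal presentation_rel (size L) (relabel (pos L) f).

Lemma ideal0 L : ideal L 0.
Proof.
split; first exact: supported0.
by rewrite relabelE linear0; apply: OI_zero.
Qed.

Lemma idealD L f g : ideal L f -> ideal L g -> ideal L (f + g).
Proof.
move=> [fL fi] [gL gi]; split; first exact: supportedD.
by rewrite relabelE linearD; apply: OI_add.
Qed.

Lemma idealZ L c f : ideal L f -> ideal L (c *: f).
Proof.
move=> [fL fi]; split; first exact: supportedZ.
by rewrite relabelE linearZ; apply: OI_scale.
Qed.

Lemma idealN L f : ideal L f -> ideal L (- f).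
Proof. by rewrite -scaleN1r; apply: idealZ. Qed.

Lemma ideal_perm L K f : uniq L -> perm_eq L K -> ideal L f -> ideal K f.
Proof.
move=> uL LK [fL fi]; split; first by move=> t /fL /perm_trans; apply.
pose s k := pos K (nth 0%N L k.-1).
have -> : relabel (pos K) f = relabel s (relabel (pos L) f).
  rewrite !relabelE tsubst_comp; apply: eq_tsubst => t /fL tL i it /=.
  by rewrite /s /pos /= nth_index // -(perm_mem tL).
rewrite -(perm_size LK); apply: OI_perm fi; rewrite /permutes.
have uK : uniq K by rewrite -(perm_uniq LK).
rewrite {2}(perm_size LK) -(map_pos uK).
have -> : [seq s i | i <- iota 1 (size L)] = map (pos K) L.
  rewrite -(map_pos uL) -map_comp; apply/eq_in_map => i iL /=.
  by rewrite /s /pos /= nth_index.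
exact: perm_map.
Qed.

Lemma linext_comp (J K : choiceType) (V : lmodType rat) (F : K -> V) (h : J -> K)
    (f : {malg rat[J]}) :
  linext F (linext (fun j => << h j >>) f) = linext (F \o h) f.
Proof. by rewrite linear_linext; apply: eq_in_linext => j _ /=; rewrite linextU. Qed.

Definition plug (i : nat) (t s : tree) : tree :=
  tree_subst (fun j => if j == i then t else Leaf j) s.

Definition plug2 (i : nat) (f g : treeMod) : treeMod :=
  linext (fun s => linext (fun t => << plug i t s >>) g) f.

Section Plug.
Variables (L1 L2 K : seq nat) (i : nat).
Hypotheses (uL : uniq (L1 ++ i :: L2)) (uM : uniq (L1 ++ K ++ L2)).
Let L := L1 ++ i :: L2.
Let M := L1 ++ K ++ L2.

(** Inserting the labels [K] in place of [i] in the list [L1 ++ i :: L2] moves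
    the positions as the partial composition at the position of [i] does. *)
Lemma relabel_plug2 f g : has_labels L f -> has_labels K g ->
  relabel (pos M) (plug2 i f g) =
  Defs.pcomp (size L1).+1 (size K) (relabel (pos L) f) (relabel (pos K) g).
Proof.
move=> fL gK; rewrite /Defs.pcomp graftE !relabelE /tsubst /plug2 !linext_comp.
rewrite linear_linext; apply: eq_in_linext => s /fL sL /=.
rewrite linear_linext linext_comp; apply: eq_in_linext => t /gK tK /=.
rewrite linextU /plug /graft_tree /tree_relabel !tree_subst_comp; congr << _ >>.
move: uL uM; rewrite /M !cat_uniq /= has_cat !negb_or -!andbA.
move=> /and5P[uL1 iL1 nL12 iL2 uL2] /and5P[_ nL1K nL1L2 uK /andP[nKL2 _]].
apply: eq_tree_subst => j; rewrite (perm_mem sL) /L => jL /=.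
have [->|ji] := eqVneq j i.
  rewrite /pos index_cat (negPf iL1) /= eqxx addn0 eqxx.
  apply: eq_tree_subst => k; rewrite (perm_mem tK) => kK /=.
  rewrite !index_cat (negPf (hasPn nL1K k kK)) kK.
  by rewrite addnS addnC.
move: jL; rewrite mem_cat inE (negPf ji) /= => /orP[jL1|jL2].
  rewrite /pos !index_cat jL1.
  have lt : (index j L1 < size L1)%N by rewrite index_mem.
  by rewrite eqSS (ltn_eqF lt) ltnS lt.
have jL1 : j \notin L1 by exact: (hasPn nL12).
rewrite /pos !index_cat (negPf jL1) (negPf (hasPn nKL2 j jL2)) /= [i == j]eq_sym (negPf ji).
rewrite eqSS -[X in _ == X]addn0 eqn_add2l /= ltnS -[X in (_ <= X)%N]addn0.
by rewrite ltn_add2l /= addnS addSn -addnA [(index j L2 + _)%N]addnC.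
Qed.

Lemma has_labels_plug2 f g : has_labels L f -> has_labels K g -> has_labels M (plug2 i f g).
Proof.
move=> fL gK; apply: supported_linext => s /fL sL; apply: supported_linext => t /gK tK.
apply: supportedU; rewrite leaves_subst.
apply: (perm_trans (perm_flatten (perm_map _ sL))).
have [iL1 iL2] : i \notin L1 /\ i \notin L2.
  by move: uL; rewrite cat_uniq /= negb_or -!andbA => /and5P[].
have notin (N : seq nat) : i \notin N ->
    flatten [seq leaves (if j == i then t else Leaf j) | j <- N] = N.
  move=> iN; rewrite -[RHS]map_id -[RHS]flatten_map1; congr flatten.
  by apply/eq_in_map => j jN; case: eqP iN => // <-; rewrite jN.
rewrite map_cat flatten_cat /= eqxx !notin //.
by rewrite perm_cat2l perm_cat2r.
Qed.

Lemma size_plug : size M = (size L + size K).-1.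
Proof. by rewrite !size_cat /=; lia. Qed.

Lemma free_op_pos N h : uniq N -> has_labels N h -> free_op (size N) (relabel (pos N) h).
Proof.
move=> uN hN; apply: supported_linext => t /hN tN; apply: supportedU.
by rewrite leaves_relabel -(map_pos uN); apply: perm_map.
Qed.

Let range_i : (0 < (size L1).+1 <= size L)%N.
Proof. by rewrite size_cat /= addnS ltnS leq_addr. Qed.

Let uK : uniq K.
Proof. by move: uM; rewrite !cat_uniq => /and3P[_ _ /and3P[]]. Qed.

Lemma ideal_plugl f g : ideal L f -> has_labels K g -> ideal M (plug2 i f g).
Proof.
move=> [fL fi] gK; split; first exact: has_labels_plug2.
rewrite relabel_plug2 // size_plug; apply: OI_compl => //.
exact: free_op_pos.
Qed.

Lemma ideal_plugr f g : has_labels L f -> ideal K g -> ideal M (plug2 i f g).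
Proof.
move=> fL [gK gi]; split; first exact: has_labels_plug2.
rewrite relabel_plug2 // size_plug; apply: OI_compr => //.
exact: free_op_pos.
Qed.
End Plug.

Lemma plug_notin i t s : i \notin leaves s -> plug i t s = s.
Proof.
by move=> si; apply: tree_subst_id => j js; case: eqP si => // <-; rewrite js.
Qed.

Lemma plug2U i f t : plug2 i f << t >> = linext (fun s => << plug i t s >>) f.
Proof. by apply: eq_in_linext => s _; rewrite linextU. Qed.

(** The operadic context [c] has its hole at the leaf [i]. *)
Lemma ideal_context L1 L2 K i c f :
  leaves c = L1 ++ i :: L2 -> uniq (L1 ++ i :: L2) -> uniq (L1 ++ K ++ L2) ->
  ideal K f -> ideal (L1 ++ K ++ L2) (linext (fun t => << plug i t c >>) f).
Proof.
move=> ci uL uM fi.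
have -> : linext (fun t => << plug i t c >>) f = plug2 i << c >> f by rewrite /plug2 linextU.
by apply: ideal_plugr fi => //; apply: supportedU; rewrite ci.
Qed.

Lemma leq_bigmax_seq (L : seq nat) i : i \in L -> (i <= \max_(j <- L) j)%N.
Proof. by move=> iL; rewrite (big_rem i) //= leq_maxl. Qed.

Lemma ex_fresh (L : seq nat) : exists i, i \notin L.
Proof.
exists (\max_(j <- L) j).+1; apply/negP => /leq_bigmax_seq.
by rewrite ltnn.
Qed.

(** A context with one hole, as a function: [L1] and [L2] are the labels to the
    left and to the right of the hole. *)
Definition context (L1 L2 : seq nat) (h : tree -> tree) : Prop :=
  forall i, i \notin L1 ++ L2 ->
    leaves (h (Leaf i)) = L1 ++ i :: L2 /\ forall t, plug i t (h (Leaf i)) = h t.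

Lemma context_Nu1 b : context [::] (leaves b) (fun t => Nu t b).
Proof.
move=> i ib; split=> // t.
by rewrite /plug /= eqxx -/(plug i t b) plug_notin.
Qed.

Lemma context_Nu2 a : context (leaves a) [::] (fun t => Nu a t).
Proof.
move=> i; rewrite cats0 => ia; split=> // t.
by rewrite /plug /= eqxx -/(plug i t a) plug_notin.
Qed.

Lemma context_Mu1 b c : context [::] (leaves b ++ leaves c) (fun t => Mu t b c).
Proof.
move=> i; rewrite /= mem_cat negb_or => /andP[ib ic]; split=> // t.
by rewrite /plug /= eqxx -/(plug i t b) -/(plug i t c) !plug_notin.
Qed.

Lemma context_Mu2 a c : context (leaves a) (leaves c) (fun t => Mu a t c).
Proof.
move=> i; rewrite mem_cat negb_or => /andP[ia ic]; split=> // t.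
by rewrite /plug /= eqxx -/(plug i t a) -/(plug i t c) !plug_notin.
Qed.

Lemma context_Mu3 a b : context (leaves a ++ leaves b) [::] (fun t => Mu a b t).
Proof.
move=> i; rewrite cats0 mem_cat negb_or => /andP[ia ib]; split=> [|t].
  by rewrite /= catA.
by rewrite /plug /= eqxx -/(plug i t a) -/(plug i t b) !plug_notin.
Qed.

Section Contexts.
Variables (L1 L2 : seq nat) (h : tree -> tree).
Hypothesis hP : context L1 L2 h.

(** The hole can be given a label that is not used elsewhere. *)
Lemma contextP K : uniq (L1 ++ K ++ L2) -> exists i,
  [/\ uniq (leaves (h (Leaf i))), leaves (h (Leaf i)) = L1 ++ i :: L2 &
      forall t, h t = plug i t (h (Leaf i))].
Proof.
move=> u; have [i iL] := ex_fresh (L1 ++ L2).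
have [hi hplug] := hP iL; exists i; split=> //; rewrite hi.
move: iL u; rewrite mem_cat negb_or !cat_uniq /= has_cat !negb_or.
by move=> /andP[-> ->] /and3P[-> /andP[_ ->] /and3P[_ _ ->]].
Qed.

Lemma leaves_context t : leaves (h t) = L1 ++ leaves t ++ L2.
Proof.
have [i iL] := ex_fresh (L1 ++ L2); have [hi <-] := hP iL.
rewrite leaves_subst hi map_cat flatten_cat /= eqxx.
have notin (N : seq nat) : i \notin N ->
    flatten [seq leaves (if j == i then t else Leaf j) | j <- N] = N.
  move=> iN; rewrite -[RHS]map_id -[RHS]flatten_map1; congr flatten.
  by apply/eq_in_map => j jN; case: eqP iN => // <-; rewrite jN.
by move: iL; rewrite mem_cat negb_or => /andP[? ?]; rewrite !notin.
Qed.

Lemma ideal_in_context K f : ideal K f -> uniq (L1 ++ K ++ L2) ->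
  ideal (L1 ++ K ++ L2) (linext (fun t => << h t >>) f).
Proof.
move=> fi u; have [i [ui hi hplug]] := contextP u.
rewrite (eq_in_linext (G := fun t => << plug i t (h (Leaf i)) >>)); last first.
  by move=> t _; rewrite hplug.
by apply: ideal_context => //; rewrite -hi.
Qed.
End Contexts.

(** * Substitution instances of the relations *)

Lemma ideal_relabel N L f : ideal L f ->
  ideal (map (addn N) L) (relabel (addn N) f).
Proof.
move=> [fL fi]; split.
  apply: supported_linext => t /fL tL; apply: supportedU.
  by rewrite leaves_relabel; apply: perm_map.
rewrite size_map; suff -> : relabel (pos (map (addn N) L)) (relabel (addn N) f) =
    relabel (pos L) f by [].
rewrite !relabelE tsubst_comp; apply: eq_tsubst => t _ i _ /=.
by rewrite /pos index_map //; apply: addnI.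
Qed.

(** Leaves are replaced one at a time, by partial compositions.  This requires
    that the labels still to be replaced do not occur in the inserted trees. *)
Lemma ideal_subst1 K L s g :
  {in L, forall j, j \notin flatten [seq leaves (s i) | i <- L]} ->
  uniq (K ++ L) -> uniq (K ++ flatten [seq leaves (s i) | i <- L]) ->
  ideal (K ++ L) g ->
  ideal (K ++ flatten [seq leaves (s i) | i <- L])
        (tsubst (fun j => if j \in L then s j else Leaf j) g).
Proof.
elim: L K g => [|i L IHL] K g nL uKL uM gi /=.
  rewrite !cats0 in gi *; suff -> : tsubst (fun j => Leaf j) g = g by [].
  rewrite [RHS]malg_linext; apply: eq_in_linext => t _.
  by rewrite tree_subst_id.
have iL : i \notin L by move: uKL; rewrite cat_uniq => /and3P[_ _ /= /andP[]].
have nL' : {in L, forall j, j \notin flatten [seq leaves (s i) | i <- L]}.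
  by move=> j jL; have := nL j; rewrite inE jL orbT /= mem_cat negb_or => /(_ isT)/andP[].
have nsi : {in L, forall j, j \notin leaves (s i)}.
  by move=> j jL; have := nL j; rewrite inE jL orbT /= mem_cat negb_or => /(_ isT)/andP[].
have uKsL : uniq (K ++ leaves (s i) ++ L).
  move: uKL uM; rewrite /= !cat_uniq /= !has_cat /= !negb_or -!andbA.
  move=> /and5P[-> iK nKL _ ->] /and5P[_ -> _ -> _]; rewrite nKL !andbT /=.
  by apply/hasPn => j /nsi.
have hsi : has_labels (leaves (s i)) << s i >> by apply: supportedU.
have := ideal_plugl uKL uKsL gi hsi; rewrite plug2U catA => gi'.
have := IHL (K ++ leaves (s i)) _ nL' _ _ gi'.
rewrite -!catA => /(_ uKsL uM); congr ideal.
rewrite [LHS]linext_comp; apply: eq_in_linext => t _ /=; congr << _ >>.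
rewrite /plug tree_subst_comp; apply: eq_tree_subst => j _ /=; rewrite inE.
have [->|ji] //= := eqVneq j i.
apply: tree_subst_id => k ki; case: ifP => // /nsi.
by rewrite ki.
Qed.

(** The labels to be replaced are first shifted beyond those of the inserted
    trees. *)
Lemma ideal_subst L s g : uniq L -> uniq (flatten [seq leaves (s i) | i <- L]) ->
  ideal L g -> ideal (flatten [seq leaves (s i) | i <- L]) (tsubst s g).
Proof.
move=> uL uF gi; pose F := flatten [seq leaves (s i) | i <- L].
pose N := (\max_(j <- F) j).+1.
pose s' j := s (j - N)%N.
have E : [seq leaves (s' i) | i <- map (addn N) L] = [seq leaves (s i) | i <- L].
  by rewrite -map_comp; apply: eq_map => i /=; rewrite /s' addKn.
have := @ideal_subst1 [::] (map (addn N) L) s' (relabel (addn N) g).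
rewrite E /= => /(_ _ _ uF (ideal_relabel N gi)) H.
have {}H := H _ _; rewrite (_ : tsubst s g =
  tsubst (fun j => if j \in map (addn N) L then s' j else Leaf j) (relabel (addn N) g)).
  apply: H.
    move=> j /mapP[k _ ->]; apply/negP => /leq_bigmax_seq.
    by rewrite leqNgt ltnS leq_addr.
  by rewrite map_inj_uniq //; apply: addnI.
rewrite relabelE tsubst_comp; apply: eq_tsubst => t /(proj1 gi) tL i it /=.
by rewrite map_f ?/s' ?addKn // -(perm_mem tL).
Qed.

Lemma pos_iota n i : i \in iota 1 n -> pos (iota 1 n) i = i.
Proof.
rewrite mem_iota => /andP[i1 i2]; have lt : (i.-1 < n)%N by lia.
have ni : nth 0%N (iota 1 n) i.-1 = i by rewrite nth_iota //; lia.
rewrite /pos -{1}ni index_uniq ?iota_uniq ?size_iota //.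
by rewrite prednK.
Qed.

Lemma relabel_pos_iota n f : free_op n f -> relabel (pos (iota 1 n)) f = f.
Proof.
move=> fn; rewrite [RHS]malg_linext; apply: eq_in_linext => t /fn tn; congr << _ >>.
by apply: tree_subst_id => i; rewrite (perm_mem tn) => /pos_iota->.
Qed.

Lemma ideal_rel n r : presentation_rel n r -> free_op n r -> ideal (iota 1 n) r.
Proof.
by move=> rn fr; split=> //; rewrite size_iota relabel_pos_iota //; apply: OI_gen.
Qed.

Lemma ideal_operad n f : ideal (iota 1 n) f -> operad_ideal presentation_rel n f.
Proof. by move=> [fn]; rewrite size_iota relabel_pos_iota. Qed.

Lemma defining_rel_free n r : defining_rel n r -> free_op n r.
Proof.
have H m (l : seq (int * tree)) : all (fun p => perm_eq (leaves p.2) (iota 1 m)) l ->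
    free_op m (lincomb60 l).
  by move=> /allP lP; apply: supported_lincomb => _ /mapP[p /lP pm ->].
by case; rewrite ?jacobi60 ?derivation60 ?associativity60; apply: H.
Qed.

Lemma symmetry_rel_free n r : symmetry_rel n r -> free_op n r.
Proof.
case=> [|i j k ijk]; apply: supported_lincomb => p; rewrite !inE.
  by move=> /orP[]/eqP->.
by move=> /orP[]/eqP->.
Qed.

Lemma ideal_rel_subst n r s : presentation_rel n r ->
  uniq (flatten [seq leaves (s i) | i <- iota 1 n]) ->
  ideal (flatten [seq leaves (s i) | i <- iota 1 n]) (tsubst s r).
Proof.
move=> rn us; apply: ideal_subst; rewrite ?iota_uniq //; apply: ideal_rel => //.
by case: rn => [/symmetry_rel_free|/defining_rel_free].
Qed.

(** * The ordering *)

Lemma word_lex_ltxx u : word_lex_lt u u = false.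
Proof. by elim: u => //= x u IHu; rewrite eqxx. Qed.

Lemma word_ltxx u : word_lt u u = false.
Proof. by rewrite /word_lt ltnn eqxx word_lex_ltxx. Qed.

Lemma word_lt_cat2l p u v : word_lt (p ++ u) (p ++ v) = word_lt u v.
Proof.
rewrite /word_lt !count_cat ltn_add2l eqn_add2l; congr (_ || _ && _).
by elim: p => //= x p ->; rewrite eqxx.
Qed.

Lemma word_lex_lt_nseq_false k q : word_lex_lt (nseq k.+1 false ++ q) q.
Proof.
elim: q k => [|[] q IHq] k //=.
by have := IHq k; rewrite -[nseq k.+1 _ ++ q]/(false :: nseq k false ++ q)
  -[false :: nseq k _ ++ q]/(nseq k.+1 false ++ q) -addn1 nseqD -catA.
Qed.

(** The end of the word lies between the two letters, so that appending a
    common suffix cannot reverse a comparison of words of the same degree. *)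
Lemma word_lt_cat2r u v q : word_lt u v -> word_lt (u ++ q) (v ++ q).
Proof.
rewrite /word_lt !count_cat ltn_add2r eqn_add2r => /orP[->//|/andP[duv luv]].
apply/orP; right; rewrite duv /=.
elim: u v duv luv => [|x u IHu] [|y v] //=.
- by case: y => //=; rewrite add1n => /eqP.
- case: x => //= du _; suff -> : u = nseq (size u) false by apply: word_lex_lt_nseq_false.
  apply/all_pred1P; apply/allP => -[] //= ut.
  by move: du; rewrite add0n -leqn0 leqNgt -has_count has_pred1 ut.
have [->|//] := eqVneq x y; rewrite eqn_add2l; exact: IHu.
Qed.

(** The part of the monomial order that decides all the comparisons below: degree
    in the ternary operation, then path words.  The path words are compared
    through the first leaf where they differ, which makes sense for arbitrary
    labels. *)
Definition less (s t : tree) : Prop :=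
  perm_eq (leaves s) (leaves t) /\
  ((mu_degree s < mu_degree t)%N \/
   mu_degree s = mu_degree t /\
   exists2 i, i \in leaves t &
     {in leaves t, forall j, (j < i)%N -> path_word s j = path_word t j} /\
     word_lt (path_word s i) (path_word t i)).

(** The comparison of two monomials into which trees are substituted, the label
    [i] being replaced by a tree with minimal leaf [m i]. *)
Definition less_under (m : nat -> nat) (s t : tree) : Prop :=
  (mu_degree s < mu_degree t)%N \/
  mu_degree s = mu_degree t /\
  exists2 k, k \in leaves t &
    {in leaves t, forall j, (m j < m k)%N -> path_word s j = path_word t j} /\
    word_lt (path_word s k) (path_word t k).

Lemma min_leaf_in t : min_leaf t \in leaves t.
Proof.
elim: t => [i|a IHa b IHb|a IHa b IHb c IHc] /=; rewrite ?inE // !mem_cat.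
  by rewrite /minn; case: ifP => _; rewrite ?IHa ?IHb ?orbT.
by rewrite /minn; do 2?case: ifP => _; rewrite ?IHa ?IHb ?IHc ?orbT.
Qed.

Lemma min_leaf_le t i : i \in leaves t -> (min_leaf t <= i)%N.
Proof.
elim: t => [j|a IHa b IHb|a IHa b IHb c IHc] /=.
- by rewrite inE => /eqP->.
- by rewrite mem_cat geq_min => /orP[/IHa->|/IHb->] //; rewrite orbT.
by rewrite !mem_cat !geq_min => /or3P[/IHa->|/IHb->|/IHc->] //; rewrite ?orbT.
Qed.

Lemma mu_degree_subst s t :
  mu_degree (tree_subst s t) = (mu_degree t + \sum_(i <- leaves t) mu_degree (s i))%N.
Proof.
elim: t => [i|a IHa b IHb|a IHa b IHb c IHc] /=; first by rewrite big_seq1.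
  by rewrite big_cat /= IHa IHb addnACA.
by rewrite !big_cat /= IHa IHb IHc; lia.
Qed.

Lemma leaf_subst s t i j :
  j \in leaves t -> i \in leaves (s j) -> i \in leaves (tree_subst s t).
Proof. by move=> jt ij; rewrite leaves_subst; apply/flattenP; exists (leaves (s j)) => //; apply/mapP; exists j. Qed.

Lemma leaf_subst_inj s t i j k : uniq (leaves (tree_subst s t)) ->
  j \in leaves t -> k \in leaves t -> i \in leaves (s j) -> i \in leaves (s k) -> j = k.
Proof.
rewrite leaves_subst; elim: (leaves t) => //= x r IHr; rewrite cat_uniq.
move=> /and3P[_ /hasPn nr ur]; rewrite !inE.
have no y : y \in r -> i \in leaves (s x) -> i \in leaves (s y) -> False.
  move=> yr ix iy; suff /nr : i \in flatten [seq leaves (s i) | i <- r] by rewrite ix.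
  by apply/flattenP; exists (leaves (s y)) => //; apply/mapP; exists y.
move=> /orP[/eqP->|jr] /orP[/eqP->|kr] // ij ik; last exact: IHr.
  by case: (no k).
by case: (no j).
Qed.

Lemma path_word_subst1 s t j i : i \in leaves (s j) ->
  {in leaves t, forall k, i \in leaves (s k) -> k = j} -> j \in leaves t ->
  path_word (tree_subst s t) i = path_word t j ++ path_word (s j) i.
Proof.
move=> ij.
have in_sub r : {in leaves r, forall k, i \in leaves (s k) -> k = j} ->
    (i \in leaves (tree_subst s r)) = (j \in leaves r).
  move=> rj; apply/idP/idP => [|jr]; last exact: leaf_subst ij.
  by rewrite leaves_subst => /flattenP[_ /mapP[k kr ->] /(rj k kr) <-].
elim: t => [k|a IHa b IHb|a IHa b IHb c IHc] /= tj.
- by rewrite inE => /eqP <-.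
- rewrite mem_cat in_sub => [|k ka]; last by apply: tj; rewrite mem_cat ka.
  case: ifP => /= ja jt; rewrite ?IHa ?IHb // => k kt; apply: tj;
  by rewrite mem_cat kt ?orbT.
rewrite !mem_cat !in_sub => [||k ka]; try by [move=> k ka; apply: tj; rewrite !mem_cat ka ?orbT|apply: tj; rewrite !mem_cat ka ?orbT].
by case: ifP => [ja _|_ /=]; [|case: ifP => /= jb jc]; rewrite ?IHa ?IHb ?IHc // => k kt; apply: tj;
  rewrite !mem_cat kt ?orbT.
Qed.

(** In a tree without repeated leaves, a leaf [i] belongs to at most one inserted
    tree [s j], and the path to [i] is the path to [j] followed by the path to
    [i] in [s j]. *)
Lemma path_word_subst s t j i : uniq (leaves (tree_subst s t)) ->
  j \in leaves t -> i \in leaves (s j) ->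
  path_word (tree_subst s t) i = path_word t j ++ path_word (s j) i.
Proof.
move=> u jt ij; apply: path_word_subst1 => // k kt ik.
exact: leaf_subst_inj u kt jt ik ij.
Qed.

(** At the smallest label at which the path words of the two results differ, the
    prefixes are the path words of the two monomials at the input [k], followed
    by a common suffix.  This label is the minimal leaf of [s k]. *)
Lemma less_subst s t' t : perm_eq (leaves t') (leaves t) ->
  uniq (leaves (tree_subst s t)) ->
  less_under (min_leaf \o s) t' t -> less (tree_subst s t') (tree_subst s t).
Proof.
move=> tt' u lt; have pl : perm_eq (leaves (tree_subst s t')) (leaves (tree_subst s t)).
  by rewrite !leaves_subst; apply: perm_flatten; apply: perm_map.
have u' : uniq (leaves (tree_subst s t')) by rewrite (perm_uniq pl).
split=> //; rewrite !mu_degree_subst (perm_big _ tt') /= ltn_add2r.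
case: lt => [->|[-> [k kt [kj lt]]]]; [by left|right; split=> //].
exists (min_leaf (s k)); first exact: leaf_subst (min_leaf_in _).
split; last first.
  rewrite (path_word_subst u' (j := k)) ?(perm_mem tt') ?min_leaf_in //.
  by rewrite (path_word_subst u (j := k)) ?min_leaf_in //; apply: word_lt_cat2r.
move=> i; rewrite {1}leaves_subst => /flattenP[_ /mapP[j jt ->] ij] ik.
rewrite (path_word_subst u' (j := j)) ?(perm_mem tt') //.
rewrite (path_word_subst u (j := j)) // kj //=.
exact: leq_ltn_trans (min_leaf_le ij) ik.
Qed.

(** Both path words of a leaf in the hole get the same prefix. *)
Lemma less_in_context L1 L2 h s t : context L1 L2 h -> uniq (L1 ++ leaves t ++ L2) ->
  less s t -> less (h s) (h t).
Proof.
move=> hP u [st lt].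
have [i [ui hi hplug]] := contextP hP u.
move: (h (Leaf i)) ui hi hplug => c ui hi hplug.
pose put r j := if j == i then r else Leaf j.
have putE r : h r = tree_subst (put r) c by exact: hplug.
have us r : perm_eq (leaves r) (leaves t) -> uniq (leaves (tree_subst (put r) c)).
  move=> rt; rewrite -putE (leaves_context hP); move: u; apply: etrans.
  by apply: perm_uniq; rewrite perm_cat2l perm_cat2r.
have ic : i \in leaves c by rewrite hi mem_cat inE eqxx orbT.
have pi r : put r i = r by rewrite /put eqxx.
have pw r x : perm_eq (leaves r) (leaves t) -> x \in leaves t ->
    path_word (h r) x = path_word c i ++ path_word r x.
  move=> rt xt; rewrite putE (path_word_subst (us r rt) ic) pi //.
  by rewrite (perm_mem rt).
have pw' r x j : perm_eq (leaves r) (leaves t) -> j \in leaves c -> x \in leaves (put t j) ->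
    j != i -> path_word (h r) x = path_word c j.
  move=> rt jc; rewrite /put => + ji; rewrite (negPf ji) => xj.
  rewrite putE (path_word_subst (us r rt) jc) /put (negPf ji) //.
  by rewrite cats0.
have mus r : mu_degree (h r) = (mu_degree c + mu_degree r)%N.
  rewrite putE mu_degree_subst; congr addn.
  rewrite (big_rem i) //= pi big1_seq ?addn0 // => j /andP[_].
  by rewrite mem_rem_uniq // inE => /andP[/negPf ji _]; rewrite /put ji.
split; first by rewrite !(leaves_context hP) perm_cat2l perm_cat2r.
rewrite !mus ltn_add2l; case: lt => [->|[-> [x xt [below lt]]]]; [by left|right; split=> //].
exists x; first by rewrite (leaves_context hP) !mem_cat xt orbT.
split; last by rewrite !pw // word_lt_cat2l.
move=> y; rewrite {1}putE leaves_subst => /flattenP[_ /mapP[j jc ->] yj] yx.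
have [ji|ji] := eqVneq j i; last by rewrite !(pw' _ y j).
by rewrite ji pi in yj; rewrite !pw // below.
Qed.

(** * Congruence modulo the relations *)

Definition eqmod (L : seq nat) (f g : treeMod) : Prop := ideal L (f - g).

Lemma eqmod_refl L f : eqmod L f f.
Proof. by rewrite /eqmod subrr; apply: ideal0. Qed.

Lemma eqmod_trans L g f h : eqmod L f g -> eqmod L g h -> eqmod L f h.
Proof. by move=> fg gh; rewrite /eqmod -(subrKA g); apply: idealD. Qed.

Lemma eqmodZ L c f g : eqmod L f g -> eqmod L (c *: f) (c *: g).
Proof. by rewrite /eqmod -scalerBr; apply: idealZ. Qed.

Lemma eqmod_context L1 L2 h K c s t : context L1 L2 h -> uniq (L1 ++ K ++ L2) ->
  eqmod K << s >> (c *: << t >>) ->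
  eqmod (L1 ++ K ++ L2) << h s >> (c *: << h t >>).
Proof.
move=> hP u /(ideal_in_context hP) /(_ u).
by rewrite linearB linearZ /= !linextU.
Qed.

Lemma eqmod_swap a b : uniq (leaves a ++ leaves b) ->
  eqmod (leaves a ++ leaves b) << Nu a b >> (- << Nu b a >>).
Proof.
pose s := nth (Leaf 0) [:: Leaf 0; a; b]; move=> u.
have us : uniq (flatten [seq leaves (s i) | i <- iota 1 2]) by rewrite /= cats0.
have := ideal_rel_subst (or_introl nu_antisymmetric) us.
rewrite /= cats0 [tsubst _ _]linext_lincomb !big_cons big_nil addr0 /= !scale1r.
by rewrite /eqmod opprK.
Qed.

Lemma eqmod_perm3 a b c s : perm_eq [:: a; b; c] s -> uniq (leaves a ++ leaves b ++ leaves c) ->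
  eqmod (leaves a ++ leaves b ++ leaves c) << Mu a b c >>
    << Mu (nth (Leaf 0) s 0) (nth (Leaf 0) s 1) (nth (Leaf 0) s 2) >>.
Proof.
move=> abc_s u; pose f := nth (Leaf 0) [:: Leaf 0; a; b; c].
have uf : uniq (flatten [seq leaves (f i) | i <- iota 1 3]) by rewrite /= cats0.
rewrite perm_sym in abc_s; have [I I3 sI] := perm_iotaP (Leaf 0) abc_s.
case: I I3 sI => [|i [|j [|k [|? ?]]]] I3 sI; try by have := perm_size I3.
have ijk : perm_eq [:: i.+1; j.+1; k.+1] [:: 1; 2; 3]%N.
  by have := perm_map succn I3.
have := ideal_rel_subst (or_introl (mu_symmetric ijk)) uf.
rewrite /= cats0 [tsubst _ _]linext_lincomb !big_cons big_nil addr0 /= scale1r.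
rewrite scaleN1r sI /= => /idealN; rewrite opprB.
by [].
Qed.

(** Trees that differ by the symmetries of the operations have the same place in
    the ordering. *)
Definition same_shape (s t : tree) : Prop :=
  [/\ perm_eq (leaves s) (leaves t), mu_degree s = mu_degree t &
      {in leaves t, path_word s =1 path_word t}].

Lemma uniq_catP (T : eqType) (s t : seq T) : uniq (s ++ t) ->
  [/\ uniq s, uniq t, {in s, forall x, x \notin t} & {in t, forall x, x \notin s}].
Proof.
rewrite cat_uniq => /and3P[us /hasPn st ut]; split=> //.
by move=> x xs; apply/negP => /st; rewrite /= xs.
Qed.

Lemma path_word_Mu a b c x i : uniq (leaves a ++ leaves b ++ leaves c) ->
  x \in [:: a; b; c] -> i \in leaves x -> path_word (Mu a b c) i = false :: path_word x i.
Proof.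
move=> /uniq_catP[_ /uniq_catP[_ _ _ nb] _ na].
rewrite !inE => /or3P[]/eqP-> ix /=; first by rewrite ix.
  by rewrite ifN ?na ?mem_cat ?ix // ifT.
by rewrite ifN ?na ?mem_cat ?ix ?orbT // ifN ?nb.
Qed.

Lemma same_shape_trans t s r : same_shape s t -> same_shape t r -> same_shape s r.
Proof.
move=> [st mst pst] [tr mtr ptr]; split; [exact: perm_trans st tr|by rewrite mst|].
by move=> i ir; rewrite pst ?ptr // (perm_mem tr).
Qed.

Lemma same_shape_uniq s t : same_shape s t -> uniq (leaves s) = uniq (leaves t).
Proof. by case=> /perm_uniq. Qed.

Lemma same_shape_Nu a b a' b' : uniq (leaves a ++ leaves b) ->
  same_shape a' a -> same_shape b' b -> same_shape (Nu a' b') (Nu a b).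
Proof.
move=> u [aa ma pa] [bb mb pb]; split; rewrite /= ?ma ?mb ?perm_cat // => i.
rewrite mem_cat (perm_mem aa) => iab; congr cons; case: ifP => ia; first exact: pa.
by apply: pb; move: iab; rewrite ia.
Qed.

Lemma same_shape_Mu a b c a' b' c' : uniq (leaves a ++ leaves b ++ leaves c) ->
  same_shape a' a -> same_shape b' b -> same_shape c' c ->
  same_shape (Mu a' b' c') (Mu a b c).
Proof.
move=> u [aa ma pa] [bb mb pb] [cc mc pc]; split; rewrite /= ?ma ?mb ?mc ?perm_cat // => i.
rewrite !mem_cat (perm_mem aa) (perm_mem bb) => iabc; congr cons.
case: ifP iabc => ia iabc; first exact: pa.
case: ifP iabc => ib iabc; first exact: pb.
by apply: pc; move: iabc.
Qed.

Lemma same_shape_swap a b : uniq (leaves a ++ leaves b) -> same_shape (Nu b a) (Nu a b).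
Proof.
move=> u; have pab : perm_eq (leaves b ++ leaves a) (leaves a ++ leaves b) by rewrite perm_catC.
split; rewrite //= 1?addnC // => i; rewrite mem_cat => iab; congr cons.
have [_ _ na nb] := uniq_catP u.
by case/orP: iab => [ia|ib]; rewrite ?ia ?ib ?(negPf (na _ ia)) ?(negPf (nb _ ib)).
Qed.

Lemma mu_degree_Mu a b c :
  mu_degree (Mu a b c) = (sumn [seq mu_degree x | x <- [:: a; b; c]]).+1.
Proof. by rewrite /= addn0 addnA. Qed.

Lemma leaves_Mu a b c : leaves (Mu a b c) = flatten [seq leaves x | x <- [:: a; b; c]].
Proof. by rewrite /= cats0. Qed.

Lemma same_shape_perm3 a b c a' b' c' : perm_eq [:: a'; b'; c'] [:: a; b; c] ->
  uniq (leaves a ++ leaves b ++ leaves c) -> same_shape (Mu a' b' c') (Mu a b c).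
Proof.
move=> p u; have pl : perm_eq (leaves (Mu a' b' c')) (leaves (Mu a b c)).
  by rewrite !leaves_Mu; apply: perm_flatten; apply: perm_map.
split=> //; first by rewrite !mu_degree_Mu; congr _.+1; apply: perm_sumn; apply: perm_map.
move=> i; rewrite {1}leaves_Mu => /flattenP[_ /mapP[x xabc ->] ix].
rewrite (path_word_Mu u xabc ix) (path_word_Mu _ _ ix) ?(perm_mem p) //.
by rewrite -[_ ++ _]/(leaves (Mu a' b' c')) (perm_uniq pl).
Qed.

Lemma sort_sign t : (sort_tree t).1 * (sort_tree t).1 = 1.
Proof.
elim: t => [i|a IHa b IHb|a IHa b IHb c IHc] /=; first by rewrite mulr1.
  case: (sort_tree a) (sort_tree b) IHa IHb => [p a'] [q b'] /= pp qq.
  by case: ifP => _ /=; rewrite ?mulrNN mulrACA pp qq mulr1.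
case: (sort_tree a) (sort_tree b) (sort_tree c) IHa IHb IHc => [p a'] [q b'] [r c'] /= pp qq rr.
by rewrite [_ * (_ * _ * _)]mulrACA rr mulr1 mulrACA pp qq mulr1.
Qed.

Lemma min_leaf_perm s t : perm_eq (leaves s) (leaves t) -> min_leaf s = min_leaf t.
Proof.
move=> st; apply/eqP; rewrite eqn_leq.
by rewrite !min_leaf_le // -?(perm_mem st) ?min_leaf_in // (perm_mem st) min_leaf_in.
Qed.

Lemma min_leaf_neq a b : uniq (leaves a ++ leaves b) -> min_leaf a != min_leaf b.
Proof.
move=> /uniq_catP[_ _ n _]; apply: contraNneq (n _ (min_leaf_in a)) => ->.
exact: min_leaf_in.
Qed.

Definition sort3 (x y z : tree) : seq tree :=
  sort (fun a b => min_leaf a <= min_leaf b)%N [:: x; y; z].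

Lemma sort3_nth x y z : perm_eq [:: x; y; z] (sort3 x y z) /\
  sort3 x y z = [:: nth x (sort3 x y z) 0; nth x (sort3 x y z) 1; nth x (sort3 x y z) 2].
Proof.
have p : perm_eq [:: x; y; z] (sort3 x y z) by rewrite perm_sym perm_sort.
by split=> //; have := perm_size p; case: (sort3 x y z) => [|? [|? [|? [|]]]].
Qed.

Lemma uniq_Mu_perm a b c a' b' c' : perm_eq [:: a'; b'; c'] [:: a; b; c] ->
  uniq (leaves (Mu a b c)) = uniq (leaves (Mu a' b' c')).
Proof. by move=> p; apply: perm_uniq; rewrite !leaves_Mu perm_sym; apply: perm_flatten; apply: perm_map. Qed.

(** The effect on a monomial of rearranging the arguments of its vertices by the
    symmetries of the operations. *)
Definition sim (s : tree) (c : rat) (t : tree) : Prop :=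
  same_shape t s /\ eqmod (leaves s) << s >> (c *: << t >>).

Lemma eqmod_perm L K f g : uniq L -> perm_eq L K -> eqmod L f g -> eqmod K f g.
Proof. exact: ideal_perm. Qed.

Lemma sim_trans t s c d r : uniq (leaves s) -> sim s c t -> sim t d r -> sim s (c * d) r.
Proof.
move=> u [ts est] [rt etr]; split; first exact: same_shape_trans rt ts.
apply: eqmod_trans est _; rewrite -scalerA; apply: eqmodZ.
apply: eqmod_perm etr; first by rewrite (same_shape_uniq ts).
by case: ts.
Qed.

Lemma sim_Nu a b c d a' b' : uniq (leaves (Nu a b)) -> sim a c a' -> sim b d b' ->
  sim (Nu a b) (c * d) (Nu a' b').
Proof.
move=> u [sa ea] [sb eb].
have sa' : same_shape (Nu a' b) (Nu a b) by apply: same_shape_Nu.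
have u' : uniq (leaves a' ++ leaves b).
  by rewrite -[_ ++ _]/(leaves (Nu a' b)) (same_shape_uniq sa').
have s1 : sim (Nu a b) c (Nu a' b).
  by split; [exact: sa' | exact (eqmod_context (@context_Nu1 b) u ea)].
apply: sim_trans u s1 _; split; first exact: same_shape_Nu.
by have := eqmod_context (K := leaves b) (@context_Nu2 a'); rewrite cats0 => /(_ _ _ _ u' eb).
Qed.

Lemma sim_Mu a b c p q r a' b' c' : uniq (leaves (Mu a b c)) ->
  sim a p a' -> sim b q b' -> sim c r c' -> sim (Mu a b c) (p * q * r) (Mu a' b' c').
Proof.
move=> u [sa ea] [sb eb] [sc ec].
have refl t : same_shape t t by [].
have sa' : same_shape (Mu a' b c) (Mu a b c) by apply: same_shape_Mu.
have ua' : uniq (leaves (Mu a' b c)) by rewrite (same_shape_uniq sa').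
have sb' : same_shape (Mu a' b' c) (Mu a' b c) by apply: same_shape_Mu.
have ub' : uniq (leaves (Mu a' b' c)) by rewrite (same_shape_uniq sb').
have s1 : sim (Mu a b c) p (Mu a' b c).
  by split; [exact: sa' | exact (eqmod_context (@context_Mu1 b c) u ea)].
have s2 : sim (Mu a' b c) q (Mu a' b' c).
  by split; [exact: sb' | exact (eqmod_context (@context_Mu2 a' c) ua' eb)].
apply: sim_trans u (sim_trans u s1 s2) _; split; first exact: same_shape_Mu.
have := eqmod_context (K := leaves c) (@context_Mu3 a' b').
by rewrite cats0 -catA => /(_ _ _ _ ub' ec).
Qed.

Lemma sim_swap a b : uniq (leaves (Nu a b)) -> sim (Nu a b) (-1) (Nu b a).
Proof.
by move=> u; split; [apply: same_shape_swap|rewrite scaleN1r; apply: eqmod_swap].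
Qed.

Lemma sim_perm3 a b c a' b' c' : perm_eq [:: a; b; c] [:: a'; b'; c'] ->
  uniq (leaves (Mu a b c)) -> sim (Mu a b c) 1 (Mu a' b' c').
Proof.
move=> p u; split; first by apply: same_shape_perm3; rewrite 1?perm_sym.
by rewrite scale1r; apply: eqmod_perm3 p u.
Qed.

(** Sorting changes a monomial by the symmetries of the operations only. *)
Lemma sortP t : uniq (leaves t) ->
  is_shuffle (sort_tree t).2 /\ sim t (sort_tree t).1 (sort_tree t).2.
Proof.
elim: t => [i|a IHa b IHb|a IHa b IHb c IHc].
- by move=> _; split=> //; split=> //=; rewrite scale1r; apply: eqmod_refl.
- move=> u; have [ua ub _ _] := uniq_catP u.
  have [sa sima] := IHa ua; have [sb simb] := IHb ub.
  have sab := sim_Nu u sima simb; rewrite /=.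
  have u' : uniq (leaves (Nu (sort_tree a).2 (sort_tree b).2)).
    by case: sab => /same_shape_uniq->.
  have ma : min_leaf (sort_tree a).2 = min_leaf a by case: sima => [[/min_leaf_perm]].
  have mb : min_leaf (sort_tree b).2 = min_leaf b by case: simb => [[/min_leaf_perm]].
  have nab := min_leaf_neq u.
  case: (sort_tree a) (sort_tree b) sa sb sab u' ma mb {sima simb} =>
    [p a'] [q b'] /= sa sb sab u' ma mb.
  case: ifP => lt; rewrite /= ma mb sa sb; first by split; [rewrite lt | exact: sab].
  split; first by rewrite ltn_neqAle eq_sym nab leqNgt lt.
  by rewrite -mulrN1; apply: sim_trans u sab (sim_swap u').
move=> u; have [ua ubc _ _] := uniq_catP u; have [ub uc _ _] := uniq_catP ubc.
have [sa sima] := IHa ua; have [sb simb] := IHb ub; have [sc simc] := IHc uc.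
have sabc := sim_Mu u sima simb simc; rewrite /=.
have u' : uniq (leaves (Mu (sort_tree a).2 (sort_tree b).2 (sort_tree c).2)).
  by case: sabc => /same_shape_uniq->.
case: (sort_tree a) (sort_tree b) (sort_tree c) sa sb sc sabc u' {sima simb simc} =>
  [p a'] [q b'] [r c'] /= sa sb sc sabc u'.
have [p3 e3] := sort3_nth a' b' c'.
rewrite -/(sort3 a' b' c').
have so : sorted (relpre min_leaf leq) (sort3 a' b' c').
  by apply: sort_sorted => t1 t2; apply: leq_total.
move: p3 so; rewrite e3 /=; set x := nth _ _ 0; set y := nth _ _ 1; set z := nth _ _ 2 => p3.
move=> /and3P[xy yz _].
have u3 : uniq (leaves (Mu x y z)) by rewrite (uniq_Mu_perm p3).
split; last first.
  by rewrite -[p * q * r]mulr1; apply: sim_trans u sabc (sim_perm3 p3 u').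
have s3 : all is_shuffle [:: x; y; z] by rewrite -(perm_all _ p3) /= sa sb sc.
have uyx : uniq (leaves x ++ leaves y) by move: u3; rewrite /= catA cat_uniq => /and3P[].
have [_ uyz _ _] := uniq_catP u3.
move: s3 => /= /and4P[-> -> -> _].
by rewrite !ltn_neqAle min_leaf_neq // min_leaf_neq // xy yz.
Qed.

(** * Leading terms of the relations *)

(** [t0] is the leading term of [r] for every assignment of minimal leaves that
    satisfies the inequalities [cs] between the labels. *)
Definition leading_term (n : nat) (r : treeMod) (t0 : tree) (cs : seq (nat * nat)) : Prop :=
  exists2 l, r = lincomb60 ((60, t0) :: l) &
  [/\ perm_eq (leaves t0) (iota 1 n),
      all (fun c => (c.1 \in iota 1 n) && (c.2 \in iota 1 n)) cs,
      forall p, p \in l -> perm_eq (leaves p.2) (iota 1 n)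
    & forall m : nat -> nat, all (fun c => m c.1 < m c.2)%N cs ->
      forall p, p \in l -> less_under m p.2 t0].

Lemma jacobi_leading :
  leading_term 3 jacobi (Nu (Nu 1 2) 3) [:: (1, 2); (2, 3)]%N.
Proof.
eexists; first exact: jacobi60.
split=> // [p|m]; first by rewrite !inE => /orP[]/eqP->.
rewrite /= andbT => /andP[m12 m23] p; rewrite !inE => /orP[]/eqP->; right; split=> //.
- exists 1%N => //; split=> // j; rewrite !inE => /or3P[]/eqP-> lt //; lia.
exists 2%N => //; split=> // j; rewrite !inE => /or3P[]/eqP-> lt //; lia.
Qed.

Lemma ex_min (m : nat -> nat) (s : seq nat) : s != [::] ->
  exists2 k, k \in s & {in s, forall j, (m k <= m j)%N}.
Proof.
elim: s => // i s IHs _; have [->|/IHs[k ks kP]] := eqVneq s [::].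
  by exists i; rewrite ?inE // => j; rewrite inE => /eqP->.
have [ik|ki] := leqP (m i) (m k).
  exists i; first by rewrite inE eqxx.
  move=> j; rewrite inE => /orP[/eqP->//|/kP]; exact: leq_trans.
exists k; first by rewrite inE ks orbT.
by move=> j; rewrite inE => /orP[/eqP->|/kP//]; apply: ltnW.
Qed.

(** The word of the smallest leaf decides, whichever input contains it: in the
    leading monomial it starts with nu2, in the others it is of smaller degree
    or starts with mu3. *)
Lemma derivation_leading : leading_term 4 derivation (Nu (Mu 1 2 3) 4) [::].
Proof.
eexists; first exact: derivation60.
split=> // [p|m _ p]; first by rewrite !inE => /or3P[]/eqP->.
have [k k4 kmin] := @ex_min m [:: 1; 2; 3; 4]%N isT.
move=> pl; right; split; first by move: pl; rewrite !inE => /or3P[]/eqP->.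
exists k => //; split; first by move=> j jt; rewrite ltnNge kmin.
by move: k4 pl {kmin}; rewrite !inE => /or4P[]/eqP-> /or3P[]/eqP->.
Qed.

(** All the terms of [B] have degree at most 1 in the ternary operation; the other
    monomial differs from the leading one by the exchange of the inputs 3 and 4,
    and mu3 mu3 < mu3 in the order on words. *)
Lemma associativity_leading :
  leading_term 5 associativity (Mu (Mu 1 2 4) 3 5) [:: (3, 4)]%N.
Proof.
eexists; first exact: associativity60.
split=> // [|m].
  by apply/allP.
rewrite /= andbT => m34 p; rewrite inE => /orP[/eqP->|pl].
  right; split=> //; exists 3%N => //; split=> // j.
  rewrite !inE => /or4P[/eqP->|/eqP->|/eqP->|/orP[]/eqP->] lt //=; lia.
left; apply: (leq_ltn_trans (n := 1)) => //.
have /allP : all (fun p => mu_degree p.2 <= 1)%N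
  ([seq (- p.1, p.2) | p <- B60 1%N 2%N 4%N 3%N 5%N] ++ B60 1%N 2%N 3%N 4%N 5%N) by [].
exact.
Qed.

(** * Reduction *)

Definition reducible (t : tree) : Prop :=
  exists2 f, eqmod (leaves t) << t >> f & supported (less^~ t) f.

Lemma less_same_shape s t t' : same_shape t t' -> less s t -> less s t'.
Proof.
move=> [tt mt pt] [st lt]; split; first exact: perm_trans st tt.
rewrite -mt; case: lt => [|[mst [i it [below lt]]]]; [by left|right; split=> //].
exists i; first by rewrite -(perm_mem tt).
split; last by rewrite -pt // -(perm_mem tt).
by move=> j jt ji; rewrite -pt // below // (perm_mem tt).
Qed.

Lemma less_same_shapel s s' t : same_shape s' s -> less s t -> less s' t.
Proof.
move=> [ss ms ps] [st lt]; split; first exact: perm_trans ss st.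
rewrite ms; case: lt => [|[mst [i it [below lt]]]]; [by left|right; split=> //].
have is_ j : j \in leaves t -> j \in leaves s by rewrite (perm_mem st).
exists i => //; split; last by rewrite ps // is_.
by move=> j jt ji; rewrite ps ?is_ // below.
Qed.

Lemma same_shape_sym s t : same_shape s t -> same_shape t s.
Proof.
case=> p m w; split; [by rewrite perm_sym|by []|].
by move=> i it; rewrite w // -(perm_mem p).
Qed.

Lemma reducible_sim s c t : uniq (leaves s) -> c * c = 1 -> sim s c t -> reducible s -> reducible t.
Proof.
move=> us cc [ts est] [f esf fs]; exists (c *: f).
  have e : eqmod (leaves s) << t >> (c *: << s >>).
    have := eqmodZ c est; rewrite scalerA cc scale1r => /idealN.
    by rewrite opprB.
  apply: (eqmod_perm us); first by rewrite perm_sym; case: ts.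
  exact: eqmod_trans e (eqmodZ c esf).
apply: supportedZ => r /fs; apply: less_same_shape.
exact: same_shape_sym.
Qed.

Lemma reducible_context L1 L2 h t : context L1 L2 h -> uniq (leaves (h t)) -> reducible t -> reducible (h t).
Proof.
move=> hP; rewrite (leaves_context hP) => u [f tf ft].
exists (linext (fun s => << h s >>) f); last first.
  apply: supported_linext => s /ft st; apply: supportedU.
  exact: less_in_context hP u st.
have := ideal_in_context hP tf u.
by rewrite (leaves_context hP) linearB [X in X - _]linextU; apply.
Qed.

(** In a substitution instance of a relation, the instance of the leading term is
    congruent to the combination of the other terms, which are smaller. *)
Lemma reducible_leading n r t0 cs s : defining_rel n r -> leading_term n r t0 cs ->
  uniq (leaves (tree_subst s t0)) ->
  all (fun c => min_leaf (s c.1) < min_leaf (s c.2))%N cs ->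
  reducible (tree_subst s t0).
Proof.
move=> rn [l rl [t0n _ ln lead]] u ltc.
have pf : perm_eq (flatten [seq leaves (s i) | i <- iota 1 n]) (leaves (tree_subst s t0)).
  by rewrite leaves_subst perm_sym; apply: perm_flatten; apply: perm_map.
have := ideal_rel_subst (or_intror rn) (s := s); rewrite (perm_uniq pf) => /(_ u).
move=> /ideal_perm -/(_ _ _ pf); rewrite (perm_uniq pf) => /(_ u) ir.
exists (- tsubst s (lincomb60 l)).
  move: ir; rewrite rl /eqmod opprK.
  rewrite -[(60, t0) :: l]cat1s lincomb60_cat linearD /=.
  by rewrite [tsubst s (lincomb60 [:: _])]linext_lincomb big_seq1 /= divff // scale1r.
apply: supportedN; apply: supported_linext => t.
have lP : supported (fun t => exists2 p, p \in l & t = p.2) (lincomb60 l).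
  by apply: supported_lincomb => _ /mapP[p pl ->]; exists p.
move=> /lP[p pl ->]; apply: supportedU; apply: less_subst => //.
  by rewrite (permPl (ln p pl)) perm_sym.
exact: lead.
Qed.

(** * Normal monomials *)

(** The shuffle monomials obtained by sorting a substitution instance of the
    leading term of a relation, the constraints on the labels being satisfied by
    the minimal leaves of the trees substituted. *)
Definition root_instance (t : tree) : Prop :=
  exists n r t0 cs s,
    [/\ defining_rel n r /\ leading_term n r t0 cs, uniq (leaves (tree_subst s t0)),
        all (fun c => min_leaf (s c.1) < min_leaf (s c.2))%N cs,
        {in iota 1 n, forall i, is_shuffle (s i)}
      & (sort_tree (tree_subst s t0)).2 = t].

Inductive has_instance : tree -> Prop :=
  | inst_root t : root_instance t -> has_instance t
  | inst_nu1 a b : has_instance a -> has_instance (Nu a b)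
  | inst_nu2 a b : has_instance b -> has_instance (Nu a b)
  | inst_mu1 a b c : has_instance a -> has_instance (Mu a b c)
  | inst_mu2 a b c : has_instance b -> has_instance (Mu a b c)
  | inst_mu3 a b c : has_instance c -> has_instance (Mu a b c).

Lemma instance_reducible t : has_instance t -> uniq (leaves t) -> reducible t.
Proof.
elim=> {t} [t [n [r [t0 [cs [s [[rn lt] us ltc _ <-]]]]]] _|a b _ IH u|a b _ IH u|a b c _ IH u|a b c _ IH u|a b c _ IH u].
- apply: (reducible_sim us (sort_sign _) (proj2 (sortP us))).
  exact: reducible_leading rn lt us ltc.
- by apply: (reducible_context (@context_Nu1 b) u); apply: IH; case/uniq_catP: u.
- by apply: (reducible_context (@context_Nu2 a) u); apply: IH; case/uniq_catP: u.
- by apply: (reducible_context (@context_Mu1 b c) u); apply: IH; case/uniq_catP: u.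
- apply: (reducible_context (@context_Mu2 a c) u); apply: IH.
  by case/uniq_catP: u => _ /uniq_catP[].
apply: (reducible_context (@context_Mu3 a b) u); apply: IH.
by case/uniq_catP: u => _ /uniq_catP[].
Qed.

(** The usual basis of the multilinear Lie elements: the standard bracketings of
    the words that start with their smallest letter. *)
Fixpoint lie (t : tree) : bool :=
  match t with
  | Leaf _ => true
  | Nu a b => [&& lie a, lie b & if a is Nu _ a2 then (min_leaf b < min_leaf a2)%N else true]
  | Mu _ _ _ => false
  end.

(** The iterated ternary products of Lie monomials l1, l2, l3, ..., grouped from
    the left, with increasing minimal leaves. *)
Fixpoint is_normal (t : tree) : bool :=
  match t with
  | Mu a b c => [&& is_normal a, lie b, lie c &
                    if a is Mu _ _ a3 then (min_leaf a3 < min_leaf b)%N else true]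
  | _ => lie t
  end.

Lemma sort3_perm x y z a b c : perm_eq [:: x; y; z] [:: a; b; c] ->
  (min_leaf a < min_leaf b < min_leaf c)%N -> sort3 x y z = [:: a; b; c].
Proof.
move=> p /andP[ab bc].
have leT_trans : transitive (relpre min_leaf leq) by move=> ? ? ?; apply: leq_trans.
have e : sort (relpre min_leaf leq) [:: a; b; c] = [:: a; b; c].
  by apply: (sorted_sort leT_trans); rewrite /= (ltnW ab) (ltnW bc).
refine (etrans (elimT (@perm_sort_inP _ (relpre min_leaf leq) [:: x; y; z] [:: a; b; c] _ _ _) p) e).
- by move=> u v _ _; apply: leq_total.
- by move=> u v w _ _ _; apply: leT_trans.
move=> u v; rewrite !(perm_mem p) => up vp /=; rewrite -eqn_leq => /eqP uv.
move: up vp uv; rewrite !inE => /or3P[]/eqP-> /or3P[]/eqP-> // ; lia.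
Qed.

Lemma sort_shuffle t : is_shuffle t -> sort_tree t = (1, t).
Proof.
elim: t => [i|a IHa b IHb|a IHa b IHb c IHc] //=.
  by move=> /and3P[lt /IHa-> /IHb->]; rewrite lt mulr1.
move=> /and4P[abc /IHa-> /IHb-> /IHc->].
by rewrite !mulr1 -/(sort3 a b c) (sort3_perm (perm_refl _) abc).
Qed.

Lemma sort_Mu x y z a b c : is_shuffle (Mu a b c) -> perm_eq [:: x; y; z] [:: a; b; c] ->
  (sort_tree (Mu x y z)).2 = Mu a b c.
Proof.
move=> /= /and4P[abc sa sb sc] p.
have : all is_shuffle [:: x; y; z] by rewrite (perm_all _ p) /= sa sb sc.
move=> /= /and4P[/sort_shuffle-> /sort_shuffle-> /sort_shuffle-> _] /=.
by rewrite -/(sort3 x y z) (sort3_perm p abc).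
Qed.

Lemma root_derivation a b c d t : uniq (leaves (Nu (Mu a b c) d)) ->
  [&& is_shuffle a, is_shuffle b, is_shuffle c & is_shuffle d] ->
  (sort_tree (Nu (Mu a b c) d)).2 = t -> root_instance t.
Proof.
move=> u /and4P[sa sb sc sd] st.
exists 4%N, derivation, (Nu (Mu 1 2 3) 4), [::], (nth (Leaf 0) [:: Leaf 0; a; b; c; d]).
split=> //; first by split; [exact: rel_derivation | exact: derivation_leading].
by move=> i; rewrite !inE => /or4P[]/eqP->.
Qed.

Lemma root_jacobi a b c : uniq (leaves (Nu (Nu a b) c)) -> is_shuffle (Nu (Nu a b) c) ->
  (min_leaf b < min_leaf c)%N -> root_instance (Nu (Nu a b) c).
Proof.
move=> u sh bc; have /and3P[_ /and3P[ab sa sb] sc] := sh.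
exists 3%N, jacobi, (Nu (Nu 1 2) 3), [:: (1, 2); (2, 3)]%N, (nth (Leaf 0) [:: Leaf 0; a; b; c]).
split=> //; first by split; [exact: rel_jacobi | exact: jacobi_leading].
- by rewrite /= ab bc.
- by move=> i; rewrite !inE => /or3P[]/eqP->.
by rewrite sort_shuffle.
Qed.

Lemma root_associativity x y z p q t : uniq (leaves (Mu (Mu x y z) p q)) ->
  all is_shuffle [:: x; y; z; p; q] -> (min_leaf p < min_leaf z)%N ->
  (sort_tree (Mu (Mu x y z) p q)).2 = t -> root_instance t.
Proof.
move=> u /and5P[sx sy sz sp /andP[sq _]] pz st.
exists 5%N, associativity, (Mu (Mu 1 2 4) 3 5), [:: (3, 4)]%N,
  (nth (Leaf 0) [:: Leaf 0; x; y; p; z; q]).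
split=> //; first by split; [exact: rel_associativity | exact: associativity_leading].
  by rewrite /= pz.
by move=> i; rewrite !inE => /or4P[/eqP->|/eqP->|/eqP->|/orP[]/eqP->].
Qed.

Lemma sort_Nu a b : is_shuffle (Nu a b) -> (sort_tree (Nu b a)).2 = Nu a b.
Proof.
move=> /= /and3P[ab sa sb]; rewrite (sort_shuffle sa) (sort_shuffle sb).
by rewrite ltnNge (ltnW ab).
Qed.

Lemma shuffle_Mu a b c : is_shuffle (Mu a b c) ->
  [/\ (min_leaf a < min_leaf b)%N, (min_leaf b < min_leaf c)%N,
      is_shuffle a, is_shuffle b & is_shuffle c].
Proof. by move=> /= /and4P[/andP[]]. Qed.

Lemma shuffle_Nu a b : is_shuffle (Nu a b) ->
  [/\ (min_leaf a < min_leaf b)%N, is_shuffle a & is_shuffle b].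
Proof. by move=> /= /and3P[]. Qed.

Lemma min_leaf_Mu a b c : is_shuffle (Mu a b c) -> min_leaf (Mu a b c) = min_leaf a.
Proof. by case/shuffle_Mu => ab bc _ _ _; rewrite /= (minn_idPl (ltnW bc)) (minn_idPl (ltnW ab)). Qed.

(** A commutator of a ternary product contains the leading term of the derivation
    relation, and a bracketing that is not standard that of the Jacobi identity.
    In a ternary product of a ternary product, if an outer input precedes an
    inner one, then exchanging these two inputs gives a smaller monomial, so the
    leading term of the associativity relation occurs. *)
Lemma instance_or_normal t : is_shuffle t -> uniq (leaves t) -> has_instance t \/ is_normal t.
Proof.
elim: t => [i|a IHa b IHb|a IHa b IHb c IHc]; [by right| |].
  move=> sh u; have [ab sa sb] := shuffle_Nu sh; have [ua ub _ _] := uniq_catP u.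
  have [ia|na] := IHa sa ua; first by left; apply: inst_nu1.
  have [ib|nb] := IHb sb ub; first by left; apply: inst_nu2.
  have uba : uniq (leaves (Nu b a)) by rewrite /= uniq_catC.
  have [[b1 [b2 [b3 eb]]]|lb] : (exists b1 b2 b3, b = Mu b1 b2 b3) \/ lie b.
  - by case: (b) nb => [i|b1 b2|b1 b2 b3] nb; [right|right|left; exists b1, b2, b3].
  - left; apply: inst_root; rewrite eb in sh sb uba *.
    apply: (root_derivation uba _ (sort_Nu sh)).
    by have [_ _ -> -> ->] := shuffle_Mu sb.
  case: a sa ua na sh u ab {IHa uba} => [j|a1 a2|a1 a2 a3] sa ua na sh u ab.
  - by right; rewrite /= lb.
  - have [ba2|a2b] := ltnP (min_leaf b) (min_leaf a2).
      by right; move: na => /= ->; rewrite lb ba2.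
    left; apply: inst_root; apply: root_jacobi => //; rewrite ltn_neqAle a2b andbT.
    by apply: min_leaf_neq; move: u; rewrite /= -catA cat_uniq => /and3P[].
  left; apply: inst_root; apply: (root_derivation u); last by rewrite (sort_shuffle sh).
  by have [_ _ -> -> ->] := shuffle_Mu sa; rewrite sb.
move=> sh u; have [ab bc sa sb sc] := shuffle_Mu sh.
have [ua ubc _ _] := uniq_catP u; have [ub uc _ _] := uniq_catP ubc.
have [ia|na] := IHa sa ua; first by left; apply: inst_mu1.
have [ib|nb] := IHb sb ub; first by left; apply: inst_mu2.
have [ic|nc] := IHc sc uc; first by left; apply: inst_mu3.
have mu_or_lie r : is_normal r -> (exists r1 r2 r3, r = Mu r1 r2 r3) \/ lie r.
  by case: r => [i|r1 r2|r1 r2 r3] nr; [right|right|left; exists r1, r2, r3].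
have [[b1 [b2 [b3 eb]]]|lb] := mu_or_lie b nb.
  left; apply: inst_root; rewrite eb in sh sb ab u *.
  have [b12 b23 sb1 sb2 sb3] := shuffle_Mu sb.
  have p : perm_eq [:: Mu b1 b2 b3; a; c] [:: a; Mu b1 b2 b3; c].
    by rewrite (perm_catCA [:: _] [:: _]).
  refine (root_associativity _ _ _ (sort_Mu sh p)).
  - by rewrite -(uniq_Mu_perm p).
  - by rewrite /= sb1 sb2 sb3 sa sc.
  by rewrite (min_leaf_Mu sb) in ab; apply: ltn_trans ab (ltn_trans b12 b23).
have [[c1 [c2 [c3 ec]]]|lc] := mu_or_lie c nc.
  left; apply: inst_root; rewrite ec in sh sc bc u *.
  have [c12 c23 sc1 sc2 sc3] := shuffle_Mu sc.
  have p : perm_eq [:: Mu c1 c2 c3; a; b] [:: a; b; Mu c1 c2 c3].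
    by rewrite (perm_catC [:: _] [:: _; _]).
  refine (root_associativity _ _ _ (sort_Mu sh p)).
  - by rewrite -(uniq_Mu_perm p).
  - by rewrite /= sc1 sc2 sc3 sa sb.
  rewrite (min_leaf_Mu sc) in bc.
  exact: ltn_trans (ltn_trans ab bc) (ltn_trans c12 c23).
case: a sa na sh ab u {IHa ua} => [i|a1 a2|a1 a2 a3] sa na sh ab u.
- by right; rewrite /= lb lc.
- by right; move: na => /= ->; rewrite lb lc.
have [a3b|ba3] := ltnP (min_leaf a3) (min_leaf b).
  by right; move: na => /= ->; rewrite lb lc a3b.
left; apply: inst_root; have [_ _ sa1 sa2 sa3] := shuffle_Mu sa.
apply: (root_associativity u); rewrite ?sort_shuffle //.
  by rewrite /= sa1 sa2 sa3 sb sc.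
rewrite ltn_neqAle ba3 andbT eq_sym; apply: min_leaf_neq.
by move: u; rewrite /= -!catA cat_uniq => /and3P[_ _]; rewrite cat_uniq => /and3P[_ _]; rewrite catA cat_uniq => /and3P[].
Qed.

(** * The ordering is well founded *)

(** Words as numbers in base three, the end of the word being padded with the
    middle digit. *)
Fixpoint word_digits (n : nat) (w : seq bool) : nat :=
  if n is n'.+1 then
    (if w is x :: w' then (if x then 2 else 0) * 3 ^ n' + word_digits n' w'
     else 3 ^ n' + word_digits n' [::])%N
  else 0%N.

Lemma word_digits_lt n w : (word_digits n w < 3 ^ n)%N.
Proof.
elim: n w => [|n IHn] [|x w] //=; rewrite expnS.
  by have := IHn [::]; lia.
by have := IHn w; case: x; lia.
Qed.

Lemma word_digits_lex n u v : (size u <= n)%N -> (size v <= n)%N ->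
  word_lex_lt u v -> (word_digits n u < word_digits n v)%N.
Proof.
elim: n u v => [|n IHn] [|x u] [|y v] //=.
- case: y => // _ _ _; have := word_digits_lt n [::]; lia.
- case: x => // _ _ _; have := word_digits_lt n u; lia.
rewrite !ltnS => su sv; have [->|] := eqVneq x y.
  by rewrite ltn_add2l; apply: IHn.
case: x y => -[] // _ _; have := word_digits_lt n u; lia.
Qed.

Definition word_rank (n : nat) (w : seq bool) : nat :=
  (count_mem true w * 3 ^ n + word_digits n w)%N.

(** Strictly larger than the ranks of all words of length at most [n]. *)
Definition word_bound (n : nat) : nat := (n.+1 * 3 ^ n)%N.

Lemma word_rank_bound n w : (size w <= n)%N -> (word_rank n w < word_bound n)%N.
Proof.
move=> wn; rewrite /word_rank /word_bound mulSn addnC.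
have := word_digits_lt n w; have := leq_trans (count_size (pred1 true) w) wn.
move: (count_mem _ _) (word_digits _ _) => c d cn dn.
have : (c * 3 ^ n <= n * 3 ^ n)%N by rewrite leq_mul2r cn orbT.
lia.
Qed.

Lemma word_rank_lt n u v : (size u <= n)%N -> (size v <= n)%N ->
  word_lt u v -> (word_rank n u < word_rank n v)%N.
Proof.
move=> un vn /orP[duv|/andP[/eqP duv luv]]; rewrite /word_rank.
  have : ((count_mem true u).+1 * 3 ^ n <= count_mem true v * 3 ^ n)%N.
    by rewrite leq_mul2r duv orbT.
  by rewrite mulSn; have := word_digits_lt n u; lia.
by rewrite duv ltn_add2l; apply: word_digits_lex.
Qed.

(** Sequences of words as numbers in base [word_bound n]. *)
Fixpoint words_rank (n : nat) (ws : seq (seq bool)) : nat :=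
  if ws is w :: ws' then
    (word_rank n w * word_bound n ^ size ws' + words_rank n ws')%N
  else 0%N.

Definition short_words n (ws : seq (seq bool)) := all (fun w => size w <= n)%N ws.

Lemma words_rank_bound n ws : short_words n ws ->
  (words_rank n ws < word_bound n ^ size ws)%N.
Proof.
elim: ws => //= w ws IHws /andP[/word_rank_bound wb /IHws {}IHws].
have : ((word_rank n w).+1 * word_bound n ^ size ws <= word_bound n * word_bound n ^ size ws)%N.
  by rewrite leq_mul2r wb orbT.
by rewrite expnS mulSn; lia.
Qed.

Lemma words_rank_lt n us vs : short_words n us -> short_words n vs -> size us = size vs ->
  lex_lt word_lt us vs -> (words_rank n us < words_rank n vs)%N.
Proof.
elim: us vs => [|u us IHus] [|v vs] //= /andP[un usn] /andP[vn vsn] [sz].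
move=> /orP[/(word_rank_lt un vn) uv|/andP[/eqP-> luv]]; last first.
  by rewrite sz ltn_add2l; apply: IHus.
have : ((word_rank n u).+1 * word_bound n ^ size vs <= word_rank n v * word_bound n ^ size vs)%N.
  by rewrite leq_mul2r uv orbT.
by rewrite sz mulSn; have := words_rank_bound usn; rewrite sz; lia.
Qed.

Definition rank (n : nat) (t : tree) : nat :=
  (mu_degree t * word_bound n ^ n + words_rank n (path_seq t))%N.

Lemma size_path_word t i : (size (path_word t i) < size (leaves t))%N.
Proof.
elim: t => //= [a IHa b IHb|a IHa b IHb c IHc]; rewrite !size_cat.
  by case: ifP => _; lia.
by do 2?case: ifP => _; lia.
Qed.

Lemma size_leaves n t : perm_eq (leaves t) (iota 1 n) -> size (leaves t) = n.
Proof. by move=> /perm_size->; rewrite size_iota. Qed.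

Lemma short_path_seq n t : perm_eq (leaves t) (iota 1 n) -> short_words n (path_seq t).
Proof.
move=> tn; apply/allP => _ /mapP[i _ ->].
by rewrite -(size_leaves tn) ltnW // size_path_word.
Qed.

Lemma size_path_seq t : size (path_seq t) = size (leaves t).
Proof. by rewrite size_map size_iota. Qed.

Lemma lex_lt_map (f g : nat -> seq bool) L i : sorted ltn L -> i \in L ->
  {in L, forall j, (j < i)%N -> f j = g j} -> word_lt (f i) (g i) ->
  lex_lt word_lt (map f L) (map g L).
Proof.
elim: L => //= k L IHL kL; rewrite inE => /orP[/eqP<- _ ->//|iL] below lt.
have ki : (k < i)%N by apply: (allP (order_path_min ltn_trans kL)).
rewrite below ?inE ?eqxx // IHL ?orbT //; first exact: path_sorted kL.
by move=> j jL; apply: below; rewrite inE jL orbT.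
Qed.

Lemma less_path_seq n s t : perm_eq (leaves t) (iota 1 n) -> less s t ->
  [/\ size (leaves s) = size (leaves t) &
   (mu_degree s < mu_degree t)%N \/
   mu_degree s = mu_degree t /\ lex_lt word_lt (path_seq s) (path_seq t)].
Proof.
move=> tn [st lt]; split; first exact: perm_size.
case: lt => [|[mst [i it [below lt]]]]; [by left|right; split=> //].
rewrite /path_seq (perm_size st) (size_leaves tn).
apply: (lex_lt_map (i := i)) => //; first exact: iota_ltn_sorted.
  by rewrite -(perm_mem tn).
by move=> j; rewrite -(perm_mem tn); apply: below.
Qed.

Lemma less_tree_lt n s t : perm_eq (leaves t) (iota 1 n) -> less s t -> tree_lt s t.
Proof.
move=> tn /(less_path_seq tn)[sz]; rewrite /tree_lt sz ltnn eqxx /=.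
by move=> [->//|[-> ->]]; rewrite ltnn eqxx.
Qed.

Lemma rank_le n s t : perm_eq (leaves s) (iota 1 n) -> perm_eq (leaves t) (iota 1 n) ->
  (mu_degree s < mu_degree t)%N \/
  mu_degree s = mu_degree t /\ lex_lt word_lt (path_seq s) (path_seq t) ->
  (rank n s < rank n t)%N.
Proof.
move=> sn tn; have sz : size (path_seq s) = size (path_seq t).
  by rewrite !size_path_seq (size_leaves sn) (size_leaves tn).
have ss := short_path_seq sn; have st := short_path_seq tn.
case=> [mst|[mst lt]]; rewrite /rank; last first.
  by rewrite mst ltn_add2l; apply: words_rank_lt.
have := words_rank_bound ss; rewrite size_path_seq (size_leaves sn).
have : ((mu_degree s).+1 * word_bound n ^ n <= mu_degree t * word_bound n ^ n)%N.
  by rewrite leq_mul2r mst orbT.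
by rewrite mulSn; lia.
Qed.

Lemma rank_less n s t : perm_eq (leaves t) (iota 1 n) -> less s t ->
  (rank n s < rank n t)%N.
Proof.
move=> tn lt; apply: rank_le => //; first by apply: perm_trans tn; case: lt.
by case: (less_path_seq tn lt).
Qed.

Lemma rank_tree_lt n s t : perm_eq (leaves s) (iota 1 n) -> perm_eq (leaves t) (iota 1 n) ->
  tree_lt s t -> (rank n s <= rank n t)%N.
Proof.
move=> sn tn; rewrite /tree_lt !(size_leaves sn) !(size_leaves tn) ltnn eqxx /=.
case/orP => [mst|/andP[/eqP mst /orP[lt|/andP[/eqP pst _]]]].
- by apply: ltnW; apply: rank_le => //; left.
- by apply: ltnW; apply: rank_le => //; right.
by rewrite /rank mst pst.
Qed.

Lemma rank_same_shape n s t : perm_eq (leaves t) (iota 1 n) -> same_shape s t ->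
  rank n s = rank n t.
Proof.
move=> tn [st mst pst]; rewrite /rank mst; congr (_ + words_rank _ _)%N.
rewrite /path_seq (perm_size st) (size_leaves tn); apply/eq_in_map => i.
by rewrite -(perm_mem tn); apply: pst.
Qed.

(** * Normal forms *)

Definition normal_on (n : nat) (t : tree) : Prop :=
  [/\ is_normal t, is_shuffle t & perm_eq (leaves t) (iota 1 n)].

Lemma eqmod0 L : eqmod L 0 0. Proof. exact: eqmod_refl. Qed.

Lemma eqmodD L f g f' g' : eqmod L f g -> eqmod L f' g' -> eqmod L (f + f') (g + g').
Proof. by rewrite /eqmod opprD addrACA; apply: idealD. Qed.

Lemma eqmod_termwise L (P : tree -> Prop) f :
  (forall t, t \in msupp f -> exists2 g, eqmod L << t >> g & supported P g) ->
  exists2 g, eqmod L f g & supported P g.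
Proof.
move=> H.
suff [g] : exists2 g, eqmod L (linext (fun t => << t >>) f) g & supported P g.
  by rewrite -malg_linext; exists g.
rewrite /linext.
have sub0 : {subset (msupp f : seq tree) <= msupp f} by [].
elim: (msupp f : seq tree) sub0 => [|t s IHs] sub.
  by exists 0; [rewrite big_nil; apply: eqmod0 | apply: supported0].
have [g tg gP] := H t (sub t (mem_head _ _)).
have [|h sh hP] := IHs; first by move=> r rs; apply: sub; rewrite inE rs orbT.
exists (f@_t *: g + h); last by apply: supportedD => //; apply: supportedZ.
by rewrite big_cons; apply: eqmodD => //; apply: eqmodZ.
Qed.

(** Induction on the rank: a monomial that is not normal is congruent to a
    combination of smaller ones, which are sorted before the induction
    hypothesis applies to them. *)
Lemma normal_form_shuffle n t : is_shuffle t -> perm_eq (leaves t) (iota 1 n) ->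
  exists2 f, eqmod (iota 1 n) << t >> f &
    supported (fun s => normal_on n s /\ (s = t \/ (rank n s < rank n t)%N)) f.
Proof.
have [r] := ubnP (rank n t); elim: r t => // r IHr t tr sh tn.
have ut : uniq (leaves t) by rewrite (perm_uniq tn) iota_uniq.
case: (instance_or_normal sh ut) => [it|nt]; last first.
  exists << t >>; first exact: eqmod_refl.
  by apply: supportedU; split=> //; left.
have [f tf fless] := instance_reducible it ut.
have [s sf|g fg gP] := @eqmod_termwise (iota 1 n)
   (fun s => normal_on n s /\ (rank n s < rank n t)%N) f.
  have lst := fless s sf; have sn : perm_eq (leaves s) (iota 1 n).
    by apply: perm_trans tn; case: lst.
  have us : uniq (leaves s) by rewrite (perm_uniq sn) iota_uniq.
  have [shu [same esu]] := sortP us.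
  have rs : (rank n (sort_tree s).2 < rank n t)%N.
    by rewrite (rank_same_shape sn same); apply: rank_less tn lst.
  have un : perm_eq (leaves (sort_tree s).2) (iota 1 n) by apply: perm_trans sn; case: same.
  have [|h uh hP] := IHr _ _ shu un; first exact: leq_trans rs _.
  exists ((sort_tree s).1 *: h).
    by apply: eqmod_trans (eqmod_perm us sn esu) _; apply: eqmodZ.
  apply: supportedZ => v /hP[vn vr]; split=> //.
  by case: vr => [->|lt] //; apply: ltn_trans lt rs.
exists g; first exact: eqmod_trans (eqmod_perm ut tn tf) fg.
by move=> s /gP[sn sr]; split=> //; right.
Qed.

Lemma normal_form n f : free_op n f ->
  exists2 g, eqmod (iota 1 n) f g & supported (normal_on n) g.
Proof.
move=> fn; apply: eqmod_termwise => t /fn tn.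
have ut : uniq (leaves t) by rewrite (perm_uniq tn) iota_uniq.
have [shu [same etu]] := sortP ut.
have un : perm_eq (leaves (sort_tree t).2) (iota 1 n) by apply: perm_trans tn; case: same.
have [h uh hP] := normal_form_shuffle shu un.
exists ((sort_tree t).1 *: h).
  by apply: eqmod_trans (eqmod_perm ut tn etu) _; apply: eqmodZ.
by apply: supportedZ => v /hP[].
Qed.

Lemma eqmod_eval n f g (A : algType rat) (x : nat -> A) : eqmod (iota 1 n) f g ->
  linext (tree_eval x) f = linext (tree_eval x) g.
Proof.
move=> /ideal_operad/(operad_ideal_identity presentation_rel_identity)/(_ A x).
by rewrite linearB => /subr0_eq.
Qed.

(** * Words of normal monomials *)

(** The concatenation of the words of the Lie factors, in decreasing order of
    their smallest letters.  The factors then begin exactly at the left-to-right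
    minima, so that they can be recovered from the word. *)
Fixpoint code (t : tree) : seq nat :=
  if t is Mu a b c then leaves c ++ leaves b ++ code a else leaves t.

Lemma code_perm t : perm_eq (code t) (leaves t).
Proof.
elim: t => // a IHa b _ c _; apply/seq.permP => p.
by rewrite /= !count_cat (seq.permP IHa) addnC (addnC (count p (leaves b))) addnA.
Qed.

Fixpoint lr_minima_from (m : nat) (w : seq nat) : nat :=
  if w is x :: w' then
    (if (x < m)%N then (lr_minima_from x w').+1 else lr_minima_from m w')
  else 0%N.

Definition lr_minima (w : seq nat) : nat :=
  if w is x :: w' then (lr_minima_from x w').+1 else 0%N.

Lemma lr_minima_from_skip m l v : all (leq m) l ->
  lr_minima_from m (l ++ v) = lr_minima_from m v.
Proof. by elim: l => //= x l IHl /andP[mx /IHl->]; rewrite ltnNge mx. Qed.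

Lemma lr_minima_from_head m x v : (x < m)%N ->
  lr_minima_from m (x :: v) = lr_minima (x :: v).
Proof. by move=> /= ->. Qed.

Lemma lie_Nu a b : lie (Nu a b) ->
  [/\ lie a, lie b & if a is Nu _ a2 then (min_leaf b < min_leaf a2)%N else true].
Proof. by case: a => [i|a1 a2|a1 a2 a3] /and3P[]; split. Qed.

Lemma lie_leaves t : lie t -> is_shuffle t -> exists2 l, leaves t = min_leaf t :: l &
  all (leq (min_leaf t)) l.
Proof.
have all_min r m : (m <= min_leaf r)%N -> all (leq m) (leaves r).
  by move=> mr; apply/allP => i /min_leaf_le; apply: leq_trans.
elim: t => [i|a IHa b IHb|//] /=; first by exists [::].
move=> /and3P[la _ _] /and3P[ab sa _]; have [l -> al] := IHa la sa.
rewrite (minn_idPl (ltnW ab)); exists (l ++ leaves b) => //.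
by rewrite all_cat al all_min // ltnW.
Qed.

Definition last_min (t : tree) : nat :=
  if t is Mu _ _ c then min_leaf c else min_leaf t.

Lemma normal_Mu a b c : is_normal (Mu a b c) -> is_shuffle (Mu a b c) ->
  [/\ is_normal a, lie b, lie c, (last_min a < min_leaf b)%N & (min_leaf b < min_leaf c)%N].
Proof.
move=> /= /and4P[na lb lc] + /and4P[/andP[ab bc] _ _ _].
by case: a na ab => [i|a1 a2|a1 a2 a3] na ab; rewrite ?ab.
Qed.

Lemma code_head t : is_normal t -> is_shuffle t -> exists v, code t = last_min t :: v.
Proof.
case: t => [i|a b|a b c] nt st; first by exists [::].
  by have [l e _] := lie_leaves nt st; exists l.
have [_ _ lc _ _] := normal_Mu nt st; have [_ _ _ _ sc] := shuffle_Mu st.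
by have [l /= -> _] := lie_leaves lc sc; exists (l ++ leaves b ++ code a).
Qed.

Lemma lr_minima_lie t : lie t -> is_shuffle t -> lr_minima (leaves t) = 1%N.
Proof.
move=> lt st; have [l -> al] := lie_leaves lt st.
by rewrite /= -[l]cats0 lr_minima_from_skip.
Qed.

Lemma lr_minima_code a b c : is_normal (Mu a b c) -> is_shuffle (Mu a b c) ->
  lr_minima (code (Mu a b c)) = (lr_minima (code a)).+2.
Proof.
move=> nt st; have [na lb lc ab bc] := normal_Mu nt st.
have [_ _ sa sb sc] := shuffle_Mu st.
have [l /= -> al] := lie_leaves lc sc; have [k -> ak] := lie_leaves lb sb.
have [v ->] := code_head na sa.
rewrite /= lr_minima_from_skip //= bc lr_minima_from_skip //.
by rewrite lr_minima_from_head.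
Qed.

Lemma lr_minima_code_odd t : is_normal t -> is_shuffle t -> odd (lr_minima (code t)).
Proof.
elim: t => [i|a _ b _|a IHa b _ c _] nt st //.
  by rewrite [code _]/= -[_ ++ _]/(leaves (Nu a b)) lr_minima_lie.
have [na _ _ _ _] := normal_Mu nt st; have [_ _ sa _ _] := shuffle_Mu st.
by rewrite lr_minima_code //= negbK IHa.
Qed.

(** The first block ends where the first letter not satisfying [p] occurs. *)
Lemma split_unique (p : pred nat) l l' v v' :
  all p l -> all p l' -> ~~ p (head 0%N v) -> ~~ p (head 0%N v') ->
  v != [::] -> v' != [::] -> l ++ v = l' ++ v' -> l = l' /\ v = v'.
Proof.
elim: l l' => [|x l IHl] [|x' l'] //=.
- by case: v => // y v _ /andP[px _] /= npy _ _ _ [yx _]; rewrite yx px in npy.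
- by case: v' {IHl} => // y v' /andP[px _] _ _ /= npy _ _ [xy _]; rewrite -xy px in npy.
move=> /andP[_ pl] /andP[_ pl'] nv nv' v0 v0' [-> e].
by have [-> ->] := IHl l' pl pl' nv nv' v0 v0' e.
Qed.

(** The second smallest letter of the word of a Lie monomial starts the word of
    its right factor, which determines the factors. *)
Lemma lie_second_min a b : lie (Nu a b) -> is_shuffle (Nu a b) ->
  {in behead (leaves a ++ leaves b), forall x, (min_leaf b <= x)%N}.
Proof.
elim: a b => [i|a1 IH1 a2 IH2|//] b lt st x.
  exact: min_leaf_le.
have [la lb ba2] := lie_Nu lt; have [_ sa sb] := shuffle_Nu st.
have [l ea _] := lie_leaves la sa; have := IH1 a2 la sa x.
rewrite -[_ ++ leaves a2]/(leaves (Nu a1 a2)) ea /= mem_cat => H /orP[xl|].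
  exact: leq_trans (ltnW ba2) (H xl).
exact: min_leaf_le.
Qed.

Lemma lie_leaves_inj s t : lie s -> lie t -> is_shuffle s -> is_shuffle t ->
  uniq (leaves s) -> leaves s = leaves t -> s = t.
Proof.
elim: s t => [i|a IHa b IHb|//] [j|a' b'|//] // ls lt ss st u e.
- by case: e => ->.
- by have := congr1 size e; rewrite /= size_cat; have := leaves_gt0 a'; have := leaves_gt0 b'; lia.
- by have := congr1 size e; rewrite /= size_cat; have := leaves_gt0 a; have := leaves_gt0 b; lia.
have [la lb _] := lie_Nu ls; have [la' lb' _] := lie_Nu lt.
have [_ sa sb] := shuffle_Nu ss; have [_ sa' sb'] := shuffle_Nu st.
have minb r r' : lie r -> is_shuffle r -> min_leaf r' \in behead (leaves r ++ leaves r').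
  by move=> lr sr; have [l -> _] := lie_leaves lr sr; rewrite /= mem_cat min_leaf_in orbT.
have bb' : min_leaf b = min_leaf b'.
  apply/eqP; rewrite eqn_leq; move: e => /= e.
  rewrite (lie_second_min ls ss) ?(lie_second_min lt st) //.
    by rewrite -[X in behead X]e minb.
  by rewrite [X in behead X]e minb.
have [l eb _] := lie_leaves lb sb; have [l' eb' _] := lie_leaves lb' sb'.
have idx r k : uniq (leaves r ++ min_leaf b :: k) ->
    index (min_leaf b) (leaves r ++ min_leaf b :: k) = size (leaves r).
  by case/uniq_catP => _ _ _ n; rewrite index_cat (negPf (n _ (mem_head _ _))) /= eqxx addn0.
have sz : size (leaves a) = size (leaves a').
  move: e u => /= e u; rewrite -(idx a l) -?(idx a' l') -?eb ?bb' -?eb' -?e //.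
have /eqP := e; rewrite /= eqseq_cat // => /andP[/eqP ea /eqP eb2].
have [ua ub _ _] := uniq_catP u.
by rewrite (IHa a' la la' sa sa' ua ea) (IHb b' lb lb' sb sb' ub eb2).
Qed.

(** The first block of the word ends at the first letter smaller than its
    head. *)
Lemma code_inj s t : is_normal s -> is_normal t -> is_shuffle s -> is_shuffle t ->
  uniq (leaves s) -> code s = code t -> s = t.
Proof.
have lie_Mu r a b c : lie r -> is_normal (Mu a b c) -> is_shuffle r -> is_shuffle (Mu a b c) ->
    code r = code (Mu a b c) -> False.
  move=> lr nt sr st /(congr1 lr_minima); rewrite lr_minima_code //.
  by case: r lr sr => // a' b' lr sr; rewrite [code _]/= (lr_minima_lie lr sr).
elim: s t => [i|a _ b _|a IHa b _ c _] [j|a' b'|a' b' c'] ns nt ss st u e;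
  try exact: lie_leaves_inj; try by [case: (lie_Mu _ _ _ _ ns nt ss st e)|
    case: (lie_Mu _ _ _ _ nt ns st ss (esym e))].
have [na lb lc ab bc] := normal_Mu ns ss; have [na' lb' lc' ab' bc'] := normal_Mu nt st.
have [_ _ sa sb sc] := shuffle_Mu ss; have [_ _ sa' sb' sc'] := shuffle_Mu st.
have all_min r : all (leq (min_leaf r)) (leaves r) by apply/allP => i /min_leaf_le.
have [l ec _] := lie_leaves lc sc; have [l' ec' _] := lie_leaves lc' sc'.
have [k eb _] := lie_leaves lb sb; have [k' eb' _] := lie_leaves lb' sb'.
have [v ea] := code_head na sa; have [v' ea'] := code_head na' sa'.
have cc' : min_leaf c = min_leaf c' by move: e; rewrite /= ec ec' => -[].
have [|||||||elc] := @split_unique (leq (min_leaf c)) (leaves c) (leaves c')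
    (leaves b ++ code a) (leaves b' ++ code a') => //.
- by rewrite cc'.
- by rewrite eb /= -ltnNge.
- by rewrite eb' /= -ltnNge cc'.
- by rewrite eb.
- by rewrite eb'.
rewrite eb eb' => e2; have bb' : min_leaf b = min_leaf b' by case: e2.
have [|||||||elb ecode] := @split_unique (leq (min_leaf b)) (leaves b) (leaves b')
    (code a) (code a') => //.
- by rewrite bb'.
- by rewrite ea /= -ltnNge.
- by rewrite ea' /= -ltnNge bb'.
- by rewrite ea.
- by rewrite ea'.
- by rewrite eb eb'.
have [ua ubc _ _] := uniq_catP u; have [ub uc _ _] := uniq_catP ubc.
rewrite (IHa a' na na' sa sa' ua ecode).
by rewrite (lie_leaves_inj lb lb' sb sb' ub elb) (lie_leaves_inj lc lc' sc sc' uc elc).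
Qed.

Lemma perm_involution (T : eqType) (phi : T -> T) (s : seq T) : involutive phi ->
  uniq s -> {in s, forall x, phi x \in s} -> perm_eq (map phi s) s.
Proof.
move=> phiK us phis; apply: uniq_perm => // [|x].
  by rewrite map_inj_uniq //; apply: inv_inj.
apply/mapP/idP => [[y ys ->]|xs]; first exact: phis.
by exists (phi x); [apply: phis | rewrite phiK].
Qed.

Lemma count_involution (T : eqType) (phi : T -> T) (p : pred T) (s : seq T) :
  involutive phi -> uniq s -> {in s, forall x, phi x \in s} ->
  {in s, forall x, p (phi x) = ~~ p x} -> (count p s + count p s)%N = size s.
Proof.
move=> phiK us phis pphi; rewrite -(count_predC p s); congr addn.
rewrite -(seq.permP (perm_involution phiK us phis)) count_map.
by apply: eq_in_count => x /pphi.
Qed.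

Definition swap_head (w : seq nat) : seq nat :=
  if w is x :: y :: v then y :: x :: v else w.

Lemma swap_headK : involutive swap_head. Proof. by case=> [|x [|y v]]. Qed.

Lemma lr_minima_swap w : uniq w -> (1 < size w)%N ->
  odd (lr_minima (swap_head w)) = ~~ odd (lr_minima w).
Proof.
case: w => [|x [|y v]] //= /andP[]; rewrite inE negb_or => /andP[xy _] _ _.
by case: ltngtP xy => //= _ _; rewrite !negbK.
Qed.

(** One representative for each word and its reversal. *)
Definition ascending (w : seq nat) : bool := (head 0 w <= last 0 w)%N.

Lemma head_neq_last (w : seq nat) : uniq w -> (1 < size w)%N -> head 0%N w != last 0%N w.
Proof.
case: w => [|x [|y v]] //= /andP[xn _] _.
by apply: contraNneq xn => ->; apply: mem_last.
Qed.

Lemma ascending_rev w : uniq w -> (1 < size w)%N -> ascending (rev w) = ~~ ascending w.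
Proof.
move=> uw sw; have := head_neq_last uw sw; rewrite /ascending.
have -> : head 0%N (rev w) = last 0%N w.
  by case/lastP: w {uw sw} => // v x; rewrite rev_rcons last_rcons.
have -> : last 0%N (rev w) = head 0%N w.
  by case: w {uw sw} => // x v; rewrite rev_cons last_rcons.
by case: ltngtP.
Qed.

Section Words.
Variable n : nat.
Let W := permutations (iota 1 n).

Lemma mem_words w : (w \in W) = perm_eq w (iota 1 n).
Proof. by rewrite mem_permutations. Qed.

Lemma word_uniq w : w \in W -> uniq w.
Proof. by rewrite mem_words => /perm_uniq->; apply: iota_uniq. Qed.

Lemma word_size w : w \in W -> size w = n.
Proof. by rewrite mem_words => /perm_size->; rewrite size_iota. Qed.

(** Both sets contain half of the words when there are at least two letters:
    exchanging the first two letters changes the parity of the number of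
    left-to-right minima, and reversal exchanges the first and the last
    letter. *)
Lemma count_odd_ascending : (0 < n)%N ->
  count (odd \o lr_minima) W = count ascending W.
Proof.
move=> n0; have uW : uniq W by apply: permutations_uniq.
have [n1|n1] := leqP n 1.
  apply: eq_in_count => w wW; have := word_size wW.
  have -> : n = 1%N by lia.
  by case: w {wW} => [|x [|]] //= _; rewrite /ascending /= leqnn.
have h1 : (count (odd \o lr_minima) W + count (odd \o lr_minima) W)%N = size W.
  apply: (count_involution swap_headK) => // w wW; last first.
    by rewrite /= lr_minima_swap ?word_uniq ?word_size.
  move: wW; rewrite !mem_words; apply: perm_trans.
  by case: w => [|x [|y v]] //=; rewrite (perm_catCA [:: y] [:: x]).
have h2 : (count ascending W + count ascending W)%N = size W.
  apply: (count_involution (@revK nat)) => // w wW; last first.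
    by rewrite ascending_rev ?word_uniq ?word_size.
  by move: wW; rewrite !mem_words perm_rev.
lia.
Qed.

Let H := filter ascending W.

(** The word of a normal monomial has an odd number of left-to-right minima, one
    for each of its Lie factors. *)
Lemma size_normal (N : seq tree) : (0 < n)%N -> uniq N -> {in N, forall t, normal_on n t} ->
  (size N <= size H)%N.
Proof.
move=> n0 uN NP; rewrite size_filter -count_odd_ascending // -size_filter -(size_map code).
apply: uniq_leq_size.
  rewrite map_inj_in_uniq // => s t /NP[ns ss sn] /NP[nt st tn]; apply: code_inj => //.
  by rewrite (perm_uniq sn) iota_uniq.
move=> _ /mapP[t /NP[nt st tn] ->]; rewrite mem_filter /= lr_minima_code_odd //=.
by rewrite mem_words; apply: perm_trans (code_perm t) tn.
Qed.

Definition coef (w : seq nat) (a : FA) : rat := (a : freeAlg)@_(FMonom w).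

Lemma coef_linear w : linear (coef w : FA -> rat^o).
Proof. by move=> c a b; rewrite /coef [LHS]mcoeffD [in LHS]mcoeffZ. Qed.

Lemma coef_linext (K : choiceType) (F : K -> FA) w f :
  coef w (linext F f) = \sum_(k <- msupp f) f@_k * coef w (F k).
Proof.
pose h : {linear FA -> rat^o} := HB.pack (coef w : FA -> rat^o)
  (GRing.isLinear.Build rat FA rat^o _ _ (coef_linear w)).
exact: (linear_linext h).
Qed.

Lemma coef_word u w : coef w (wordA u) = (u == w)%:R.
Proof. exact: (mcoeff_word u (FMonom w)). Qed.

Lemma coef_skewprod u w : (0 < n)%N -> u \in H -> w \in H ->
  coef w (skewprod (map letter u)) =
  (if n == 1%N then 2 else 1) *+ (u == w).
Proof.
move=> n0; rewrite !mem_filter => /andP[au uW] /andP[aw wW].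
rewrite skew_letter antipode_word (word_size uW).
have -> : coef w (wordA u - (-1) ^+ n *: wordA (rev u)) =
    coef w (wordA u) - (-1) ^+ n * coef w (wordA (rev u)).
  by rewrite /coef [LHS]mcoeffB [X in _ - X = _]mcoeffZ.
rewrite !coef_word; have [n1|n1] := eqVneq n 1%N.
  have -> : rev u = u by have := word_size uW; rewrite n1; case: (u) => [|x [|]].
  by rewrite n1 expr1 mulN1r opprK; case: eqP.
have {}n1 : (1 < n)%N by lia.
have -> : rev u == w = false.
  apply: contraTF aw => /eqP<-; rewrite ascending_rev ?word_uniq ?word_size // au.
  by [].
by rewrite mulr0 subr0; case: eqP.
Qed.

(** The skew sums of the representatives are linearly independent and are
    combinations of normal monomials, which are not more numerous: so the normal
    monomials are linearly independent. *)
Lemma normal_free f : supported (normal_on n) f ->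
  linext (tree_eval letter) f = 0 -> f = 0.
Proof.
move=> fn f0; have [n0|n0] := posnP n.
  apply/malgP => t; rewrite mcoeff0; apply/eqP; rewrite mcoeff_eq0.
  apply/negP => /fn[_ _ /perm_size]; rewrite n0 /= => t0.
  by have := leaves_gt0 t; rewrite t0.
pose h := size H; pose w (j : 'I_h) := nth [::] H j.
have wH j : w j \in H by apply: mem_nth.
have /fin_all_exists[g gP] (j : 'I_h) : exists g, supported (normal_on n) g /\
    linext (tree_eval letter) g = skewprod (map letter (w j)).
  have := wH j; rewrite mem_filter mem_words => /andP[_ wn].
  have [g0 g0n g0w] := skew_letter_attained n0 wn.
  have [g gg0 gn] := normal_form g0n; exists g; split; first exact: gn.
  by rewrite -g0w; symmetry; apply: (eqmod_eval letter gg0).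
pose N : {fset tree} := (msupp f `|` \bigcup_(j <- enum 'I_h) msupp (g j))%fset.
have fN : (msupp f `<=` N)%fset by apply: fsubsetUl.
have gN j : (msupp (g j) `<=` N)%fset.
  apply: fsubsetU; apply/orP; right.
  by apply: (@bigfcup_sup _ _ _ j); rewrite ?mem_enum.
have Nn : {in (N : seq tree), forall t, normal_on n t}.
  move=> t; rewrite inE => /orP[/fn//|/bigfcupP[j _ tg]].
  exact: (proj1 (gP j)).
pose s : seq tree := N; have sz : (size s <= h)%N.
  by apply: size_normal => //; apply: fset_uniq.
pose A := \matrix_(i < size s, j < h) coef (w j) (tree_eval letter (nth (Leaf 0) s i)).
pose row_of e : 'rV[rat]_(size s) := \row_i e@_(nth (Leaf 0) s i).
have row_ofE e j : (msupp e `<=` N)%fset ->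
    (row_of e *m A) 0 j = coef (w j) (linext (tree_eval letter) e).
  move=> eN; rewrite coef_linext mxE (big_fset_incl _ eN) /=; last first.
    by move=> t _; rewrite -mcoeff_eq0 => /eqP->; rewrite mul0r.
  rewrite (big_nth (Leaf 0)) big_mkord; apply: eq_bigr => i _.
  by rewrite !mxE.
pose c : rat := if n == 1%N then 2 else 1.
have c0 : c != 0 by rewrite /c; case: ifP.
pose C := \matrix_(j < h) row_of (g j).
have CA : C *m A = c%:M.
  apply/row_matrixP => i; rewrite row_mul rowK; apply/rowP => j.
  rewrite row_ofE // (proj2 (gP i)) coef_skewprod //.
  rewrite !mxE nth_uniq //.
  exact/filter_uniq/permutations_uniq.
have rA : row_full A.
  by apply/row_fullP; exists (c^-1 *: C); rewrite -scalemxAl CA scale_scalar_mx mulVf.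
have freeA : row_free A.
  rewrite /row_free eqn_leq rank_leq_row /=.
  by move: rA; rewrite /row_full => /eqP->.
have : row_of f == 0.
  rewrite -(mulmx_free_eq0 _ freeA); apply/eqP/rowP => j.
  by rewrite row_ofE // f0 mxE [LHS]mcoeff0.
move=> /eqP rf0; apply/malgP => t; rewrite mcoeff0.
have [tf|] := boolP (t \in msupp f); last by rewrite -mcoeff_eq0 => /eqP.
have tN : t \in s by apply: (fsubsetP fN).
have lt : (index t s < size s)%N by rewrite index_mem.
have := congr1 (fun r : 'rV_(size s) => r 0 (Ordinal lt)) rf0.
by rewrite !mxE /= nth_index.
Qed.
End Words.

(** * Increasing substitutions *)

Section IncreasingSubstitution.
Variable s : nat -> tree.

Definition increasing_on (L : seq nat) : Prop :=
  {in L &, {homo (fun i => min_leaf (s i)) : i j / (i < j)%N}}.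

Lemma increasing_sub L K : {subset K <= L} -> increasing_on L -> increasing_on K.
Proof. by move=> KL inc i j /KL iL /KL jL; apply: inc. Qed.

Lemma increasing_mono L i j : increasing_on L -> i \in L -> j \in L ->
  (min_leaf (s i) < min_leaf (s j))%N = (i < j)%N.
Proof.
move=> inc iL jL; case: (ltngtP i j) => [ij|ji|->]; last by rewrite ltnn.
  exact: inc.
by apply/negbTE; rewrite -leqNgt ltnW // inc.
Qed.

Lemma increasing_minn L i j : increasing_on L -> i \in L -> j \in L ->
  minn (min_leaf (s i)) (min_leaf (s j)) = min_leaf (s (minn i j)).
Proof. by move=> inc iL jL; rewrite /minn (increasing_mono inc) //; case: ifP. Qed.

Lemma min_leaf_subst t : increasing_on (leaves t) ->
  min_leaf (tree_subst s t) = min_leaf (s (min_leaf t)).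
Proof.
elim: t => [//|a IHa b IHb|a IHa b IHb c IHc] /= inc.
  rewrite IHa ?IHb; try by apply: increasing_sub inc => i ti; rewrite mem_cat ti ?orbT.
  by rewrite (increasing_minn inc) // mem_cat min_leaf_in ?orbT.
rewrite IHa ?IHb ?IHc; try by apply: increasing_sub inc => i ti; rewrite !mem_cat ti ?orbT.
rewrite !(increasing_minn inc) // ?mem_cat ?min_leaf_in ?orbT //.
by rewrite /minn; case: ifP => _; rewrite min_leaf_in ?orbT.
Qed.

Lemma min_leaf_subst_lt a b : increasing_on (leaves a ++ leaves b) ->
  (min_leaf (tree_subst s a) < min_leaf (tree_subst s b))%N = (min_leaf a < min_leaf b)%N.
Proof.
move=> inc; rewrite !min_leaf_subst.
- by rewrite (increasing_mono inc) // mem_cat min_leaf_in ?orbT.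
- by apply: increasing_sub inc => i ti; rewrite mem_cat ti ?orbT.
by apply: increasing_sub inc => i ti; rewrite mem_cat ti ?orbT.
Qed.

Lemma shuffle_subst t : increasing_on (leaves t) ->
  {in leaves t, forall i, is_shuffle (s i)} -> is_shuffle t -> is_shuffle (tree_subst s t).
Proof.
elim: t => [i _ sh _|a IHa b IHb|a IHa b IHb c IHc] /=; first by apply: sh; rewrite inE.
  move=> inc sh /and3P[ab sa sb]; rewrite min_leaf_subst_lt // ab.
  rewrite IHa ?IHb //; try by apply: increasing_sub inc => i ti; rewrite mem_cat ti ?orbT.
    by move=> i ti; apply: sh; rewrite mem_cat ti ?orbT.
  by move=> i ti; apply: sh; rewrite mem_cat ti ?orbT.
move=> inc sh /and4P[/andP[ab bc] sa sb sc].
rewrite !min_leaf_subst_lt ?ab ?bc; try by apply: increasing_sub inc => i; rewrite !mem_cat => /orP[]->; rewrite ?orbT.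
by rewrite IHa ?IHb ?IHc //; try (by apply: increasing_sub inc => i ti; rewrite !mem_cat ti ?orbT);
  move=> i ti; apply: sh; rewrite !mem_cat ti ?orbT.
Qed.

(** Sorting only compares minimal leaves, whose order an increasing substitution
    preserves. *)
Lemma sort_subst t : uniq (leaves t) -> increasing_on (leaves t) ->
  {in leaves t, forall i, is_shuffle (s i)} ->
  sort_tree (tree_subst s t) = ((sort_tree t).1, tree_subst s (sort_tree t).2).
Proof.
elim: t => [i|a IHa b IHb|a IHa b IHb c IHc] u inc sh.
- by have /sort_shuffle si := sh i (mem_head _ _); rewrite /= si.
- have [ua ub _ _] := uniq_catP u.
  have [inca incb] : increasing_on (leaves a) /\ increasing_on (leaves b).
    by split; apply: increasing_sub inc => i ti; rewrite mem_cat ti ?orbT.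
  rewrite /= IHa ?IHb //; try by move=> i ti; apply: sh; rewrite mem_cat ti ?orbT.
  rewrite min_leaf_subst_lt //; case: (sort_tree a) (sort_tree b) => [p a'] [q b'].
  by case: ifP.
have [ua ubc _ _] := uniq_catP u; have [ub uc _ _] := uniq_catP ubc.
have sub x : x \in [:: a; b; c] -> {subset leaves x <= leaves (Mu a b c)}.
  by rewrite !inE => /or3P[]/eqP-> i ti; rewrite !mem_cat ti ?orbT.
have IH x : x \in [:: a; b; c] -> sort_tree (tree_subst s x) =
    ((sort_tree x).1, tree_subst s (sort_tree x).2).
  move=> xabc; have incx : increasing_on (leaves x) by apply: increasing_sub inc; apply: sub.
  have shx : {in leaves x, forall i, is_shuffle (s i)} by move=> i /(sub x xabc); apply: sh.
  by move: xabc incx shx; rewrite !inE => /or3P[]/eqP-> ? ?; rewrite ?IHa ?IHb ?IHc.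
have [shu [[pl _ _] _]] := sortP u; move: shu pl.
rewrite /= !IH ?inE ?eqxx ?orbT //.
case: (sort_tree a) (sort_tree b) (sort_tree c) => [p a'] [q b'] [r c'].
rewrite -!/(sort3 _ _ _).
have [p3 e3] := sort3_nth a' b' c'; move: p3; rewrite e3 /=.
set x := nth _ _ 0; set y := nth _ _ 1; set z := nth _ _ 2 => p3.
move=> /and4P[/andP[xy yz] _ _ _] pl.
rewrite (@sort3_perm _ _ _ (tree_subst s x) (tree_subst s y) (tree_subst s z)) //=.
  exact: (perm_map (tree_subst s) p3).
have incx : increasing_on (leaves x ++ leaves y ++ leaves z).
  by apply: increasing_sub inc => i; rewrite (perm_mem pl).
by rewrite !min_leaf_subst_lt ?xy ?yz //; apply: increasing_sub incx => i;
  rewrite !mem_cat => /orP[]->; rewrite ?orbT.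
Qed.
End IncreasingSubstitution.

(** * The shuffle ideal consists of shuffle elements *)

Lemma min_leaf_iota n t : perm_eq (leaves t) (iota 1 n) -> min_leaf t = 1%N.
Proof.
move=> tn; have n0 : (0 < n)%N by rewrite -(size_leaves tn) leaves_gt0.
apply/eqP; rewrite eqn_leq min_leaf_le ?(perm_mem tn) ?mem_iota ?n0 //=.
by have := min_leaf_in t; rewrite (perm_mem tn) mem_iota => /andP[].
Qed.

(** The smallest input of the grafted tree takes the place of [i], so the order of
    the minimal leaves is that of the inputs of [s]. *)
Lemma shuffle_graft m n i u v s t : shuffle_data m n i u v ->
  is_shuffle s -> perm_eq (leaves s) (iota 1 m) ->
  is_shuffle t -> perm_eq (leaves t) (iota 1 n) ->
  is_shuffle (graft_tree i u v s t) /\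
  perm_eq (leaves (graft_tree i u v s t)) (iota 1 (m + n).-1).
Proof.
move=> [im incu incv uv puv] ss sm st tn.
have incv' : increasing_on (fun k => Leaf (v k)) (leaves t).
  by move=> j k; rewrite !(perm_mem tn); apply: incv.
pose f j := if j == i then tree_relabel v t else Leaf (u j).
have minf j : min_leaf (f j) = u j.
  rewrite /f; case: eqP => // ->.
  by rewrite min_leaf_subst // (min_leaf_iota tn) /= uv.
split.
  apply: shuffle_subst => // [j k|j _].
    by rewrite !(perm_mem sm) -!/(f _) !minf; apply: incu.
  by case: ifP => // _; apply: shuffle_subst.
rewrite leaves_subst; apply: perm_trans puv.
apply: (perm_trans (perm_flatten (perm_map _ sm))).
have iI : i \in iota 1 m by rewrite mem_iota add1n ltnS.
have := perm_to_rem iI; rewrite rem_filter ?iota_uniq // => /(perm_map (fun j => leaves (f j))).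
move=> /perm_flatten /perm_trans -> //=.
rewrite {1}/f eqxx leaves_relabel perm_catC.
apply: perm_cat; last exact: perm_map.
have -> : [seq leaves (f j) | j <- iota 1 m & predC1 i j] = [seq [:: u j] | j <- iota 1 m & j != i].
  by apply/eq_in_map => j; rewrite mem_filter /f /= => /andP[/negPf-> _].
by rewrite flatten_map1.
Qed.

Lemma permutes_relabel n s t : permutes n s -> perm_eq (leaves t) (iota 1 n) ->
  perm_eq (leaves (tree_relabel s t)) (iota 1 n).
Proof.
by move=> sn tn; rewrite leaves_relabel; apply: perm_trans sn; apply: perm_map.
Qed.

Lemma shuffle_rel_op n r : shuffle_rel n r -> shuffle_op n r.
Proof.
case=> {n r} n s r rn sn; rewrite shuffle_formE.
apply: supported_linext => t; rewrite relabelE => tr; apply: supportedZ; apply: supportedU.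
have tn : perm_eq (leaves t) (iota 1 n).
  have : supported (fun t => perm_eq (leaves t) (iota 1 n)) (tsubst (fun i => Leaf (s i)) r).
    apply: supported_linext => t' /(defining_rel_free rn) t'n; apply: supportedU.
    exact: permutes_relabel.
  exact.
have ut : uniq (leaves t) by rewrite (perm_uniq tn) iota_uniq.
by have [shu [[pl _ _] _]] := sortP ut; split=> //; apply: perm_trans pl tn.
Qed.

Lemma shuffle_ideal_op n f : shuffle_ideal shuffle_rel n f -> shuffle_op n f.
Proof.
elim=> {n f} [n f /shuffle_rel_op//|n|n f g _ fn _ gn|n c f _ fn|m n i u v f g d _ fm gn|m n i u v f g d fm _ gn].
- exact: supported0.
- exact: supportedD.
- exact: supportedZ.
- rewrite graftE; apply: supported_linext => s /fm[ss sm].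
  apply: supported_linext => t /gn[st tn]; apply: supportedU.
  exact: shuffle_graft d ss sm st tn.
rewrite graftE; apply: supported_linext => s /fm[ss sm].
apply: supported_linext => t /gn[st tn]; apply: supportedU.
exact: shuffle_graft d ss sm st tn.
Qed.

(** * Leading monomials of the shuffle relations *)

Lemma less_irrefl s : ~ less s s.
Proof. by move=> [_ [|[_ [i _ []]]]]; rewrite ?ltnn // word_ltxx. Qed.

Section Ranks.
Variables (m : nat -> nat) (n : nat).
Hypothesis m_inj : {in iota 1 n &, injective m}.

(** The increasing relabelling of the values of [m] by 1, 2, and so on. *)
Definition label_rank (i : nat) : nat := (count (fun j => m j < m i)%N (iota 1 n)).+1.

Lemma label_rank_lt i j : i \in iota 1 n -> (m i < m j)%N -> (label_rank i < label_rank j)%N.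
Proof.
move=> iI ij; rewrite /label_rank ltnS.
rewrite !(seq.permP (perm_to_rem iI)) /= ltnn ij add0n add1n ltnS.
by apply: sub_count => k /= ki; apply: ltn_trans ki ij.
Qed.

Lemma label_rank_mono i j : i \in iota 1 n -> j \in iota 1 n ->
  (label_rank i < label_rank j)%N = (m i < m j)%N.
Proof.
move=> iI jI; case: (ltngtP (m i) (m j)) => [ij|ji|e]; first exact: label_rank_lt.
  by apply/negbTE; rewrite -leqNgt ltnW // label_rank_lt.
by rewrite (m_inj iI jI e) ltnn.
Qed.

Lemma label_rank_inj : {in iota 1 n &, injective label_rank}.
Proof.
move=> i j iI jI e; apply: m_inj => //.
by apply/eqP; rewrite eqn_leq; apply/andP; split; rewrite leqNgt -label_rank_mono // e ltnn.
Qed.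

Lemma label_rank_permutes : permutes n label_rank.
Proof.
apply: uniq_perm; rewrite ?iota_uniq //.
  by rewrite map_inj_in_uniq ?iota_uniq //; apply: label_rank_inj.
have sub : {subset [seq label_rank i | i <- iota 1 n] <= iota 1 n}.
  move=> _ /mapP[i iI ->]; rewrite mem_iota add1n !ltnS /=.
  have := count_predC (fun j => m j < m i)%N (iota 1 n); rewrite size_iota.
  have : has (predC (fun j => m j < m i)%N) (iota 1 n).
    by apply/hasP; exists i => //=; rewrite ltnn.
  by rewrite has_count /label_rank; lia.
have uniq_rank : uniq [seq label_rank i | i <- iota 1 n].
  by rewrite map_inj_in_uniq ?iota_uniq //; apply: label_rank_inj.
by have [|_] := uniq_min_size uniq_rank sub; rewrite ?size_map.
Qed.
End Ranks.

(** The terms other than the leading one remain smaller after relabelling and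
    sorting, so they cannot cancel it. *)
Lemma relabel_leading n r t0 cs sigma : defining_rel n r -> leading_term n r t0 cs ->
  permutes n sigma -> all (fun c => sigma c.1 < sigma c.2)%N cs ->
  leading_monomial (shuffle_form (relabel sigma r)) (sort_tree (tree_relabel sigma t0)).2.
Proof.
move=> rn [l rl [t0n csn ln lead]] sn lt.
set s0 := (sort_tree _).2.
have tn t : perm_eq (leaves t) (iota 1 n) -> perm_eq (leaves (tree_relabel sigma t)) (iota 1 n).
  exact: permutes_relabel.
have un t : perm_eq (leaves t) (iota 1 n) -> uniq (leaves t).
  by move=> /perm_uniq->; apply: iota_uniq.
have [_ [[p0 _ _] _]] := sortP (un _ (tn _ t0n)).
have s0n : perm_eq (leaves s0) (iota 1 n) by apply: perm_trans p0 (tn _ t0n).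
have less0 p : p \in l -> less (sort_tree (tree_relabel sigma p.2)).2 s0.
  move=> pl; have pn := ln p pl.
  have l1 : less (tree_relabel sigma p.2) (tree_relabel sigma t0).
    apply: less_subst (un _ (tn _ t0n)) _; first by rewrite (permPl pn) perm_sym.
    exact: lead.
  have [_ [same0 _]] := sortP (un _ (tn _ t0n)).
  have [_ [same _]] := sortP (un _ (tn _ pn)).
  by apply: (less_same_shapel same); apply: less_same_shape l1; apply: same_shape_sym.
pose F t := (sort_tree (tree_relabel sigma t)).1 *: << (sort_tree (tree_relabel sigma t)).2 >> : treeMod.
have E : shuffle_form (relabel sigma r) = F t0 + linext F (lincomb60 l).
  rewrite shuffle_formE relabelE /tsubst linext_comp rl -[(60, t0) :: l]cat1s lincomb60_cat linearD.
  by congr (_ + _); rewrite [LHS]linext_lincomb big_seq1 /= divff // scale1r.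
have rest : supported (fun t => less t s0) (linext F (lincomb60 l)).
  apply: supported_linext => t.
  have lP : supported (fun t => exists2 p, p \in l & t = p.2) (lincomb60 l).
    by apply: supported_lincomb => _ /mapP[p pl ->]; exists p.
  move=> /lP[p pl ->]; apply: supportedZ; apply: supportedU; exact: less0.
rewrite E; split.
  rewrite -mcoeff_neq0 mcoeffD mcoeffZ mcoeffUU mulr1.
  have -> : (linext F (lincomb60 l))@_s0 = 0.
    by apply/eqP; rewrite mcoeff_eq0; apply/negP => /rest/less_irrefl.
  rewrite addr0; apply/eqP => c0; have := sort_sign (tree_relabel sigma t0).
  by rewrite c0 mul0r => /esym/eqP; rewrite oner_eq0.
move=> s /(fsubsetP (msuppD_le _ _)); rewrite inE => /orP[|/rest ls _].
  by move=> /(fsubsetP (msuppZ_le _ _)); rewrite msuppU oner_eq0 inE => ->.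
exact: less_tree_lt s0n ls.
Qed.

(** The inputs of the relation are renumbered in the order of the minimal leaves
    of the trees substituted for them; the instance is then an increasing
    substitution in a shuffle relation. *)
Lemma root_divides t : root_instance t ->
  exists m g s, [/\ shuffle_rel m g, leading_monomial g s & divides s t].
Proof.
move=> [n [r [t0 [cs [s [[rn lead] us lt sh <-]]]]]].
have [l rl [t0n csn ln _]] := lead.
pose m := min_leaf \o s.
have m_inj : {in iota 1 n &, injective m}.
  move=> i j; rewrite -!(perm_mem t0n) => it jt e.
  apply: leaf_subst_inj us it jt (min_leaf_in _) _.
  by rewrite -[min_leaf _]/(m i) e min_leaf_in.
pose sigma := label_rank m n; have sn : permutes n sigma by apply: label_rank_permutes.
exists n, (shuffle_form (relabel sigma r)), (sort_tree (tree_relabel sigma t0)).2.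
split; first exact: ShuffleRel.
  apply: (relabel_leading rn lead sn); apply/allP => c cc.
  have /andP[c1 c2] := allP csn c cc.
  by rewrite label_rank_mono //; apply: (allP lt c cc).
pose s' k := s (nth 0%N (iota 1 n) (index k [seq sigma i | i <- iota 1 n])).
have s'E i : i \in iota 1 n -> s' (sigma i) = s i.
  move=> iI; rewrite /s'; have [lti ltn] : (index i (iota 1 n) < size (iota 1 n))%N /\ True.
    by rewrite index_mem.
  rewrite -{1}(nth_index 0%N iI) -(nth_map 0%N 0%N sigma) // index_uniq ?size_map //.
    by rewrite nth_index.
  by rewrite (perm_uniq sn) iota_uniq.
have -> : tree_subst s t0 = tree_subst s' (tree_relabel sigma t0).
  rewrite tree_subst_comp; apply: eq_tree_subst => i; rewrite (perm_mem t0n) => iI /=.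
  by rewrite s'E.
have t1n := permutes_relabel sn t0n.
have surj k : k \in iota 1 n -> exists2 i, i \in iota 1 n & k = sigma i.
  by rewrite -(perm_mem sn) => /mapP[i iI ->]; exists i.
have inc : increasing_on s' (leaves (tree_relabel sigma t0)).
  move=> j k; rewrite !(perm_mem t1n) => /surj[j' jI ->] /surj[k' kI ->].
  by rewrite !s'E // label_rank_mono.
have u1 : uniq (leaves (tree_relabel sigma t0)) by rewrite (perm_uniq t1n) iota_uniq.
rewrite sort_subst //; last first.
  by move=> k; rewrite (perm_mem t1n) => /surj[i iI ->]; rewrite s'E // sh.
apply: div_root; have [_ [[p _ _] _]] := sortP u1.
by apply: increasing_sub inc => i; rewrite (perm_mem p).
Qed.

Lemma instance_divides t : has_instance t ->
  exists m g s, [/\ shuffle_rel m g, leading_monomial g s & divides s t].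
Proof.
elim=> {t} [t /root_divides//|a b _|a b _|a b c _|a b c _|a b c _] [m [g [s [mg gs sd]]]];
  exists m, g, s; split=> //.
- exact: div_nu1.
- exact: div_nu2.
- exact: div_mu1.
- exact: div_mu2.
exact: div_mu3.
Qed.

(** * Presentation and Groebner basis *)

Lemma identity_realize f : identity f -> realize f = 0.
Proof. by move=> f0; rewrite realizeE; exact: (f0 FA letter). Qed.

(** The normal form of an element of the kernel is in the kernel, hence zero by
    independence of the normal monomials. *)
Lemma kernel_realize n f : free_op n f -> realize f = 0 ->
  operad_ideal presentation_rel n f.
Proof.
move=> fn f0; have [g fg gn] := normal_form fn.
have g0 : g = 0.
  apply: (normal_free gn); rewrite -(eqmod_eval letter fg) -realizeE.
  exact: f0.
by apply: ideal_operad; move: fg; rewrite /eqmod g0 subr0.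
Qed.

(** If the leading monomial [t] of an element of the ideal were normal, then
    rewriting the smaller terms in normal form would give a combination of
    normal monomials in which [t] still has a nonzero coefficient, although it
    vanishes in the associative operad. *)
Lemma shuffle_groebner : groebner_basis shuffle_rel.
Proof.
move=> n f t fi [tf lead].
have fn := shuffle_ideal_op fi; have [sht tn] := fn t tf.
have ut : uniq (leaves t) by rewrite (perm_uniq tn) iota_uniq.
have [/instance_divides//|nt] := instance_or_normal sht ut.
pose f' := f - f@_t *: << t >>.
have f't : f'@_t = 0 by rewrite mcoeffB mcoeffZ mcoeffUU mulr1 subrr.
have [s sf'|g f'g gP] := @eqmod_termwise (iota 1 n)
    (fun s => normal_on n s /\ s <> t) f'.
  have st : s != t by apply: contraTneq sf' => ->; rewrite -mcoeff_eq0 f't.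
  have sf : s \in msupp f.
    move: sf'; rewrite -!mcoeff_neq0 mcoeffB mcoeffZ mcoeffU.
    by rewrite [t == s]eq_sym (negPf st) mulr0 subr0.
  have [shs sn] := fn s sf.
  have [h sh hP] := normal_form_shuffle shs sn; exists h => //.
  move=> v /hP[vn vs]; split=> // vt.
  case: vs => [vs|]; first by rewrite -vs vt eqxx in st.
  by rewrite vt ltnNge (rank_tree_lt sn tn (lead s sf st)).
have : f@_t *: << t >> + g = 0.
  apply: (@normal_free n).
    by apply: supportedD; [apply: supportedZ; apply: supportedU | move=> s /gP[]].
  rewrite linearD /= -(eqmod_eval letter f'g) -linearD /= /f' addrC subrK.
  exact: (shuffle_ideal_identity shuffle_rel_identity fi letter).
move=> /(congr1 (mcoeff t)); rewrite mcoeff0 mcoeffD mcoeffZ mcoeffUU mulr1.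
have -> : g@_t = 0 by apply/eqP; rewrite mcoeff_eq0; apply/negP => /gP[].
by rewrite addr0 => /eqP; rewrite mcoeff_eq0 tf.
Qed.

Theorem theorem3p4p1 :
  [/\ (* the operations generated by nu2 and mu3 are the invariants *)
      forall (n : nat) (a : freeAlg),
        As_inv n a <-> (exists2 f : treeMod, free_op n f & realize f = a),
      (* the given relations define them *)
      forall (n : nat) (f : treeMod), free_op n f ->
        (realize f = 0 <-> operad_ideal presentation_rel n f)
    & groebner_basis shuffle_rel].
Proof.
split=> [n a|n f fn|]; last exact: shuffle_groebner.
  split=> [|[f fn <-]]; [exact: As_inv_attained | exact: realize_inv].
split; first exact: kernel_realize.
by move=> /(operad_ideal_identity presentation_rel_identity)/identity_realize.
Qed.
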